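(* Let $m,n\in\mathbb{N}\setminus\{0\}$ and $p\in(\mathbb{N}\setminus\{0\})\cup\{\infty\}$ with $p\ge\max\{m,2\}$. For $i\in\{1,\ldots,n\}$ let $f_i\colon\mathbb{R}^m\to\mathbb{R}$ be continuous and piecewise-$C^p$ with representation $(\{P_i^j\}_{j=1}^{J_i},\{f_i^j\}_{j=1}^{J_i})$ and piecewise gradient $\widetilde\nabla f_i$ with respect to this representation. Let $f=\frac1n\sum_{i=1}^n f_i$ and assume that $f$ is bounded below. Let $(i_k)_{k\in\mathbb{N}}$ be the i.i.d. random indices, uniformly distributed on $\{1,\ldots,n\}$, on the probability space $(\Omega,\mathcal F,\mathbb P)$ described in the context. Let $(\alpha_k)_{k\in\mathbb{N}}$ be positive real numbers with $\sum_{k=0}^\infty\alpha_k=\infty$ and $\alpha_k=o(1/\log k)$ as $k\to\infty$. Suppose that, for all $i\in\{1,\ldots,n\}$, the interface $$\mathcal I_i\coloneqq\bigcup_{\substack{j,\ell\in\{1,\ldots,J_i\}\\ j\ne\ell}}\bigl(\operatorname{cl}P_i^j\cap\operatorname{cl}P_i^\ell\bigr)$$ is Lebesgue negligible. Then there exists $\Gamma\subset(0,\infty)$ of full Lebesgue measure such that, for Lebesgue-almost every $c>0$, $c\alpha_k\in\Gamma$ for all $k\in\mathbb{N}$. For each such $c>0$ (i.e. each $c>0$ with $c\alpha_k\in\Gamma$ for all $k$), there exists $G\subset\mathbb{R}^m$ of full Lebesgue measure with the following property: if $x_0\in G$ and the iterates generated by $$x_{k+1}=x_k-c\,\alpha_k\widetilde\nabla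 f_{i_k}(x_k),\qquad k\in\mathbb{N},$$ are bounded $\mathbb P$-almost surely, then $\mathbb P$-almost surely $$\lim_{k\to\infty}\operatorname{dist}\bigl(x_k,\{x\in\mathbb{R}^m:0\in\partial^c f(x)\}\bigr)=0,$$ and the sequence of function values $(f(x_k))_{k\in\mathbb{N}}$ converges. Moreover, the set of limit points of $(x_k)_{k\in\mathbb{N}}$ is connected ($\mathbb P$-almost surely).
   Context: A continuous function $g\colon\mathbb{R}^m\to\mathbb{R}$ is piecewise-$C^p$ if there exist a finite Borel partition $\mathbb{R}^m=\bigsqcup_{j=1}^J P^j$ (nonempty, pairwise disjoint Borel sets) and $C^p$ functions $g^1,\ldots,g^J\colon\mathbb{R}^m\to\mathbb{R}$ with $g(x)=g^j(x)$ whenever $x\in P^j$; the pair $(\{P^j\},\{g^j\})$ is a representation of $g$. The piecewise gradient of $g$ with respect to this representation is $\widetilde\nabla g(x)=\nabla g^j(x)$ for $x\in P^j$. Such functions are locally Lipschitz. The Clarke subdifferential of a locally Lipschitz $\varphi\colon\mathbb{R}^m\to\mathbb{R}$ is $\partial^c\varphi(x)=\operatorname{conv}\{u:\exists(x_\ell)\subset\Omega_\varphi,\ x_\ell\to x,\ \nabla\varphi(x_\ell)\to u\}$, where $\Omega_\varphi$ is the (full-measure) set of points of differentiability of $\varphi$ and $\operatorname{conv}$ is the convex hull. Probability setting: $(\Omega_0,\mathcal F_0,\mathbb P^0)$ is a probability space with a random variable $\iota\colon\Omega_0\to\{1,\ldots,n\}$ satisfying $\mathbb P^0(\iota=\ell)=1/n$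 for each $\ell$. Set $\Omega=\Omega_0^{\mathbb N}$, $\mathcal F=\mathcal F_0^{\otimes\mathbb N}$, $\mathbb P=(\mathbb P^0)^{\otimes\mathbb N}$, and $i_k(\omega)=\iota(\omega_k)$ for $\omega=(\omega_0,\omega_1,\ldots)$; thus the $i_k$ are i.i.d. uniform on $\{1,\ldots,n\}$. ''Full Lebesgue measure'' means that the complement (in $(0,\infty)$, resp. $\mathbb{R}^m$) is Lebesgue null. $\operatorname{dist}(x,S)=\inf\{\|x-y\|:y\in S\}$, with $\operatorname{dist}(x,\varnothing)=\infty$. $\operatorname{cl}$ is the closure. A limit point of $(x_k)$ is a limit of a convergent subsequence. *)

(* Defs.v *)
From HB Require Import structures.
From mathcomp Require Import all_boot all_order all_algebra.
From mathcomp Require Import all_classical all_reals all_analysis.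

Set Implicit Arguments.
Unset Strict Implicit.
Unset Printing Implicit Defensive.

Import Order.TTheory GRing.Theory Num.Theory.
Import numFieldNormedType.Exports.

Local Open Scope classical_set_scope.
Local Open Scope ring_scope.

Section Euclidean.
Context {R : realType} {m : nat}.
Implicit Types (x y : 'rV[R]_m) (g : 'rV[R]_m -> R).

(* The library norm on 'rV[R]_m is the sup norm; this is the Euclidean one. *)
Definition enorm x : R := Num.sqrt (\sum_(i < m) x 0 i ^+ 2).

(* The infimum of the empty set in \bar R is +oo. *)
Definition dist_to x (S : set 'rV[R]_m) : \bar R :=
  ereal_inf [set (enorm (x - y))%:E | y in S].

Definition gradient g x : 'rV[R]_m :=
  \row_(i < m) 'D_(delta_mx 0 i) g x.

(* Existence and continuity of all iterated partial derivatives up to order k. *)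
Fixpoint continuously_differentiable (k : nat) g : Prop :=
  if k is k'.+1 then
    continuous g /\
    forall i : 'I_m, (forall x, derivable g x (delta_mx 0 i)) /\
      continuously_differentiable k' ('D_(delta_mx 0 i) g)
  else continuous g.

(* Regularity exponents live in option nat, None standing for infinity. *)
Definition class_C (p : option nat) g : Prop :=
  if p is Some k then continuously_differentiable k g
  else forall k, continuously_differentiable k g.

Definition le_exponent (k : nat) (p : option nat) : bool :=
  if p is Some q then (k <= q)%N else true.

Definition borel_set : set (set 'rV[R]_m) := <<s [set U | open U] >>.

Definition borel_partition (J : nat) (P : 'I_J -> set 'rV[R]_m) : Prop :=
  [/\ forall j, borel_set (P j),
      forall j, P j !=set0,
      trivIset setT P
    & \bigcup_j P j = setT].

Definition piecewise_representation (p : option nat) g (J : nat)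
    (P : 'I_J -> set 'rV[R]_m) (gs : 'I_J -> 'rV[R]_m -> R) : Prop :=
  [/\ continuous g,
      borel_partition P,
      forall j, class_C p (gs j)
    & forall j x, P j x -> g x = gs j x].

(* For a partition P the sum has exactly one term. *)
Definition piecewise_gradient (J : nat) (P : 'I_J -> set 'rV[R]_m)
    (gs : 'I_J -> 'rV[R]_m -> R) x : 'rV[R]_m :=
  \sum_(j < J | x \in P j) gradient (gs j) x.

Definition interface (J : nat) (P : 'I_J -> set 'rV[R]_m) : set 'rV[R]_m :=
  \bigcup_(jl in [set jl : 'I_J * 'I_J | jl.1 != jl.2])
    (closure (P jl.1) `&` closure (P jl.2)).

Definition convex_hull (A : set 'rV[R]_m) : set 'rV[R]_m :=
  [set u | exists (N : nat) (t : 'I_N -> R) (v : 'I_N -> 'rV[R]_m),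
    [/\ forall i, 0 <= t i, \sum_(i < N) t i = 1, forall i, A (v i)
      & u = \sum_(i < N) t i *: v i]].

Definition clarke_subdifferential g x : set 'rV[R]_m :=
  convex_hull [set u | exists xs : nat -> 'rV[R]_m,
    [/\ forall l, differentiable g (xs l),
        xs l @[l --> \oo] --> x
      & gradient g (xs l) @[l --> \oo] --> u]].

Definition limit_points (xs : nat -> 'rV[R]_m) : set 'rV[R]_m :=
  [set y | exists phi : nat -> nat,
    {homo phi : k l / (k < l)%N} /\ xs (phi k) @[k --> \oo] --> y].

Definition box (a b : 'rV[R]_m) : set 'rV[R]_m :=
  [set x | forall i, a 0 i <= x 0 i <= b 0 i].

(* m-dimensional Lebesgue outer measure, by countable covers with boxes. *)
Definition lebesgue_outer (A : set 'rV[R]_m) : \bar R :=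
  ereal_inf [set v | exists a b : nat -> 'rV[R]_m,
    [/\ forall k i, a k 0 i <= b k 0 i,
        A `<=` \bigcup_k box (a k) (b k)
      & v = (\sum_(0 <= k <oo) (\prod_(i < m) (b k 0 i - a k 0 i))%:E)%E]].

Definition lebesgue_null (A : set 'rV[R]_m) : Prop := lebesgue_outer A = 0%E.

End Euclidean.

Section InfiniteProduct.
Context {d0 : measure_display} {T0 : measurableType d0}.

Definition coordinate_preimages : set (set (nat -> T0)) :=
  \bigcup_k preimage_set_system setT (fun w : nat -> T0 => w k) measurable.

(* nat -> T0 with the product sigma-algebra. *)
Definition infinite_product := g_sigma_algebraType coordinate_preimages.

(* The defining (and characterizing) property of the power of P0. *)
Definition is_product_measure (R : realType) (P0 : probability T0 R)
    (P : probability infinite_product R) : Prop :=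
  forall (N : nat) (A : nat -> set T0), (forall k, measurable (A k)) ->
    P [set w : infinite_product | forall k, (k < N)%N -> A k (w k)] =
    (\prod_(k < N) P0 (A k))%E.

End InfiniteProduct.
Arguments infinite_product {d0} T0.

Fixpoint sgd (R : realType) (m n : nat) (grad : 'I_n -> 'rV[R]_m -> 'rV[R]_m)
    (step : nat -> R) (idx : nat -> 'I_n) (x0 : 'rV[R]_m) (k : nat) : 'rV[R]_m :=
  if k is k'.+1 then
    let x := sgd grad step idx x0 k' in x - step k' *: grad (idx k') x
  else x0.

(* Main.v *)
(** Off the interfaces f coincides locally with one of finitely many averages
    g_j of smooth pieces, so x_k is a noisy Euler scheme for the inclusion
    gamma' in - conv {grad g_j (gamma) : gamma in C_j}, with C_j the closure of
    the open set where f = g_j.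

    - Noise. Conditionally centred increments of size O(a_k) with
      a_k = o(1 / log k) have, by Chernoff's bound with th = 4 ln k / eta, window
      sums exceeding eta with probability at most k^-2; Borel-Cantelli applies.
    - Descent. Along an ultrafilter the interpolated iterates converge to a
      Lipschitz curve gamma. The integrated inclusion gives
      f (gamma T) - f (gamma 0) <= - |gamma T - gamma 0|^2 / T, because the
      Lipschitz function f (gamma) - g_j (gamma) does not vary on its zero set,
      which contains the times spent on the piece j; by Gordan's alternative the
      decrease is strict from a point where 0 is not in the hull.
    - Sard. The critical values of f contain no interval. After Taylor expansion
      on small cubes this is a statement about near critical values of
      polynomials of bounded degree, where quantifier elimination bounds the
      number of alternations of a definable selection uniformly in the
      coefficients. Hence f (x_k) cannot oscillate, so it converges and every
      limit point is critical.
    - Step sizes. x - al grad g (x) pulls null sets back to null sets unless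
      1 / al is an eigenvalue of the Hessian of g on a set of positive measure;
      since a point carries at most m eigenvalues, this excludes only countably
      many al. So for almost every x_0 no iterate meets an interface. *)

Require Import Defs.
From HB Require Import structures.
From mathcomp Require Import all_boot all_order all_algebra.
From mathcomp Require Import all_classical all_reals all_analysis.
From mathcomp Require Import measurable_realfun lra ring zify.
From mathcomp Require ordered_qelim qe_rcf.

Set Implicit Arguments.
Unset Strict Implicit.
Unset Printing Implicit Defensive.

Import Order.TTheory GRing.Theory Num.Theory.
Import numFieldNormedType.Exports.

Local Open Scope classical_set_scope.
Local Open Scope ring_scope.

(** A critical point is critical only for a convex combination of pieces that agree there, so the
    statement of Sard's theorem for a single C^m function does not apply as it stands. On a cube of
    size eps, Taylor expansion costs o(eps^m) in the values and o(eps^(m-1)) in the gradients. It is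
    therefore enough that near critical values of polynomials, with gradient tolerance delta and
    value tolerance delta * eps, contain at most N points spaced by more than C * delta * eps, where
    N and C depend only on the dimension, the degree and the number of pieces. A bounded domain
    needs order eps^(-m) cubes, and this is why m derivatives are enough.

    Ultrafilters replace subsequences: all bounded sequences converge along the same one, so the
    positions at every time, the times spent on the pieces and the hitting times have limits without
    diagonal extraction or equicontinuity.

    Null sets are handled through covers by cubes, with bounds on finite sums. The counting of
    eigenvalues on a set of positive measure then becomes a count of grid cells, and no integration
    in dimension m is involved. *)

Module ord := ordered_qelim.ord.

(** * Alternations of definable sets *)

Definition changes (b : nat -> bool) (K : nat) : nat :=
  count (fun i => b i != b i.+1) (iota 0 K).

Lemma count_orl (T : Type) (a a1 a2 : pred T) (s : seq T) :
  (forall x, a x -> a1 x || a2 x) -> (count a s <= count a1 s + count a2 s)%N.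
Proof.
move=> h; rewrite -count_predUI; apply: (leq_trans _ (leq_addr _ _)).
exact: sub_count.
Qed.

Lemma changes_sub (b b1 b2 : nat -> bool) K :
  (forall i j, b i != b j -> (b1 i != b1 j) || (b2 i != b2 j)) ->
  (changes b K <= changes b1 K + changes b2 K)%N.
Proof. by move=> h; apply: count_orl => i; apply: h. Qed.

(** Each change of sign puts a root in the closed interval between [v i] and [v i.+1]. Neighbouring
    intervals may share a root at their common end, whereas intervals with indices of equal parity
    are disjoint; hence the factor 2. *)
Lemma changes_sign (R : rcfType) (p : {poly R}) (v : nat -> R) K :
  {homo v : i j / (i < j)%N >-> i < j} ->
  (count (fun i => Num.sg p.[v i] != Num.sg p.[v i.+1]) (iota 0 K)
    <= (size p).*2)%N.
Proof.
move=> vhomo; have [->|p0] := eqVneq p 0.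
  rewrite (eq_count (a2 := pred0)) ?count_pred0 // => i.
  by rewrite /= !horner0 eqxx.
set a := fun i : nat => _.
have /choice[r rP] : forall i, exists r, a i ->
    [/\ v i <= r, r <= v i.+1 & root p r].
  move=> i; case ai : (a i); last by exists 0.
  have vi : v i <= v i.+1 by rewrite ltW // vhomo.
  have [p0v|pv] := lerP p.[v i] 0.
    have [q0v|qv] := lerP 0 p.[v i.+1].
      have [|r /andP[hr1 hr2] rr] := @poly_ivt _ p _ _ vi; first by rewrite p0v q0v.
      by exists r => _; split.
    have [|r /andP[hr1 hr2] rr] := @poly_ivt _ (- p) _ _ vi; last first.
      by exists r => _; split=> //; rewrite -rootN.
    rewrite !hornerN oppr_le0 oppr_ge0 (ltW qv) andbT.
    move: p0v; rewrite le_eqVlt => /orP[/eqP->//|p0v].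
    by move: ai; rewrite /a !ltr0_sg ?eqxx.
  have [q0v|qv] := lerP p.[v i.+1] 0; last first.
    by move: ai; rewrite /a !gtr0_sg ?eqxx.
  have [|r /andP[hr1 hr2] rr] := @poly_ivt _ (- p) _ _ vi; last first.
    by exists r => _; split=> //; rewrite -rootN.
  by rewrite !hornerN oppr_le0 oppr_ge0 q0v (ltW pv).
have par (e : bool) : (count (fun i => a i && (odd i == e)) (iota 0 K)
    <= size p)%N.
  rewrite -size_filter -(size_map r); apply/ltnW/max_poly_roots => //.
    apply/allP => x /mapP[i]; rewrite mem_filter => /andP[/andP[ai _] _] ->.
    by case: (rP i ai).
  rewrite map_inj_in_uniq ?filter_uniq ?iota_uniq //.
  have aux i j : a i && (odd i == e) -> a j && (odd j == e) -> (i < j)%N ->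
      r i < r j.
    move=> /andP[/rP[_ ri _] /eqP oi] /andP[/rP[rj _ _] /eqP oj] ij.
    apply: (le_lt_trans ri); apply: (lt_le_trans _ rj); apply: vhomo.
    rewrite ltn_neqAle ij andbT; apply/eqP => ji.
    by move: oj; rewrite -ji /= oi; case: (e).
  move=> i j; rewrite !mem_filter => /andP[hi _] /andP[hj _] rij.
  have [ij|ji|//] := ltngtP i j.
    by have := aux _ _ hi hj ij; rewrite rij ltxx.
  by have := aux _ _ hj hi ji; rewrite rij ltxx.
rewrite -addnn; apply: leq_trans (leq_add (par true) (par false)).
by apply: count_orl => i ai; rewrite ai /=; case: (odd i).
Qed.

Section Definable.
Variable R : rcfType.
Implicit Types (env : nat -> R) (e : seq R).

(** Formulas are evaluated in lists, so a predicate on infinite environments is tested only on lists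
    padded with 0. *)
Definition definable (A : (nat -> R) -> Prop) : Prop :=
  exists phi : ord.formula R, forall e, ord.holds e phi <-> A (nth 0 e).

Definition definable_fun (t : (nat -> R) -> R) : Prop :=
  exists T : GRing.term R, forall e, GRing.eval e T = t (nth 0 e).

Definition upd env (i : nat) (x : R) : nat -> R :=
  fun j => if j == i then x else env j.

Definition upd_block env (b q : nat) (u : nat -> R) : nat -> R :=
  fun j => if (b <= j < b + q)%N then u (j - b)%N else env j.

Lemma nth_set_nthE e i x : nth 0 (set_nth 0 e i x) = upd (nth 0 e) i x.
Proof. by apply/funext => j; rewrite nth_set_nth. Qed.

Lemma definable_fun_var i : definable_fun (fun env => env i).
Proof. by exists (GRing.Var _ i). Qed.

Lemma definable_fun_nat k : definable_fun (fun _ => k%:R).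
Proof. by exists (GRing.NatConst _ k). Qed.

Lemma definable_funD s t : definable_fun s -> definable_fun t ->
  definable_fun (fun env => s env + t env).
Proof. by move=> [S hS] [T hT]; exists (GRing.Add S T) => e /=; rewrite hS hT. Qed.

Lemma definable_funM s t : definable_fun s -> definable_fun t ->
  definable_fun (fun env => s env * t env).
Proof. by move=> [S hS] [T hT]; exists (GRing.Mul S T) => e /=; rewrite hS hT. Qed.

Lemma definable_funN s : definable_fun s -> definable_fun (fun env => - s env).
Proof. by move=> [S hS]; exists (GRing.Opp S) => e /=; rewrite hS. Qed.

Lemma definable_funB s t : definable_fun s -> definable_fun t ->
  definable_fun (fun env => s env - t env).
Proof. by move=> hs ht; apply: definable_funD => //; apply: definable_funN. Qed.

Lemma definable_fun_sum (I : Type) (r : seq I) (t : I -> (nat -> R) -> R) :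
  (forall i, definable_fun (t i)) ->
  definable_fun (fun env => \sum_(i <- r) t i env).
Proof.
move=> ht; elim: r => [|i r IH].
  have -> : (fun env => \sum_(i <- [::]) t i env) = fun=> 0%:R.
    by apply/funext => e; rewrite big_nil.
  exact: definable_fun_nat.
have -> : (fun env => \sum_(j <- i :: r) t j env) =
    fun env => t i env + \sum_(j <- r) t j env.
  by apply/funext => e; rewrite big_cons.
exact: definable_funD.
Qed.

Lemma definable_le s t : definable_fun s -> definable_fun t ->
  definable (fun env => s env <= t env).
Proof. by move=> [S hS] [T hT]; exists (ord.Le S T) => e /=; rewrite hS hT. Qed.

Lemma definable_eq s t : definable_fun s -> definable_fun t ->
  definable (fun env => s env = t env).
Proof. by move=> [S hS] [T hT]; exists (ord.Equal S T) => e /=; rewrite hS hT. Qed.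

Lemma definable_and A B : definable A -> definable B ->
  definable (fun env => A env /\ B env).
Proof.
by move=> [S hS] [T hT]; exists (ord.And S T) => e /=; rewrite hS hT.
Qed.

Lemma definable_imply A B : definable A -> definable B ->
  definable (fun env => A env -> B env).
Proof.
by move=> [S hS] [T hT]; exists (ord.Implies S T) => e /=; rewrite hS hT.
Qed.

Lemma definable_exists A i : definable A ->
  definable (fun env => exists x, A (upd env i x)).
Proof.
move=> [S hS]; exists (ord.Exists i S) => e /=.
by split=> -[x hx]; exists x; move: hx; rewrite hS nth_set_nthE.
Qed.

Lemma definable_true : definable (fun _ : nat -> R => True).
Proof. by exists (ord.Bool true). Qed.

Lemma definable_all (I : finType) (A : I -> (nat -> R) -> Prop) :
  (forall i, definable (A i)) -> definable (fun env => forall i, A i env).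
Proof.
move=> hA.
suff h (r : seq I) : definable (fun env => forall i, i \in r -> A i env).
  have [phi hphi] := h (enum I); exists phi => e; rewrite hphi.
  by split=> H i; [apply: H; rewrite mem_enum|].
elim: r => [|i r [phi hphi]].
  by have [phi hphi] := definable_true; exists phi => e; rewrite hphi.
have [psi hpsi] := hA i; exists (ord.And psi phi) => e /=; rewrite hphi hpsi.
split=> [[h1 h2] j|h].
  by rewrite inE => /orP[/eqP->//|]; apply: h2.
by split=> [|j jr]; apply: h; rewrite inE ?eqxx // jr orbT.
Qed.

Lemma upd_blockS env b q u :
  upd_block env b q.+1 u = upd_block (upd env (b + q)%N (u q)) b q u.
Proof.
apply/funext => j; rewrite /upd_block /upd addnS ltnS.
have [bj|jb] := leqP b j; rewrite /=; last first.
  by case: eqP => // E; move: jb; rewrite E ltnNge leq_addr.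
rewrite leq_eqVlt.
by have [->|jb] := eqVneq j (b + q)%N; rewrite ?ltnn ?orbT //= addKn.
Qed.

Lemma upd_block_ext env b q u u' : (forall i, (i < q)%N -> u i = u' i) ->
  upd_block env b q u = upd_block env b q u'.
Proof.
move=> uu; apply/funext => j; rewrite /upd_block.
by case: ifP => // /andP[bj jb]; apply: uu; rewrite ltn_subLR.
Qed.

Lemma definable_exists_block A b q : definable A ->
  definable (fun env => exists u : nat -> R, A (upd_block env b q u)).
Proof.
move=> hA; elim: q => [|q IH].
  have [phi hphi] := hA; exists phi => e; rewrite hphi.
  have E u : upd_block (nth 0 e) b 0 u = nth 0 e.
    apply/funext => j; rewrite /upd_block addn0.
    by case: ifP => // /andP[bj]; rewrite ltnNge bj.
  by split=> [h|[u]]; [exists (fun=> 0); rewrite E|rewrite E].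
have [phi hphi] := definable_exists (b + q)%N IH; exists phi => e; rewrite hphi.
split=> [[x [u hu]]|[u hu]].
  exists (fun i => if i == q then x else u i); rewrite upd_blockS eqxx.
  rewrite (@upd_block_ext _ _ _ _ u) // => i iq.
  by case: eqP => // E; rewrite E ltnn in iq.
by exists (u q), u; rewrite -upd_blockS.
Qed.

Lemma definable_forall_block A b q : definable A ->
  definable (fun env => forall u : nat -> R, A (upd_block env b q u)).
Proof.
move=> hA; have nA : definable (fun env => ~ A env).
  by have [phi h] := hA; exists (ord.Not phi) => e /=; rewrite h.
have [phi h] := definable_exists_block b q nA; exists (ord.Not phi) => e /=.
rewrite h; split=> [H u|H [u]]; last by apply.
by apply: contrapT => hu; apply: H; exists u.
Qed.

(** An atom depends on the sign of a difference of terms, which is a polynomial in the variable 0.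
    The size of its formal version [T] bounds its degree whatever the values of the other variables;
    connectives add the bounds. *)
Lemma changes_rformula (phi : ord.formula R) :
  ord.qf_form phi && ord.rformula phi ->
  exists N, forall e (v : nat -> R) K,
    {homo v : i j / (i < j)%N >-> i < j} ->
    (changes (fun i => ord.qf_eval (set_nth 0%R e 0%N (v i)) phi) K <= N)%N.
Proof.
have atom (t1 t2 : GRing.term R) (op : R -> R -> bool) :
    (forall x y x' y', Num.sg (x - y) = Num.sg (x' - y') -> op x y = op x' y') ->
    GRing.rterm t1 -> GRing.rterm t2 ->
  exists N, forall e (v : nat -> R) K,
    {homo v : i j / (i < j)%N >-> i < j} ->
    (changes (fun i => op (GRing.eval (set_nth 0%R e 0%N (v i)) t1)
       (GRing.eval (set_nth 0%R e 0%N (v i)) t2)) K <= N)%N.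
  move=> hop r1 r2; pose t := GRing.Add t1 (GRing.Opp t2).
  have rt : GRing.rterm t by rewrite /= r1.
  pose T := qe_rcf.abstrX 0%N (qe_rcf.to_rterm t).
  exists (size T).*2 => e v K hv.
  have E x : GRing.eval (set_nth 0%R e 0%N x) t1 - GRing.eval (set_nth 0%R e 0%N x) t2
      = (qe_rcf.eval_poly e T).[x].
    by rewrite qe_rcf.abstrXP qe_rcf.evalE qe_rcf.to_rtermE.
  have sT : (size (qe_rcf.eval_poly e T) <= size T)%N.
    by rewrite qe_rcf.eval_polyP (leq_trans (size_Poly _)) // size_map.
  apply: (@leq_trans (size (qe_rcf.eval_poly e T)).*2); last by rewrite leq_double.
  apply: leq_trans (changes_sign (qe_rcf.eval_poly e T) K hv).
  apply: sub_count => i; apply: contraNneq => sE; apply/eqP/hop.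
  by rewrite !E.
elim: phi => //=.
- move=> b _; exists 0%N => e v K _; rewrite /changes.
  rewrite (eq_count (a2 := pred0)) ?count_pred0 // => i.
  by rewrite /= eqxx.
- move=> t1 t2 /andP[r1 r2]; apply: (atom t1 t2 (fun x y => x == y)) => //.
  move=> x y x' y' h; rewrite -subr_eq0 -[RHS]subr_eq0.
  by rewrite -sgr_eq0 h sgr_eq0.
- move=> t1 t2 /andP[r1 r2]; apply: (atom t1 t2 (fun x y => x < y)) => //.
  by move=> x y x' y' h; rewrite -subr_lt0 -[RHS]subr_lt0 -sgr_lt0 h sgr_lt0.
- move=> t1 t2 /andP[r1 r2]; apply: (atom t1 t2 (fun x y => x <= y)) => //.
  by move=> x y x' y' h; rewrite -subr_le0 -[RHS]subr_le0 -sgr_le0 h sgr_le0.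
- move=> f1 IH1 f2 IH2 /andP[/andP[q1 q2] /andP[r1 r2]].
  have [N1 h1] := IH1 (introT andP (conj q1 r1)).
  have [N2 h2] := IH2 (introT andP (conj q2 r2)).
  exists (N1 + N2)%N => e v K hv.
  apply: leq_trans (leq_add (h1 e v K hv) (h2 e v K hv)).
  by apply: changes_sub => i j; do !case: (ord.qf_eval _ _).
- move=> f1 IH1 f2 IH2 /andP[/andP[q1 q2] /andP[r1 r2]].
  have [N1 h1] := IH1 (introT andP (conj q1 r1)).
  have [N2 h2] := IH2 (introT andP (conj q2 r2)).
  exists (N1 + N2)%N => e v K hv.
  apply: leq_trans (leq_add (h1 e v K hv) (h2 e v K hv)).
  by apply: changes_sub => i j; do !case: (ord.qf_eval _ _).
- move=> f1 IH1 f2 IH2 /andP[/andP[q1 q2] /andP[r1 r2]].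
  have [N1 h1] := IH1 (introT andP (conj q1 r1)).
  have [N2 h2] := IH2 (introT andP (conj q2 r2)).
  exists (N1 + N2)%N => e v K hv.
  apply: leq_trans (leq_add (h1 e v K hv) (h2 e v K hv)).
  by apply: changes_sub => i j; do !case: (ord.qf_eval _ _).
move=> f IH hf; have [N h] := IH hf; exists N => e v K hv.
apply: leq_trans (h e v K hv); apply: sub_count => i.
by do !case: (ord.qf_eval _ _).
Qed.

(* Quantifier elimination makes the bound uniform in the parameters. *)
Lemma definable_changes A : definable A ->
  exists N, forall e (v : nat -> R) K,
    {homo v : i j / (i < j)%N >-> i < j} ->
    (changes (fun i => `[< A (upd (nth 0%R e) 0%N (v i)) >]) K <= N)%N.
Proof.
move=> [phi hphi].
pose psi := ord.quantifier_elim
  (fun n s => qe_rcf.qfr_to_formula (@qe_rcf.wproj R n s)) (ord.to_rform phi).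
have psiP := ord.quantifier_elim_wf (@qe_rcf.wf_QE_wproj R)
  (ord.to_rform_rformula phi).
have [N hN] := changes_rformula psiP; exists N => e v K hv.
apply: leq_trans (hN e v K hv).
rewrite leq_eqVlt; apply/orP; left; apply/eqP; apply: eq_count => i.
suff E x : `[< A (upd (nth 0%R e) 0%N x) >] = ord.qf_eval (set_nth 0%R e 0%N x) psi.
  by rewrite !E.
rewrite -nth_set_nthE; apply/asboolP/idP.
  by move=> /hphi /(qe_rcf.rcf_satP).
by move=> h; apply/hphi/qe_rcf.rcf_satP.
Qed.

End Definable.

(** * Row vectors and ultrafilter limits *)

Section RowVectors.
Context {R : realType} {m : nat}.
Implicit Types (x y : 'rV[R]_m).

Lemma ler_coord_norm x i : `|x 0 i| <= `|x|.
Proof.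
rewrite [leRHS]/Num.norm /= mx_normrE.
exact: (le_bigmax _ (fun ij => `|x ij.1 ij.2|) (ord0, i)).
Qed.

Lemma rV_norm_leP x (M : R) : 0 <= M ->
  (forall i, `|x 0 i| <= M) -> `|x| <= M.
Proof.
move=> M0 h; rewrite [leLHS]/Num.norm /= mx_normrE.
by apply/bigmax_leP; split=> // -[i j] _ /=; rewrite (ord1 i).
Qed.

Lemma cvg_rV (T : Type) (F : set_system T) {FF : Filter F} (x : T -> 'rV[R]_m)
  (l : 'rV[R]_m) :
  (forall i, x t 0 i @[t --> F] --> l 0 i) -> x t @[t --> F] --> l.
Proof.
move=> h; apply/cvgrPdist_le => e e0.
have : \forall t \near F, forall i, `|l 0 i - x t 0 i| <= e.
  by apply: filter_forall => i; move/cvgrPdist_le : (h i); exact.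
apply: filterS => t ht; apply: rV_norm_leP => [|i]; first exact: ltW.
by rewrite !mxE.
Qed.

Lemma cvg_coord (T : Type) (F : set_system T) {FF : Filter F}
  (x : T -> 'rV[R]_m) (l : 'rV[R]_m) i :
  x t @[t --> F] --> l -> x t 0 i @[t --> F] --> l 0 i.
Proof.
move=> h; apply/cvgrPdist_le => e e0; move/cvgrPdist_le : h => /(_ e e0).
apply: filterS => t; apply: le_trans.
by have := ler_coord_norm (l - x t) i; rewrite !mxE.
Qed.

End RowVectors.

Section Ultra.
Context {R : realType}.

(** Stands for the extraction of a subsequence with indices in [A]. *)
Lemma ultra_infinite (A : set nat) :
  (forall N, exists2 k, (N <= k)%N & A k) ->
  exists U : set_system nat, [/\ UltraFilter U, \oo `<=` U & U A].
Proof.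
move=> hA; pose F := within A \oo.
have FF : ProperFilter F.
  apply: Build_ProperFilter_ex => B [N _ hN]; have [k Nk Ak] := hA N.
  by exists k; apply: hN.
have [U [UU FU]] := ultraFilterLemma FF; exists U; split=> //.
  by move=> B hB; apply: FU; move: hB; apply: filterS => k Bk _.
by apply: FU; apply: withinT.
Qed.

Lemma ultra_cvg_rV (m : nat) (U : set_system nat) (UU : UltraFilter U)
  (x : nat -> 'rV[R]_m) (M : R) : (forall k, `|x k| <= M) ->
  exists l, x k @[k --> U] --> (l : 'rV[R]_m).
Proof.
move=> xM; pose A : set 'rV[R]_m := [set y | forall i, `[-M, M]%classic (y ord0 i)].
have cA : compact A.
  exact: (@rV_compact R m (fun=> `[-M, M]%classic) (fun=> @segment_compact R (-M) M)).
have UA : U (x @^-1` A).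
  apply: filterE => k i; rewrite /= in_itv /= -ler_norml.
  exact: le_trans (ler_coord_norm (x k) i) (xM k).
have [l [_ cl]] := cA (x k @[k --> U]) _ UA.
exists l => B nB; have [//|h] := in_ultra_setVsetC (x @^-1` B) UU.
by have [y []] := cl (~` B) B h nB.
Qed.

Lemma ultra_cvg_R (U : set_system nat) (UU : UltraFilter U)
  (x : nat -> R) (M : R) : (forall k, `|x k| <= M) ->
  exists l, x k @[k --> U] --> (l : R).
Proof.
move=> xM; have [|l hl] := @ultra_cvg_rV 1 U UU (fun k => \row_i x k) M.
  move=> k; apply: rV_norm_leP => [|i]; last by rewrite mxE.
  exact: le_trans (normr_ge0 (x k)) (xM k).
exists (l 0 0); apply: cvg_trans (cvg_coord (i := 0) hl).
by apply: near_eq_cvg; apply: filterE => k; rewrite mxE.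
Qed.

End Ultra.

Section Calculus.
Context {R : realType} {m : nat}.
Implicit Types (x y : 'rV[R]_m) (g h : 'rV[R]_m -> R).
Local Notation partial i g := ('D_(delta_mx 0 i) g).

(** Heine's theorem by contradiction: pairs violating it at distance [k.+1%:R^-1] have a common
    limit along an ultrafilter. *)
Lemma continuous_unif_ball g (M e : R) : continuous g -> 0 < e ->
  exists2 r, 0 < r & forall x y, `|x| <= M -> `|x - y| <= r ->
    `|g x - g y| <= e.
Proof.
move=> cg e0; apply: contrapT => H.
have /choice[f fP] : forall k : nat, exists xy : 'rV[R]_m * 'rV[R]_m,
    [/\ `|xy.1| <= M, `|xy.1 - xy.2| <= k.+1%:R^-1 & e < `|g xy.1 - g xy.2|].
  move=> k; apply: contrapT => H2; apply: H; exists k.+1%:R^-1 => //.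
  move=> x y xM xy; rewrite leNgt; apply/negP => eg.
  by apply: H2; exists (x, y).
have [U [UU oU _]] := @ultra_infinite setT (fun N => ex_intro2 _ _ N (leqnn N) I).
have [|l hl] := @ultra_cvg_rV R m U UU (fun k => (f k).1) M.
  by move=> k; case: (fP k).
have hl2 : (f k).2 @[k --> U] --> l.
  have : (f k).1 - ((f k).1 - (f k).2) @[k --> U] --> l - 0.
    apply: cvgB => //; apply/cvgr0Pnorm_le => d d0.
    have : \forall k \near \oo, (k.+1%:R^-1 : R) <= d.
      near=> k; apply: ltW; near: k; exact: near_infty_natSinv_lt (PosNum d0).
    move=> /oU; apply: filterS => k; apply: le_trans.
    by case: (fP k).
  rewrite subr0; apply: cvg_trans; apply: near_eq_cvg.
  by near=> k; rewrite opprB addrC subrK.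
have : `|g (f k).1 - g (f k).2| @[k --> U] --> `|g l - g l|.
  apply: cvg_norm; apply: cvgB.
    exact: (cvg_comp _ _ hl (cg l)).
  exact: (cvg_comp _ _ hl2 (cg l)).
rewrite subrr normr0 => h.
have : e <= 0.
  apply: (cvgr_to_ge h); apply: filterE => k.
  by apply: ltW; case: (fP k).
by rewrite leNgt e0.
Unshelve. all: by end_near. Qed.

Lemma partial_mvt g x i (d : R) :
  (forall y, derivable g y (delta_mx 0 i)) ->
  exists2 t, 0 <= t <= 1 &
    g (x + d *: delta_mx 0 i) - g x = d * partial i g (x + (t * d) *: delta_mx 0 i).
Proof.
move=> dg; pose e : 'rV[R]_m := delta_mx 0 i.
pose phi (s : R) := g (x + s *: e).
have E s (k : R) : (phi \o shift s) (k *: 1) - phi s =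
    (g \o shift (x + s *: e)) (k *: e) - g (x + s *: e).
  rewrite /phi /=; congr (g _ - _).
  by rewrite [k *: 1]mulr1 scalerDl addrCA.
have dphi (s : R) : is_derive s (1 : R) phi (partial i g (x + s *: e)).
  apply: DeriveDef.
    rewrite /derivable; under eq_fun do rewrite E; exact: dg.
  by rewrite /derive; under eq_fun do rewrite E.
have cphi a b : {within `[a, b], continuous phi}.
  by apply: derivable_within_continuous => s _; case: (dphi s).
have [d0|d0] := leP 0 d.
  have [c cd] := MVT_segment d0 (fun s _ => dphi s) (@cphi _ _).
  rewrite /phi scale0r addr0 subr0 => ->.
  move: cd d0; rewrite in_itv /= => /andP[c0 cd]; rewrite le_eqVlt => /orP[/eqP d0|d0].
    exists 0; first by rewrite lexx ler01.
    have -> : c = 0 by apply/eqP; rewrite eq_le c0 d0 cd.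
    by rewrite mul0r mulrC.
  exists (c / d).
    by apply/andP; split; [exact: divr_ge0 c0 (ltW d0)|rewrite ler_pdivrMr ?mul1r].
  by rewrite mulfVK ?gt_eqF // mulrC.
have [c] := MVT_segment (ltW d0) (fun s _ => dphi s) (@cphi _ _).
rewrite in_itv /= => /andP[cd c0].
rewrite /phi scale0r addr0 sub0r => /(congr1 -%R); rewrite opprB => ->.
exists (c / d).
  apply/andP; split; last by rewrite ler_ndivrMr // mul1r.
  by rewrite -mulrNN -invrN divr_ge0 // oppr_ge0 // ltW.
by rewrite mulfVK ?lt_eqF // mulrN opprK mulrC.
Qed.

(** The coordinates are changed one at a time, so partial derivatives along the axes suffice. The
    price is that [xi i] lies in the box spanned by [x] and [y], with its own [t] in each
    coordinate, and not on the segment. *)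
Lemma coord_mvt g x y :
  (forall i z, derivable g z (delta_mx 0 i)) ->
  exists xi : 'I_m -> 'rV[R]_m,
    g y - g x = \sum_i (y 0 i - x 0 i) * partial i g (xi i) /\
    forall i l, exists2 t, 0 <= t <= 1 & xi i 0 l = x 0 l + t * (y 0 l - x 0 l).
Proof.
move=> dg; pose h k : 'rV[R]_m := \row_l if (l < k)%N then y 0 l else x 0 l.
have hS (k : 'I_m) : h k.+1 = h k + (y 0 k - x 0 k) *: delta_mx 0 k.
  apply/rowP => l; rewrite !mxE eqxx /= ltnS leq_eqVlt.
  have [->|lk] := eqVneq l k; first by rewrite eqxx ltnn /=; ring.
  by rewrite (negbTE (_ : nat_of_ord l != k)) //= mulr0 addr0.
have /choice[t tP] : forall k : 'I_m, exists t, 0 <= t <= 1 /\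
    g (h k.+1) - g (h k) = (y 0 k - x 0 k) *
      partial k g (h k + (t * (y 0 k - x 0 k)) *: delta_mx 0 k).
  by move=> k; rewrite hS; have [t] := partial_mvt (h k) (y 0 k - x 0 k) (dg k); exists t.
exists (fun k : 'I_m => h k + (t k * (y 0 k - x 0 k)) *: delta_mx 0 k); split.
  have -> : y = h m by apply/rowP => l; rewrite mxE ltn_ord.
  have -> : x = h 0%N by apply/rowP => l; rewrite mxE.
  rewrite -(telescope_sumr (fun k => g (h k))) // big_mkord.
  apply: eq_bigr => k _; case: (tP k) => _ ->.
  by rewrite !mxE ltn_ord.
move=> k l; rewrite !mxE eqxx /=; have [->|lk] := eqVneq l k.
  by exists (t k); [case: (tP k)|rewrite ltnn mulr1].
rewrite mulr0 addr0; case: ifP => _.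
  by exists 1; [rewrite ler01 lexx|ring].
by exists 0; [rewrite ler01 lexx|ring].
Qed.

End Calculus.

(** * Smooth functions and Taylor polynomials *)

Section SmoothFunctions.
Context {R : realType} {m : nat}.
Implicit Types (x y z : 'rV[R]_m) (g h : 'rV[R]_m -> R).
Local Notation partial i g := ('D_(delta_mx 0 i) g).
Local Notation CD := continuously_differentiable.

Lemma CD_continuous k g : CD k g -> continuous g.
Proof. by case: k => [//|k []]. Qed.

Lemma CD_derivable k g i x : CD k.+1 g -> derivable g x (delta_mx 0 i).
Proof. by move=> [_ /(_ i)[]]. Qed.

Lemma CD_partial k g i : CD k.+1 g -> CD k (partial i g).
Proof. by move=> [_ /(_ i)[]]. Qed.

Lemma CD_leq k l g : (k <= l)%N -> CD l g -> CD k g.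
Proof.
elim: k l g => [|k IH] [|l] g //=; first by move=> _ [].
move=> kl [cg dg]; split=> // i; have [di ci] := dg i; split=> //.
exact: IH ci.
Qed.

Lemma CD_cst k (c : R) : CD k (fun _ : 'rV[R]_m => c).
Proof.
elim: k c => [|k IH] c /=; first exact: cst_continuous.
split; first exact: cst_continuous.
move=> i; split; first by move=> x; apply: derivable_cst.
rewrite (_ : 'D_ _ _ = fun=> 0) //.
by apply/funext => x; rewrite derive_cst.
Qed.

Lemma CDD k g h : CD k g -> CD k h -> CD k (fun x => g x + h x).
Proof.
elim: k g h => [|k IH] g h /=.
  by move=> cg ch x; exact: (cvgD (cg x) (ch x)).
move=> [cg dg] [ch dh]; split.
  by move=> x; exact: (cvgD (cg x) (ch x)).
move=> i; have [dgi cgi] := dg i; have [dhi chi] := dh i; split.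
  by move=> x; apply: derivableD.
rewrite (_ : 'D_ _ _ = fun x => partial i g x + partial i h x); first exact: IH.
by apply/funext => x; rewrite -deriveD.
Qed.

Lemma CDZ k (c : R) g : CD k g -> CD k (fun x => c * g x).
Proof.
elim: k g => [|k IH] g /=.
  by move=> cg x; exact: (cvgM (cvg_cst c) (cg x)).
move=> [cg dg]; split.
  by move=> x; exact: (cvgM (cvg_cst c) (cg x)).
move=> i; have [dgi cgi] := dg i; split.
  by move=> x; apply: derivableZ.
rewrite (_ : 'D_ _ _ = fun x => c * partial i g x); first exact: IH.
by apply/funext => x; rewrite -[RHS]/(c *: _) -deriveZ.
Qed.

Lemma CD_sum k (I : Type) (r : seq I) (g : I -> 'rV[R]_m -> R) :
  (forall i, CD k (g i)) -> CD k (fun x => \sum_(i <- r) g i x).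
Proof.
move=> hg; elim: r => [|i r IH].
  rewrite (_ : (fun x => _) = fun=> 0); first exact: CD_cst.
  by apply/funext => x; rewrite big_nil.
rewrite (_ : (fun x => _) = fun x => g i x + \sum_(j <- r) g j x).
  exact: CDD.
by apply/funext => x; rewrite big_cons.
Qed.

Lemma is_derive_translate g x y v : derivable g (x + y) v ->
  is_derive x v (fun z => g (z + y)) ('D_v g (x + y)).
Proof.
move=> dg.
have E (k : R) : ((fun z => g (z + y)) \o shift x) (k *: v) - g (x + y) =
    (g \o shift (x + y)) (k *: v) - g (x + y).
  by rewrite /= addrA.
apply: DeriveDef.
  by rewrite /derivable; under eq_fun do rewrite E.
by rewrite /derive; under eq_fun do rewrite E.
Qed.

Lemma continuous_bounded g (M : R) : continuous g ->
  exists2 B, 0 <= B & forall x, `|x| <= M -> `|g x| <= B.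
Proof.
move=> cg; apply: contrapT => H.
have /choice[f fP] : forall k : nat, exists x : 'rV[R]_m,
    `|x| <= M /\ k%:R < `|g x|.
  move=> k; apply: contrapT => H2; apply: H; exists k%:R => // x xM.
  by rewrite leNgt; apply/negP => gx; apply: H2; exists x.
have [U [UU oU _]] := @ultra_infinite setT (fun N => ex_intro2 _ _ N (leqnn N) I).
have [|l hl] := @ultra_cvg_rV R m U UU f M; first by move=> k; case: (fP k).
have h : `|g (f k)| @[k --> U] --> `|g l|.
  by apply: cvg_norm; exact: (cvg_comp _ _ hl (cg l)).
have Ug : \forall k \near U, `|g (f k)| <= `|g l| + 1.
  by apply: (cvgr_le _ h); rewrite ltrDl.
have Ub : \forall k \near U, `|g l| + 1 <= k%:R.
  by apply: oU; apply: nbhs_infty_ger.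
have [k [h1 h2]] := filter_ex (filterI Ug Ub).
have [_] := fP k; rewrite ltNge; move/negP; apply.
exact: le_trans h1 h2.
Qed.

(** For the sup norm the box of [coord_mvt] is as good as the segment. *)
Lemma between_norm_le x y z (M : R) : `|x| <= M -> `|y| <= M ->
  (forall l, exists2 t, 0 <= t <= 1 & z 0 l = x 0 l + t * (y 0 l - x 0 l)) ->
  `|z| <= M /\ `|z - x| <= `|y - x|.
Proof.
move=> xM yM hz; split; apply: rV_norm_leP => //.
- exact: le_trans xM.
- move=> l; have [t /andP[t0 t1] ->] := hz l.
  have -> : x 0 l + t * (y 0 l - x 0 l) = (1 - t) * x 0 l + t * y 0 l by ring.
  apply: le_trans (ler_normD _ _) _; rewrite !normrM (ger0_norm t0).
  have s0 : 0 <= 1 - t by rewrite subr_ge0.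
  rewrite (ger0_norm s0); have -> : M = (1 - t) * M + t * M by ring.
  apply: lerD; apply: ler_wpM2l => //.
    exact: le_trans (ler_coord_norm x l) xM.
  exact: le_trans (ler_coord_norm y l) yM.
move=> l; have [t /andP[t0 t1] zE] := hz l; rewrite !mxE zE addrC addKr.
rewrite normrM (ger0_norm t0); apply: le_trans (ler_coord_norm (y - x) l).
by rewrite !mxE ler_piMl.
Qed.

Lemma CD1_lipschitz g (M : R) : CD 1 g ->
  exists2 L, 0 <= L & forall x y, `|x| <= M -> `|y| <= M ->
    `|g y - g x| <= L * `|y - x|.
Proof.
move=> c1; have dg i z : derivable g z (delta_mx 0 i) by exact: CD_derivable c1.
have /choice[B hB] : forall i : 'I_m, exists B, 0 <= B /\
    forall x, `|x| <= M -> `|partial i g x| <= B.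
  move=> i; have [B B0 hB] := continuous_bounded M (CD_continuous (CD_partial i c1)).
  by exists B.
exists (\sum_i B i); first by apply: sumr_ge0 => i _; case: (hB i).
move=> x y xM yM; have [xi [-> hxi]] := coord_mvt x y dg.
rewrite mulr_suml; apply: le_trans (ler_norm_sum _ _ _) _; apply: ler_sum => i _.
have [B0 hBi] := hB i; have [xiM _] := between_norm_le xM yM (hxi i).
rewrite normrM mulrC; apply: ler_pM => //; first exact: hBi.
by have := ler_coord_norm (y - x) i; rewrite !mxE.
Qed.

Lemma CD2_taylor g (M : R) : CD 2 g ->
  exists2 L, 0 <= L & forall x y, `|x| <= M -> `|y| <= M ->
    `|g y - g x - \sum_i partial i g x * (y 0 i - x 0 i)| <= L * `|y - x| ^+ 2.
Proof.
move=> c2; have c1 : CD 1 g by exact: CD_leq c2.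
have dg i z : derivable g z (delta_mx 0 i) by exact: CD_derivable c1.
have /choice[B hB] : forall i : 'I_m, exists B, 0 <= B /\
    forall x y, `|x| <= M -> `|y| <= M ->
      `|partial i g y - partial i g x| <= B * `|y - x|.
  move=> i; have [B B0 hB] := CD1_lipschitz M (CD_partial i c2).
  by exists B.
exists (\sum_i B i); first by apply: sumr_ge0 => i _; case: (hB i).
move=> x y xM yM; have [xi [-> hxi]] := coord_mvt x y dg.
rewrite -sumrB mulr_suml; apply: le_trans (ler_norm_sum _ _ _) _.
apply: ler_sum => i _.
have [B0 hBi] := hB i; have [xiM xix] := between_norm_le xM yM (hxi i).
rewrite [partial i g x * _]mulrC -mulrBr normrM mulrC expr2 mulrA.
apply: ler_pM => //.
  apply: le_trans (hBi _ _ xM xiM) _; exact: ler_wpM2l.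
by have := ler_coord_norm (y - x) i; rewrite !mxE.
Qed.

(** Schwarz's theorem: the second difference over a square of side [s] equals [s ^+ 2] times either
    mixed derivative at some point of the square, and both points tend to [x]. *)
Lemma partialC g i l : CD 2 g -> partial i (partial l g) = partial l (partial i g).
Proof.
have halves (a b c e : R) : `|a - c| <= e / 2 -> `|b - c| <= e / 2 -> `|a - b| <= e.
  move=> k1; rewrite distrC => k2.
  by rewrite [leRHS]splitr; apply: le_trans (lerD k1 k2); apply: ler_distD.
have swap (A B a b c d s : R) : s != 0 -> a - b - (c - d) = s * (s * A) ->
    a - c - (b - d) = s * (s * B) -> A = B.
  move=> s0 h1 h2; apply: (mulfI s0); apply: (mulfI s0); rewrite -h1 -h2; ring.
move=> c2; have c1 : CD 1 g by exact: CD_leq c2.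
have dg k z : derivable g z (delta_mx 0 k) by exact: CD_derivable c1.
have dpg k k' z : derivable (partial k g) z (delta_mx 0 k').
  exact: CD_derivable (CD_partial k c2).
have key a b x (s : R) : exists t t', [/\ 0 <= t <= 1, 0 <= t' <= 1 &
    g (x + s *: delta_mx 0 a + s *: delta_mx 0 b) - g (x + s *: delta_mx 0 a)
    - (g (x + s *: delta_mx 0 b) - g x) = s * (s * partial b (partial a g)
      (x + (t * s) *: delta_mx 0 a + (t' * s) *: delta_mx 0 b))].
  pose phi z := g (z + s *: delta_mx 0 b) - g z.
  have dphi z : is_derive z (delta_mx 0 a) phi
      (partial a g (z + s *: delta_mx 0 b) - partial a g z).
    by apply: is_deriveB; [exact: is_derive_translate|apply: DeriveDef].
  have [|t ht E] := @partial_mvt _ _ phi x a s; first by move=> z; case: (dphi z).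
  have [t' ht' E'] := partial_mvt (x + (t * s) *: delta_mx 0 a) s (dpg a b).
  exists t, t'; split=> //; move: E; rewrite {1 2}/phi => ->.
  by case: (dphi (x + (t * s) *: delta_mx 0 a)) => _ ->; rewrite E'.
apply/funext => x; apply/eqP; rewrite -subr_eq0 -normr_le0.
apply/ler_addgt0Pr => e e0; rewrite add0r.
have e2 : 0 < e / 2 by rewrite divr_gt0.
have [r r0 hr] := @continuous_unif_ball _ _ _ `|x| _ (CD_continuous (CD_partial i (CD_partial l c2))) e2.
have [r' r'0 hr'] := @continuous_unif_ball _ _ _ `|x| _ (CD_continuous (CD_partial l (CD_partial i c2))) e2.
(* Halved because the intermediate points are displaced by up to [s] in two directions. *)
pose s := Num.min r r' / 2.
have s0 : 0 < s by rewrite divr_gt0 // lt_min r0.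
have s1 : s <= r / 2 by apply: ler_pM; rewrite ?invr_ge0 ?ge_min ?lexx // le_min !ltW.
have s2 : s <= r' / 2.
  by apply: ler_pM; rewrite ?invr_ge0 ?ge_min ?lexx ?orbT // le_min !ltW.
have [t [t' [ht ht' E]]] := key l i x s.
have [u [u' [hu hu' E']]] := key i l x s.
have near (a b : 'I_m) (p q : R) (rho : R) : 0 <= p <= 1 -> 0 <= q <= 1 ->
    s <= rho / 2 ->
    `|x - (x + (p * s) *: delta_mx 0 a + (q * s) *: delta_mx 0 b)| <= rho.
  move=> /andP[p0 p1] /andP[q0 q1] sr; rewrite -addrA opprD addrA subrr add0r normrN.
  apply: le_trans (ler_normD _ _) _; rewrite (normrZ (p * s)) (normrZ (q * s)).
  have dn (c : 'I_m) : `|delta_mx 0 c : 'rV[R]_m| <= 1.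
    by apply: rV_norm_leP => // k; rewrite mxE; case: (_ && _); rewrite ?normr1 ?normr0.
  rewrite [leRHS]splitr.
  have b1 (c : R) (a' : 'I_m) : 0 <= c -> c <= 1 -> `|c * s| * `|delta_mx 0 a' : 'rV[R]_m| <= rho / 2.
    move=> c0 c1'; rewrite normrM (ger0_norm c0) (gtr0_norm s0).
    apply: le_trans sr; rewrite -[leRHS]mulr1 -[s in leRHS]mul1r.
    by apply: ler_pM => //; [rewrite mulr_ge0 // ltW|rewrite ler_pM // ltW].
  by apply: lerD; [exact: (b1 p a p0 p1)|exact: (b1 q b q0 q1)].
have EE : partial i (partial l g) (x + (t * s) *: delta_mx 0 l + (t' * s) *: delta_mx 0 i)
   = partial l (partial i g) (x + (u * s) *: delta_mx 0 i + (u' * s) *: delta_mx 0 l).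
  have sn : s != 0 by rewrite gt_eqF.
  move: E'; rewrite [x + s *: delta_mx 0 i + s *: delta_mx 0 l]addrAC.
  exact: (swap _ _ _ _ _ _ _ sn E).
have h1 := hr x _ (lexx _) (near l i t t' r ht ht' _).
have h2 := hr' x _ (lexx _) (near i l u u' r' hu hu' _).
by move: (h1 s1) (h2 s2); rewrite EE; exact: halves.
Qed.

End SmoothFunctions.

Lemma finite_lower_bound (R : realType) (I : finType) (r : I -> R) :
  (forall i, 0 < r i) -> exists2 r0, 0 < r0 & forall i, r0 <= r i.
Proof.
move=> h; exists (\big[Num.min/1]_i r i); last by move=> i; apply: bigmin_le.
by apply: lt_bigmin.
Qed.

(* Polynomials in noncommuting notation: c w is the coefficient of the monomial
   spelled by the word w. *)
Section WordPolynomials.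
Context {R : realType} {m : nat}.

Fixpoint peval (d : nat) (c : seq 'I_m -> R) (z : 'I_m -> R) : R :=
  c [::] + if d is d'.+1 then \sum_l z l * peval d' (fun w => c (l :: w)) z
           else 0.

Definition is_poly (d : nat) (F : ('I_m -> R) -> R) : Prop :=
  exists c, forall z, F z = peval d c z.

Lemma is_polyS_form d (F : 'I_m -> ('I_m -> R) -> R) :
  (forall l, is_poly d (F l)) -> is_poly d.+1 (fun z => \sum_l z l * F l z).
Proof.
move=> /choice[c hc]; exists (fun w => if w is l :: w' then c l w' else 0) => z /=.
by rewrite add0r; apply: eq_bigr => l _; rewrite hc.
Qed.

Lemma is_poly_cst d a : is_poly d (fun=> a).
Proof.
exists (fun w => if w is [::] then a else 0) => z.
suff E k : peval k (fun=> 0) z = 0.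
  case: d => [|d] /=; first by rewrite addr0.
  by rewrite big1 ?addr0 // => l _; rewrite E mulr0.
elim: k => [|k IH] /=; first by rewrite addr0.
by rewrite add0r big1 // => l _; rewrite IH mulr0.
Qed.

Lemma is_polyD d F G : is_poly d F -> is_poly d G ->
  is_poly d (fun z => F z + G z).
Proof.
move=> [c hc] [c' hc']; exists (fun w => c w + c' w) => z; rewrite hc hc'.
elim: d c c' {hc hc'} => [|d IH] c c' /=; first by rewrite !addr0.
rewrite addrACA -big_split /=; congr (_ + _); apply: eq_bigr => l _.
by rewrite -mulrDr IH.
Qed.

Lemma is_polyZ d a F : is_poly d F -> is_poly d (fun z => a * F z).
Proof.
move=> [c hc]; exists (fun w => a * c w) => z; rewrite hc.
elim: d c {hc} => [|d IH] c /=; first by rewrite !addr0.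
rewrite mulrDr mulr_sumr; congr (_ + _); apply: eq_bigr => l _.
by rewrite mulrCA IH.
Qed.

Lemma is_poly_leq d d' F : (d <= d')%N -> is_poly d F -> is_poly d' F.
Proof.
elim: d d' F => [|d IH] d' F.
  move=> _ [c hc]; have [c' hc'] := is_poly_cst d' (c [::]).
  by exists c' => z; rewrite hc -hc' /= addr0.
case: d' => // d' dd' [c hc].
have h l : is_poly d' (peval d (fun w => c (l :: w))).
  by apply: IH => //; exists (fun w => c (l :: w)).
have [c' hc'] := is_polyD (is_poly_cst d'.+1 (c [::])) (is_polyS_form h).
by exists c' => z; rewrite hc -hc'.
Qed.

Lemma is_poly_sum d (I : Type) (r : seq I) (F : I -> ('I_m -> R) -> R) :
  (forall i, is_poly d (F i)) -> is_poly d (fun z => \sum_(i <- r) F i z).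
Proof.
move=> hF; elim: r => [|i r IH].
  rewrite (_ : (fun z => _) = fun=> 0); first exact: is_poly_cst.
  by apply/funext => z; rewrite big_nil.
rewrite (_ : (fun z => _) = fun z => F i z + \sum_(j <- r) F j z).
  exact: is_polyD.
by apply/funext => z; rewrite big_cons.
Qed.

Lemma peval_bounded d c (B : R) : 0 <= B -> exists2 K, 0 <= K &
  forall z, (forall i, `|z i| <= B) -> `|peval d c z| <= K.
Proof.
move=> B0; elim: d c => [|d IH] c.
  by exists `|c [::]| => // z _ /=; rewrite addr0.
have /choice[K hK] : forall l : 'I_m, exists K, 0 <= K /\
    forall z, (forall i, `|z i| <= B) -> `|peval d (fun w => c (l :: w)) z| <= K.
  by move=> l; have [K K0 hK] := IH (fun w => c (l :: w)); exists K.
exists (`|c [::]| + \sum_l B * K l).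
  rewrite addr_ge0 // sumr_ge0 // => l _; rewrite mulr_ge0 //.
  by case: (hK l).
move=> z hz /=; apply: le_trans (ler_normD _ _) _; rewrite lerD2l.
apply: le_trans (ler_norm_sum _ _ _) _; apply: ler_sum => l _.
by rewrite normrM ler_pM //; case: (hK l) => _; apply.
Qed.

Lemma peval_lipschitz d c (B : R) : 0 <= B -> exists2 L, 0 <= L &
  forall z z' e, 0 <= e -> (forall i, `|z i| <= B) -> (forall i, `|z' i| <= B) ->
    (forall i, `|z' i - z i| <= e) -> `|peval d c z' - peval d c z| <= L * e.
Proof.
move=> B0; elim: d c => [|d IH] c.
  by exists 0 => // z z' e e0 _ _ _ /=; rewrite subrr normr0 mul0r.
have /choice[K hK] : forall l : 'I_m, exists K, 0 <= K /\
    forall z, (forall i, `|z i| <= B) -> `|peval d (fun w => c (l :: w)) z| <= K.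
  move=> l; have [K K0 hK] := peval_bounded d (fun w => c (l :: w)) B0.
  by exists K.
have /choice[L hL] : forall l : 'I_m, exists L, 0 <= L /\
  forall z z' e, 0 <= e -> (forall i, `|z i| <= B) -> (forall i, `|z' i| <= B) ->
    (forall i, `|z' i - z i| <= e) -> `|peval d (fun w => c (l :: w)) z' -
      peval d (fun w => c (l :: w)) z| <= L * e.
  by move=> l; have [L L0 hL] := IH (fun w => c (l :: w)); exists L.
exists (\sum_l (K l + B * L l)).
  by apply: sumr_ge0 => l _; case: (hK l) (hL l) => ? _ [? _]; rewrite addr_ge0 ?mulr_ge0.
move=> z z' e e0 hz hz' hzz /=; rewrite [c _ + _]addrC addrKA -sumrB.
apply: le_trans (ler_norm_sum _ _ _) _; rewrite mulr_suml; apply: ler_sum => l _.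
set p := peval d _ z; set p' := peval d _ z'.
have -> : z' l * p' - z l * p = (z' l - z l) * p' + z l * (p' - p) by ring.
apply: le_trans (ler_normD _ _) _; rewrite !normrM mulrDl; apply: lerD.
  by rewrite mulrC ler_pM //; case: (hK l) => _; apply.
by rewrite -mulrA ler_pM //; case: (hL l) => _; apply.
Qed.

End WordPolynomials.

Section Taylor.
Context {R : realType} {m : nat}.
Implicit Types (x y z : 'rV[R]_m) (g h : 'rV[R]_m -> R).
Local Notation partial i g := ('D_(delta_mx 0 i) g).
Local Notation CD := continuously_differentiable.

(** The differential of order [s] at [x] on [s] copies of [z], as a sum over words of indices
    without grouping equal monomials. *)
Fixpoint taylor_form (s : nat) h x z : R :=
  if s is s'.+1 then \sum_l z 0 l * taylor_form s' (partial l h) x z else h x.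

Lemma taylor_formS s h x z :
  taylor_form s.+1 h x z = \sum_l z 0 l * taylor_form s (partial l h) x z.
Proof. by []. Qed.

Definition taylor (k : nat) h x z : R :=
  \sum_(s < k.+1) s`!%:R^-1 * taylor_form s h x z.

Lemma is_derive_coord x v l : is_derive x v (fun z : 'rV[R]_m => z 0 l) (v 0 l).
Proof.
have C : (k : R)^-1 *: (((fun z : 'rV[R]_m => z 0 l) \o shift x) (k *: v) - x 0 l)
    @[k --> 0^'] --> v 0 l.
  apply: cvg_near_cst; near=> k.
  rewrite /= !mxE addrK [_ *: _]mulrA mulVf ?mul1r //.
  by near: k; exact: nbhs_dnbhs_neq.
apply: DeriveDef; first by apply/cvg_ex; exists (v 0 l).
exact: cvg_lim C.
Unshelve. all: by end_near. Qed.

Lemma is_derive_form x v (F : 'I_m -> 'rV[R]_m -> R) (dF : 'I_m -> R) :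
  (forall l, is_derive x v (F l) (dF l)) ->
  is_derive x v (fun z => \sum_l z 0 l * F l z)
    (\sum_l (v 0 l * F l x + x 0 l * dF l)).
Proof.
move=> hF.
have -> : (fun z : 'rV[R]_m => \sum_l z 0 l * F l z) =
    \sum_l (fun z : 'rV[R]_m => z 0 l) * F l.
  by apply/funext => z; rewrite fct_sumE.
apply: is_derive_sum => l.
have := is_deriveM (is_derive_coord x v l) (hF l).
by rewrite addrC [F l x *: _]mulrC.
Qed.

Lemma sum_delta_form (A B z : 'I_m -> R) (c : R) i :
  \sum_l ((delta_mx 0 i : 'rV[R]_m) 0 l * A l + z l * (c * B l)) =
  A i + c * \sum_l z l * B l.
Proof.
rewrite big_split /= (bigD1 i) //= mxE !eqxx mul1r big1 ?addr0; last first.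
  by move=> l li; rewrite mxE eqxx (negbTE li) mul0r.
by congr (_ + _); rewrite mulr_sumr; apply: eq_bigr => l _; rewrite mulrCA.
Qed.

(** The product rule yields one copy of the form from the outermost coordinate and, by induction,
    the other copies from the inner form; Schwarz's theorem moves the derivative along [i] next to
    [h]. *)
Lemma taylor_form_derive s h x z i : CD s.+1 h ->
  is_derive z (delta_mx 0 i) (taylor_form s.+1 h x)
    (s.+1%:R * taylor_form s (partial i h) x z).
Proof.
elim: s h => [|s IH] h ch.
  have /is_derive_form : forall l, is_derive z (delta_mx 0 i)
    (fun _ : 'rV[R]_m => partial l h x) (0 * 0) by move=> l; rewrite mul0r; apply: is_derive_cst.
  by rewrite sum_delta_form mul0r addr0 mul1r.
have hF l := IH (partial l h) (CD_partial l ch).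
have := is_derive_form hF; rewrite sum_delta_form.
have -> : \sum_l z 0 l * taylor_form s (partial i (partial l h)) x z =
    taylor_form s.+1 (partial i h) x z.
  have c2 : CD 2 h := @CD_leq R m 2 s.+2 h isT ch.
  have pc l : partial i (partial l h) = partial l (partial i h) := partialC i l c2.
  rewrite taylor_formS.
  by apply: eq_bigr => l _; exact: (congr1 (fun F => z 0 l * taylor_form s F x z) (pc l)).
by rewrite [s.+2%:R]mulrS mulrDl mul1r.
Qed.

(** This drives the induction of [taylor_bound]. It also makes Taylor polynomials of the partial
    derivatives the exact gradients of those of the pieces, as the expansion hypothesis of the
    packing bound demands. *)
Lemma taylor_derive k h x z i : CD k.+1 h ->
  is_derive z (delta_mx 0 i) (taylor k.+1 h x) (taylor k (partial i h) x z).
Proof.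
move=> ch.
have -> : taylor k.+1 h x = \sum_(s < k.+2) s`!%:R^-1 \*: taylor_form s h x.
  by apply/funext => y; rewrite fct_sumE.
have -> : taylor k (partial i h) x z = \sum_(s < k.+2)
    (if s : nat is s'.+1 then s'`!%:R^-1 * taylor_form s' (partial i h) x z else 0).
  by rewrite big_ord_recl add0r.
apply: is_derive_sum => -[[|s] hs] /=.
  have := is_deriveZ (0`!%:R^-1) (is_derive_cst (h x) z (delta_mx 0 i)).
  by rewrite scaler0.
have := is_deriveZ (s.+1`!%:R^-1) (@taylor_form_derive s h x z i (@CD_leq R m s.+1 k.+1 h hs ch)).
congr is_derive; rewrite -[_ *: _]/(_ * _) mulrA; congr (_ * _).
by rewrite factS natrM invfM mulrAC mulVf ?mul1r ?pnatr_eq0.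
Qed.

Lemma taylor0 k h x : taylor k h x 0 = h x.
Proof.
rewrite /taylor big_ord_recl /= invr1 mul1r big1 ?addr0 // => s _ /=.
by rewrite big1 ?mulr0 // => l _; rewrite mxE mul0r.
Qed.

(** Only [k] derivatives are available, so the base case is uniform continuity. In the inductive
    step the remainder vanishes at 0 and its partial derivatives are remainders of order [k], so the
    mean value theorem gains one factor [r]. *)
Lemma taylor_bound k h (M e : R) : CD k h -> 0 < e ->
  exists2 r0, 0 < r0 & forall x, `|x| <= M -> forall r, 0 < r -> r <= r0 ->
    forall z, `|z| <= r -> `|h (z + x) - taylor k h x z| <= e * r ^+ k.
Proof.
elim: k h e => [|k IH] h e ch e0.
  have [r0 r00 hr] := @continuous_unif_ball R m h M e ch e0.
  exists r0 => // x xM r rp rr z zr.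
  rewrite expr0 mulr1 /taylor big_ord_recl big_ord0 /= invr1 mul1r addr0 distrC.
  by apply: hr => //; rewrite opprD addrCA subrr addr0 normrN (le_trans zr).
(* The [m] coordinates each contribute [e']; the successor covers dimension 0. *)
pose e' := e / m.+1%:R; have e'0 : 0 < e' by rewrite divr_gt0.
have /choice[r hr] : forall i : 'I_m, exists r0, 0 < r0 /\ forall x, `|x| <= M ->
    forall r, 0 < r -> r <= r0 -> forall z, `|z| <= r ->
    `|partial i h (z + x) - taylor k (partial i h) x z| <= e' * r ^+ k.
  by move=> i; have [r0 r00 H] := IH _ _ (CD_partial i ch) e'0; exists r0.
have [|r0 r00 hr0] := @finite_lower_bound R _ r; first by move=> i; case: (hr i).
exists r0 => // x xM r1 r1p r1r z zr.
pose F y := h (y + x) - taylor k.+1 h x y.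
have dF i y : is_derive y (delta_mx 0 i) F
    (partial i h (y + x) - taylor k (partial i h) x y).
  have d1 := @is_derive_translate _ _ h y x _ (@CD_derivable _ _ _ _ i (y + x) ch).
  exact: (is_deriveB d1 (@taylor_derive k h x y i ch)).
have dF' i y : derivable F y (delta_mx 0 i) by case: (dF i y).
have [xi []] := coord_mvt 0 z dF'.
rewrite {2}/F add0r taylor0 subrr subr0 => FE hxi.
rewrite -/(F z) FE; apply: le_trans (ler_norm_sum _ _ _) _.
apply: (@le_trans _ _ (\sum_(i < m) r1 * (e' * r1 ^+ k))).
  apply: ler_sum => i _; rewrite normrM; apply: ler_pM => //.
    by rewrite mxE subr0; apply: le_trans (ler_coord_norm z i) zr.
  have [_ ->] := dF i (xi i); have [_ h2] := hr i; apply: h2 => //.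
    exact: le_trans (hr0 i).
  have [|//] := @between_norm_le _ _ 0 z (xi i) r1 _ zr (hxi i).
  by rewrite normr0 ltW.
rewrite sumr_const card_ord -[leLHS]mulr_natr.
rewrite /e' exprS -!mulrA [leRHS]mulrCA ler_pM2l // ler_pM2l //.
rewrite mulrCA ler_piMr ?exprn_ge0 ?(ltW r1p) //.
by rewrite ler_pdivrMl // mulr1 ler_nat leqnSn.
Qed.

Lemma is_poly_taylor k h x : is_poly k
  (fun z : 'I_m -> R => taylor k h x (\row_i z i)).
Proof.
apply: is_poly_sum => s; apply: is_polyZ; apply: (@is_poly_leq _ _ s).
  by rewrite -ltnS.
case: s => s _ /=; elim: s h => [|s IH] h /=; first exact: is_poly_cst.
have [c hc] := is_polyS_form (fun l => IH (partial l h)).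
by exists c => z; rewrite -hc; apply: eq_bigr => l _; rewrite mxE.
Qed.

End Taylor.

(** * Near critical values of polynomials *)

Section Closedness.
Context {R : realType} {T : topologicalType}.

Lemma cvg_sumr (S : Type) (F : set_system S) {FF : Filter F} (I : Type) (r : seq I)
  (f : I -> S -> R) (a : I -> R) : (forall i, f i x @[x --> F] --> a i) ->
  \sum_(i <- r) f i x @[x --> F] --> \sum_(i <- r) a i.
Proof.
move=> h; elim: r => [|i r IH].
  rewrite big_nil; apply: cvg_near_cst; apply: filterE => x.
  by rewrite big_nil.
rewrite big_cons; apply: cvg_trans (cvgD (h i) IH).
by apply: near_eq_cvg; apply: filterE => x; rewrite big_cons.
Qed.

Lemma contM (f g : T -> R) : continuous f -> continuous g ->
  continuous (fun x => f x * g x).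
Proof. by move=> cf cg x; exact: (cvgM (cf x) (cg x)). Qed.

Lemma contB (f g : T -> R) : continuous f -> continuous g ->
  continuous (fun x => f x - g x).
Proof. by move=> cf cg x; exact: (cvgB (cf x) (cg x)). Qed.

Lemma contD (f g : T -> R) : continuous f -> continuous g ->
  continuous (fun x => f x + g x).
Proof. by move=> cf cg x; exact: (cvgD (cf x) (cg x)). Qed.

Lemma cont_sum (I : Type) (r : seq I) (f : I -> T -> R) :
  (forall i, continuous (f i)) -> continuous (fun x => \sum_(i <- r) f i x).
Proof. by move=> cf x; exact: (@cvg_sumr T (nbhs x) _ I r f (fun i => f i x) (fun i => cf i x)). Qed.

Lemma closed_continuous_le (f : T -> R) (a : R) : continuous f ->
  closed [set x | f x <= a].
Proof. by move=> /continuous_closedP /(_ [set y | y <= a] (@closed_le R a)). Qed.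

Lemma closed_continuous_ge (f : T -> R) (a : R) : continuous f ->
  closed [set x | a <= f x].
Proof. by move=> /continuous_closedP /(_ [set y | a <= y] (@closed_ge R a)). Qed.

Lemma closed_continuous_eq (f : T -> R) (a : R) : continuous f ->
  closed [set x | f x = a].
Proof. by move=> /continuous_closedP /(_ [set y | y = a] (@closed_eq R a)). Qed.

Lemma closed_forall (I : Type) (A : I -> set T) : (forall i, closed (A i)) ->
  closed [set x | forall i, A i x].
Proof.
move=> h x cx i; apply: h; apply: closure_subset cx => y; exact.
Qed.

Lemma closed_and (A B : set T) : closed A -> closed B ->
  closed [set x | A x /\ B x].
Proof. exact: closedI. Qed.

End Closedness.

(** * Lexicographic minima as definable selections *)

Section Lexicographic.
Context {R : realType}.

(** The lexicographic order as a conjunction of implications between atoms, hence visibly first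
    order; being antisymmetric on the first [q] coordinates, it gives a unique minimum there. *)
Definition lexle (q : nat) (u u' : nat -> R) : Prop :=
  forall i : 'I_q, (forall k : 'I_q, (k < i)%N -> u k = u' k) -> u i <= u' i.

Definition row_fun (q : nat) (x : 'rV[R]_q) (i : nat) : R :=
  if insub i is Some k then x 0 k else 0.

Lemma row_funE q (x : 'rV[R]_q) (i : 'I_q) : row_fun x i = x 0 i.
Proof. by rewrite /row_fun valK. Qed.

(** The coordinates are minimised one after the other; [B k] is the compact set of points that are
    minimal for the first [k]. A choice function would not do later on, because the selection has to
    be definable. *)
Lemma lexmin_exists q (A : set 'rV[R]_q) : compact A -> A !=set0 ->
  exists2 x, A x & forall y, A y -> lexle q (row_fun x) (row_fun y).
Proof.
move=> cA A0.
have [k] : exists k : nat, (q <= k)%N by exists q.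
pose B k := [set x | A x /\ forall i : 'I_q, (i < k)%N -> forall y, A y ->
  (forall l : 'I_q, (l < i)%N -> x 0 l = y 0 l) -> x 0 i <= y 0 i].
suff /(_ q)[_ [x [Ax hx]]] : forall k, compact (B k) /\ B k !=set0.
  move=> _; exists x => // y Ay i h; rewrite !row_funE; apply: hx => // l li.
  by have := h l li; rewrite !row_funE.
elim=> {k} [|k [cB B0]].
  have -> : B 0%N = A by apply/seteqP; split=> x; [case|split].
  by [].
have [kq|qk] := ltnP k q; last first.
  suff -> : B k.+1 = B k by [].
  apply/seteqP; split=> x [Ax hx]; split=> // i ik; apply: hx.
    exact: ltnW.
  exact: leq_trans (ltn_ord i) qk.
pose K := Ordinal kq.
have cK : continuous (fun x : 'rV[R]_q => x 0 K) by apply: coord_continuous.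
have [|c /set_mem cB' hc] := @EVT_min_rV R q (fun x => x 0 K) (B k) B0 cB.
  by apply: continuous_subspaceT.
have -> : B k.+1 = B k `&` [set x | x 0 K <= c 0 K].
  apply/seteqP; split=> x.
    move=> [Ax hx]; have Bx : B k x.
      by split=> // i ik; apply: hx; apply: ltnW.
    split=> //=; have [Ac hc'] := cB'.
    apply: hx => //= l lk.
    (* Two points of [B k] agree on the first [k] coordinates, by strong induction on the
       coordinate. *)
    suff E : forall n (l : 'I_q), (l < n)%N -> (l < k)%N -> x 0 l = c 0 l.
      exact: (E l.+1 l).
    elim=> // n IH l' l'n l'k.
    have agree (l'' : 'I_q) : (l'' < l')%N -> x 0 l'' = c 0 l''.
      by move=> h; apply: IH; [apply: leq_trans h _|apply: ltn_trans h _].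
    have [_ hx'] := Bx; apply/eqP; rewrite eq_le (hx' l') //=.
    by apply: hc' => // l'' h; rewrite agree.
  move=> [[Ax hx] /= xc]; split=> // i; rewrite ltnS leq_eqVlt => /orP[/eqP ik|]; last exact: hx.
  have -> : i = K by apply/val_inj.
  move=> y Ay agree; apply: le_trans xc _; apply: hc; apply/mem_set.
  split=> // i' i'k y' Ay' agree'; rewrite -agree; last by [].
  by apply: hx => // l li'; rewrite agree ?agree' //; apply: ltn_trans li' _.
split; first by apply: compact_closedI => //; apply: closed_continuous_le.
by exists c; split=> /=.
Qed.

End Lexicographic.

Section NearCritical.
Context {R : realType} {m r : nat}.
Local Notation q := (m + r)%N.
Implicit Types (P : 'I_r -> ('I_m -> R) -> R) (G : 'I_r -> 'I_m -> ('I_m -> R) -> R).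

(* A candidate is u = (z, lambda): coordinates below m form z, the others
   are the convex weights lambda. *)
Definition near_crit (v eps delta : R) P G (u : nat -> R) : Prop :=
  (forall i : 'I_m, - eps <= u i /\ u i <= eps) /\
  (forall j : 'I_r, 0 <= u (m + j)%N) /\
  \sum_(j < r) u (m + j)%N = 1 /\
  v = \sum_(j < r) u (m + j)%N * P j (fun i => u i) /\
  (forall j, P j (fun i => u i) - v <= delta * eps /\
             v - P j (fun i => u i) <= delta * eps) /\
  (forall i, \sum_(j < r) u (m + j)%N * G j i (fun i => u i) <= delta /\
             - delta <= \sum_(j < r) u (m + j)%N * G j i (fun i => u i)).

Lemma near_crit_ext v eps delta P G u u' :
  (forall i, (i < q)%N -> u i = u' i) ->
  near_crit v eps delta P G u -> near_crit v eps delta P G u'.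
Proof.
move=> uu.
have z : (fun i : 'I_m => u i) = fun i : 'I_m => u' i.
  by apply/funext => i; apply: uu; rewrite (leq_trans (ltn_ord i)) ?leq_addr.
have l (j : 'I_r) : u (m + j)%N = u' (m + j)%N by apply: uu; rewrite ltn_add2l.
have S (F : 'I_r -> R) : \sum_(j < r) u (m + j)%N * F j = \sum_(j < r) u' (m + j)%N * F j.
  by apply: eq_bigr => j _; rewrite l.
rewrite /near_crit z; move=> [h1 [h2 [h3 [h4 [h5 h6]]]]]; split.
  by move=> i; move: (h1 i); rewrite (congr1 (fun f => f i) z).
split; first by move=> j; rewrite -l.
split; first by rewrite -h3; apply: eq_bigr => j _; rewrite l.
split; first by rewrite h4 S.
by split=> // i; move: (h6 i); rewrite S.
Qed.

Lemma near_crit_bounds v eps delta P G u : near_crit v eps delta P G u ->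
  forall i, (i < q)%N -> (if (i < m)%N then - eps else 0) <= u i <= (if (i < m)%N then eps else 1).
Proof.
move=> [h1 [h2 [h3 _]]] i iq; case: ifP => im.
  by have [a b] := h1 (Ordinal im); rewrite a b.
have mi : (m <= i)%N by rewrite leqNgt im.
have jr : (i - m < r)%N by rewrite ltn_subLR.
have E : i = (m + Ordinal jr)%N by rewrite /= subnKC.
rewrite E h2 /= -E -h3 (bigD1 (Ordinal jr)) //= subnKC // lerDl.
by apply: sumr_ge0 => j _; apply: h2.
Qed.

(** The conditions of [near_crit] are equations and weak inequalities between polynomials, and the
    weights lie in a simplex, so the candidates form a compact set. *)
Lemma lexmin_near_crit v eps delta P G :
  (forall j, exists d, is_poly d (P j)) ->
  (forall j i, exists d, is_poly d (G j i)) ->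
  (exists u, near_crit v eps delta P G u) ->
  exists u, near_crit v eps delta P G u /\
    forall u', near_crit v eps delta P G u' -> lexle q u u'.
Proof.
move=> hP hG [u0 hu0].
pose A := [set x : 'rV[R]_q | near_crit v eps delta P G (row_fun x)].
have roundtrip u : near_crit v eps delta P G u -> A (\row_i u i).
  apply: near_crit_ext => i iq; rewrite /row_fun.
  by rewrite insubT /= mxE.
have [||x Ax hx] := @lexmin_exists R q A.
- have coord i : continuous (fun x : 'rV[R]_q => row_fun x i).
    rewrite /row_fun; case: insub => [k|]; first exact: coord_continuous.
    exact: cst_continuous.
  have ppeval d c : continuous (fun x : 'rV[R]_q => peval d c (fun i : 'I_m => row_fun x i)).
    elim: d c => [|d IH] c /=; apply: contD; try exact: cst_continuous.
    by apply: cont_sum => l; apply: contM; [exact: coord|exact: IH].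
  have cP F : (exists d, is_poly d F) ->
      continuous (fun x : 'rV[R]_q => F (fun i : 'I_m => row_fun x i)).
    move=> [d [c hc]].
    rewrite (_ : (fun x => _) = fun x : 'rV[R]_q => peval d c (fun i : 'I_m => row_fun x i)) //.
    by apply/funext => x; rewrite hc.
  have cS (F : 'I_r -> ('I_m -> R) -> R) : (forall j, exists d, is_poly d (F j)) ->
      continuous (fun x : 'rV[R]_q => \sum_(j < r) row_fun x (m + j)%N * F j (fun i : 'I_m => row_fun x i)).
    move=> hF; apply: cont_sum => j; apply: contM; first exact: coord.
    exact: (cP (F j)).
  apply: bounded_closed_compact.
    exists (`|eps| + 1); split; first by rewrite num_real.
    move=> M hM x Ax /=; have M0 : 0 <= M by apply: le_trans (ltW hM); rewrite addr_ge0.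
    apply: rV_norm_leP => // i; have := near_crit_bounds Ax (ltn_ord i).
    rewrite row_funE => /andP[a b]; rewrite ler_norml.
    have e1 : `|eps| <= M by apply: le_trans (ltW hM); rewrite lerDl.
    have e2 : 1 <= M by apply: le_trans (ltW hM); rewrite lerDr.
    move: a b; case: ifP => _ a b; apply/andP; split.
    + by apply: le_trans a; rewrite lerN2 (le_trans _ e1) // ler_norm.
    + by apply: le_trans b _; rewrite (le_trans _ e1) // ler_norm.
    + by apply: le_trans a; rewrite oppr_le0.
    + exact: le_trans b _.
  apply: closed_and.
    apply: closed_forall => i; apply: closed_and.
      exact: closed_continuous_ge.
    exact: closed_continuous_le.
  apply: closed_and; first by apply: closed_forall => j; exact: closed_continuous_ge.
  apply: closed_and.
    by apply: closed_continuous_eq; apply: cont_sum => j; exact: coord.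
  apply: closed_and.
    move=> x cx; apply: esym; move: (closed_continuous_eq (a := v) (cS P hP)) => /(_ x) /=; apply.
    by apply: closure_subset cx => y /= <-.
  apply: closed_and.
    apply: closed_forall => j; apply: closed_and.
      by apply: closed_continuous_le; apply: contB; [exact: cP|exact: cst_continuous].
    by apply: closed_continuous_le; apply: contB; [exact: cst_continuous|exact: cP].
  apply: closed_forall => i; apply: closed_and.
    apply: closed_continuous_le; exact: (cS (fun j => G j i)).
  by apply: closed_continuous_ge; exact: (cS (fun j => G j i)).
- by exists (\row_i u0 i); apply: roundtrip.
exists (row_fun x); split=> // u' hu' i h.
have E (k : 'I_q) : row_fun (\row_(i0 < q) u' i0) k = u' k by rewrite row_funE mxE.
have := hx _ (roundtrip _ hu') i; rewrite E; apply => k ki.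
by rewrite E; exact: h.
Qed.

End NearCritical.

Section UniformBounds.
Context {R : realType} {m r : nat} (d : nat).
Local Notation q := (m + r)%N.

Lemma words_bound (F : seq 'I_m -> nat) k :
  exists N, forall w, (size w <= k)%N -> (F w < N)%N.
Proof.
elim: k F => [|k IH] F.
  by exists (F [::]).+1 => -[|l w].
have /choice[N hN] : forall l, exists N, forall w, (size w <= k)%N ->
  (F (l :: w) < N)%N by move=> l; apply: IH.
exists (F [::] + \sum_l N l).+1 => -[|l w] /=; first by rewrite ltnS leq_addr.
move=> kw; rewrite ltnS (leq_trans (ltnW (hN l w kw))) //.
by rewrite (bigD1 l) //= addnCA leq_addr.
Qed.

Lemma peval_ext k (c c' : seq 'I_m -> R) z :
  (forall w, (size w <= k)%N -> c w = c' w) -> peval k c z = peval k c' z.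
Proof.
elim: k c c' => [|k IH] c c' h /=; first by rewrite h.
rewrite h //; congr (_ + _); apply: eq_bigr => l _; congr (_ * _).
by apply: IH => w kw; apply: h.
Qed.

Let key : countType := (('I_r + 'I_r * 'I_m) * seq 'I_m)%type.
(** Layout of an environment: variable 0 is the value [v], 1 the threshold to which a coordinate of
    the selection is compared, 2 and 3 are [eps] and [delta]; the polynomial coefficients start at
    4. *)
Let code (k : key) : nat := (4 + pickle k)%N.

Let Penv (env : nat -> R) (j : 'I_r) (z : 'I_m -> R) : R :=
  peval d (fun w => env (code (inl j, w))) z.
Let Genv (env : nat -> R) (j : 'I_r) (i : 'I_m) (z : 'I_m -> R) : R :=
  peval d (fun w => env (code (inr (j, i), w))) z.

Let ncrit (env : nat -> R) (u : nat -> R) : Prop :=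
  near_crit (env 0%N) (env 2%N) (env 3%N) (Penv env) (Genv env) u.

Lemma definable_ext (A B : (nat -> R) -> Prop) :
  (forall env, A env <-> B env) -> definable A -> definable B.
Proof. by move=> AB [phi h]; exists phi => e; rewrite h AB. Qed.

Lemma definable_peval k (c : seq 'I_m -> nat) (b : nat) :
  definable_fun (fun env : nat -> R => peval k (fun w => env (c w)) (fun i => env (b + i)%N)).
Proof.
elim: k c => [|k IH] c /=; apply: definable_funD; try exact: definable_fun_var.
  exact: (definable_fun_nat _ 0).
apply: definable_fun_sum => l; apply: definable_funM; first exact: definable_fun_var.
exact: (IH (fun w => c (l :: w))).
Qed.

Lemma definable_ncrit b : definable (fun env => ncrit env (fun i => env (b + i)%N)).
Proof.
have dP j : definable_fun (fun env => Penv env j (fun i : 'I_m => env (b + i)%N)).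
  exact: definable_peval.
have dG j i : definable_fun (fun env => Genv env j i (fun i : 'I_m => env (b + i)%N)).
  exact: definable_peval.
have dv i := @definable_fun_var R i.
apply: definable_and.
  apply: definable_all => i; apply: definable_and; apply: definable_le => //.
  exact: definable_funN.
apply: definable_and.
  by apply: definable_all => j; apply: definable_le => //; exact: (definable_fun_nat _ 0).
apply: definable_and.
  apply: definable_eq; last exact: (definable_fun_nat _ 1).
  exact: definable_fun_sum.
apply: definable_and.
  apply: definable_eq => //; apply: definable_fun_sum => j.
  exact: definable_funM.
apply: definable_and.
  apply: definable_all => j; apply: definable_and; apply: definable_le;
    by [exact: definable_funB|exact: definable_funM].
apply: definable_all => i; apply: definable_and; apply: definable_le => //.
- by apply: definable_fun_sum => j; exact: definable_funM.
- exact: definable_funN.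
- by apply: definable_fun_sum => j; exact: definable_funM.
Qed.

(** [peval d] reads words of length at most [d] only, so finitely many variables carry data and
    those from [B] on are free for quantified blocks. *)
Lemma code_bound : exists2 B, (4 <= B)%N &
  forall f w, (size w <= d)%N -> (code (f, w) < B)%N.
Proof.
have /choice[N hN] : forall f, exists N, forall w, (size w <= d)%N ->
  (code (f, w) < N)%N by move=> f; apply: words_bound.
exists (4 + \sum_f N f)%N => [//|f w dw].
by rewrite (bigD1 f) //= addnCA (leq_trans (hN f w dw)) // leq_addr.
Qed.

Lemma ncrit_agree B env env' u : (4 <= B)%N ->
  (forall f w, (size w <= d)%N -> (code (f, w) < B)%N) ->
  (forall i, (i < B)%N -> env i = env' i) -> ncrit env u <-> ncrit env' u.
Proof.
move=> B4 hB ee.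
have hlt i : (i < 4)%N -> (i < B)%N by move=> i4; apply: leq_trans B4.
have EP : Penv env = Penv env'.
  apply/funext => j; apply/funext => z; apply: peval_ext => w dw.
  by apply: ee; apply: hB.
have EG : Genv env = Genv env'.
  apply/funext => j; apply/funext => i; apply/funext => z; apply: peval_ext => w dw.
  by apply: ee; apply: hB.
by rewrite /ncrit EP EG !ee ?hlt.
Qed.

Let lexmin (env : nat -> R) (u : nat -> R) : Prop :=
  ncrit env u /\ forall u', ncrit env u' -> lexle q u u'.

Lemma definable_exists_ncrit : definable (fun env => exists u, ncrit env u).
Proof.
have [B B4 hB] := code_bound.
apply: definable_ext (definable_exists_block B q (definable_ncrit B)) => env.
have E u : ncrit (upd_block env B q u) (fun i => upd_block env B q u (B + i)%N) <-> ncrit env u.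
  rewrite (ncrit_agree (env' := env) _ B4 hB); last first.
    by move=> i iB; rewrite /upd_block leqNgt iB.
  by split; apply: near_crit_ext => i iq; rewrite /upd_block leq_addr ltn_add2l iq addKn.
by split=> -[u hu]; exists u; apply/E.
Qed.

(** The candidate occupies the block of length [q] at [B], its competitors the block after it; the
    data below [B] stay untouched. *)
Lemma definable_lexmin (c : 'I_q) :
  definable (fun env => exists u, lexmin env u /\ u c <= env 1%N).
Proof.
have [B B4 hB] := code_bound.
have dv i := @definable_fun_var R i.
have dlex : definable (fun env => ncrit env (fun i => env (B + q + i)%N) ->
    lexle q (fun i => env (B + i)%N) (fun i => env (B + q + i)%N)).
  apply: definable_imply; first exact: definable_ncrit.
  apply: definable_all => i; apply: definable_imply; last exact: definable_le.
  apply: definable_all => k; have [ki|ki] := boolP (k < i)%N.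
    by apply: definable_ext (definable_eq (dv (B + k)%N) (dv (B + q + k)%N)) => env; split; [move=> -> | apply].
  by apply: definable_ext (definable_true R) => env; split.
have := definable_exists_block B q (definable_and (definable_and (definable_ncrit B)
  (definable_forall_block (B + q) q dlex)) (definable_le (dv (B + c)%N) (dv 1%N))).
apply: definable_ext => env.
have B1 : (1 < B)%N by apply: leq_trans B4.
have low u i : (i < B)%N -> upd_block env B q u i = env i.
  by move=> iB; rewrite /upd_block leqNgt iB.
have mid u i : (i < q)%N -> upd_block env B q u (B + i)%N = u i.
  by move=> iq; rewrite /upd_block leq_addr ltn_add2l iq addKn.
have E u : ncrit (upd_block env B q u) (fun i => upd_block env B q u (B + i)%N) <-> ncrit env u.
  rewrite (ncrit_agree (env' := env) _ B4 hB); last by move=> i; exact: low.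
  by split; apply: near_crit_ext => i iq; rewrite mid.
pose e2 u u' := upd_block (upd_block env B q u) (B + q) q u'.
have low2 u u' i : (i < B)%N -> e2 u u' i = env i.
  by move=> iB; rewrite /e2 /upd_block [(B + q <= i)%N]leqNgt (leq_trans iB) ?leq_addr //= leqNgt iB.
have mid2 u u' i : (i < q)%N -> e2 u u' (B + i)%N = u i.
  move=> iq; rewrite /e2 /upd_block leq_add2l leqNgt iq /=.
  by rewrite leq_addr ltn_add2l iq addKn.
have top2 u u' i : (i < q)%N -> e2 u u' (B + q + i)%N = u' i.
  by move=> iq; rewrite /e2 /upd_block leq_addr ltn_add2l iq addKn.
have E2 u u' : ncrit (e2 u u') (fun i => e2 u u' (B + q + i)%N) <-> ncrit env u'.
  rewrite (ncrit_agree (env' := env) _ B4 hB); last by move=> i; exact: low2.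
  by split; apply: near_crit_ext => i iq; rewrite top2.
have L u u' : lexle q (fun i => e2 u u' (B + i)%N) (fun i => e2 u u' (B + q + i)%N) <-> lexle q u u'.
  by split=> h i hi; [have := h i; rewrite mid2 // top2 //; apply => k ki; rewrite mid2 // top2 // hi|
    rewrite mid2 // top2 //; apply: h => k ki; have := hi k ki; rewrite mid2 // top2].
split=> -[u [[h1 h2] h3]]; exists u; (split; first split); try by apply/E.
- by move=> u' hu'; apply/L; apply: h2; apply/E2.
- by move: h3; rewrite mid // low.
- by move=> u' /E2 hu'; apply/L; apply: h2.
- by rewrite mid // low.
Qed.

(** The coefficients, [eps], [delta] and the threshold [y] are all entries of the environment, so
    [N] depends only on [m], [r] and [d]. The first bound serves to count gaps between near critical
    values, the second to find where the selection hardly moves. *)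
Lemma near_crit_changes : exists N : nat, forall (cP : 'I_r -> seq 'I_m -> R)
    (cG : 'I_r -> 'I_m -> seq 'I_m -> R) (eps delta : R),
  let nc v u := near_crit v eps delta (fun j => peval d (cP j))
    (fun j i => peval d (cG j i)) u in
  (forall (v : nat -> R) K, {homo v : i j / (i < j)%N >-> i < j} ->
    (changes (fun k => `[< exists u, nc (v k) u >]) K <= N)%N) /\
  (forall (c : 'I_q) (y : R) (v : nat -> R) K,
    {homo v : i j / (i < j)%N >-> i < j} ->
    (changes (fun k => `[< exists u, (nc (v k) u /\
      forall u', nc (v k) u' -> lexle q u u') /\ (u c <= y)%R >]) K <= N)%N).
Proof.
have [N0 hN0] := definable_changes definable_exists_ncrit.
have /choice[N1 hN1] := fun c => definable_changes (definable_lexmin c).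
have [B B4 hB] := code_bound.
exists (N0 + \sum_c N1 c)%N => cP cG eps delta nc.
pose env (y : R) (i : nat) : R :=
  if i is i'.+4 then
    if unpickle i' is Some k then
      let: (f, w) := (k : key) in
      match f with inl j => cP j w | inr (j, i) => cG j i w end
    else 0
  else nth 0 [:: 0; y; eps; delta] i.
pose e y := mkseq (env y) B.
have envP y j w : env y (code (inl j, w)) = cP j w.
  by rewrite -[code _]/(pickle _).+4 /env pickleK.
have envG y j i w : env y (code (inr (j, i), w)) = cG j i w.
  by rewrite -[code _]/(pickle _).+4 /env pickleK.
have ncE y v u : ncrit (upd (nth 0 (e y)) 0%N v) u <-> nc v u.
  have hup i : (0 < i < B)%N -> upd (nth 0 (e y)) 0%N v i = env y i.
    by move=> /andP[i0 iB]; rewrite /upd; case: eqP i0 => [->//|_ _]; rewrite nth_mkseq.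
  rewrite /ncrit.
  have -> : Penv (upd (nth 0 (e y)) 0%N v) = fun j => peval d (cP j).
    apply/funext => j; apply/funext => z; apply: peval_ext => w dw.
    by rewrite hup ?hB // envP.
  have -> : Genv (upd (nth 0 (e y)) 0%N v) = fun j i => peval d (cG j i).
    apply/funext => j; apply/funext => i; apply/funext => z; apply: peval_ext => w dw.
    by rewrite hup ?hB // envG.
  by rewrite (hup 2%N) ?(hup 3%N) ?(leq_trans _ B4).
split=> [v K hv|c y v K hv].
  apply: leq_trans (leq_addr _ _); apply: leq_trans (hN0 (e 0) v K hv).
  rewrite /changes; apply: eq_leq; apply: eq_count => k.
  have E k' : `[< exists u, nc (v k') u >] =
      `[< exists u, ncrit (upd (nth 0 (e 0)) 0%N (v k')) u >].
    by apply/asboolP/asboolP => -[u hu]; exists u; [apply/ncE|apply/(ncE 0)].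
  by rewrite !E.
apply: (@leq_trans (N1 c)); last first.
  by rewrite (bigD1 c) //= addnCA leq_addr.
apply: leq_trans (hN1 c (e y) v K hv).
rewrite /changes; apply: eq_leq; apply: eq_count => k.
have E k' : `[< exists u, (nc (v k') u /\ forall u', nc (v k') u' -> lexle q u u')
      /\ u c <= y >] = `[< exists u, lexmin (upd (nth 0 (e y)) 0%N (v k')) u /\
        u c <= upd (nth 0 (e y)) 0%N (v k') 1%N >].
  have -> : upd (nth 0 (e y)) 0%N (v k') 1%N = y.
    by rewrite /upd /= nth_mkseq // (leq_trans _ B4).
  apply/asboolP/asboolP => -[u [[h1 h2] h3]]; exists u; (split; last by []); split.
  - by apply/ncE.
  - by move=> u' /ncE; exact: h2.
  - by apply/(ncE y).
  - by move=> u' hu'; apply: h2; apply/(ncE y).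
by rewrite !E.
Qed.

End UniformBounds.

Lemma count_exists_le (I : finType) (T : Type) (a : I -> pred T) (s : seq T) :
  (count (fun x => [exists i, a i x]) s <= \sum_i count (a i) s)%N.
Proof.
elim: s => [|x s IH] /=; first by [].
rewrite big_split /= leq_add //; case: existsP => // -[i ai].
by rewrite (bigD1 i) //= ai.
Qed.

(** Turns the absence of alternations into closeness: points not separated by a threshold share a
    cell, whose right end is the first threshold above them. *)
Lemma grid_close (R : realType) (lo hi a b : R) (M : nat) : (0 < M)%N ->
  lo <= a <= hi -> lo <= b <= hi ->
  (forall k, (k <= M)%N -> (a <= lo + (hi - lo) * k%:R / M%:R) =
                           (b <= lo + (hi - lo) * k%:R / M%:R)) ->
  `|a - b| <= (hi - lo) / M%:R.
Proof.
move=> M0; wlog ab : a b / a <= b => [H|].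
  move=> ha hb E; have [ab|/ltW ba] := leP a b; first exact: H.
  by rewrite distrC; apply: H => // k kM; rewrite E.
move=> /andP[la ah] /andP[lb bh] E.
pose y (k : nat) := lo + (hi - lo) * k%:R / M%:R.
have M0' : M%:R != 0 :> R by rewrite pnatr_eq0 -lt0n.
have Mp : 0 < M%:R :> R by rewrite ltr0n.
have ex : exists k, a <= y k by exists M; rewrite /y mulfK // addrC subrK.
case: (ex_minnP ex) => k ak kmin.
have kM : (k <= M)%N by apply: kmin; rewrite /y mulfK // addrC subrK.
have bk : b <= y k by rewrite -E.
rewrite distrC ger0_norm ?subr_ge0 //.
case: k ak kmin kM bk => [|k] ak kmin kM bk.
  move: bk; rewrite /y mulr0 mul0r addr0 => bk.
  have -> : b - a = 0 by apply/eqP; rewrite eq_le subr_ge0 ab subr_le0 (le_trans bk).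
  by rewrite divr_ge0 // subr_ge0 (le_trans la).
have yk : y k < a.
  by rewrite ltNge; apply/negP => /kmin; rewrite ltnn.
have -> : (hi - lo) / M%:R = y k.+1 - y k.
  by rewrite /y -[in k.+1%:R]addn1 natrD; field.
by apply: lerB => //; apply: ltW.
Qed.

(** * Packing of near critical values *)

Section Packing.
Context {R : realType} {m r : nat}.
Local Notation q := (m + r)%N.

(* The exact first order expansion of sum_j lambda_j P_j(z) between two near
   critical candidates, which is where near criticality is used. *)
Lemma near_crit_increment (P : 'I_r -> ('I_m -> R) -> R) G (eps delta Mq : R) v v' u u' (M : nat) :
  0 < eps -> 0 <= delta -> (0 < M)%N ->
  (forall j (z z' : 'I_m -> R) e, 0 <= e -> (forall i, `|z i| <= eps) ->
    (forall i, `|z' i| <= eps) -> (forall i, `|z' i - z i| <= e) ->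
    `|P j z' - P j z - \sum_i G j i z * (z' i - z i)| <= Mq * e ^+ 2) ->
  near_crit v eps delta P G u -> near_crit v' eps delta P G u' ->
  (forall c, (c < m)%N -> `|u' c - u c| <= 2 * eps / M%:R) ->
  (forall c, (m <= c < q)%N -> `|u' c - u c| <= M%:R^-1) ->
  v' - v <= (m%:R * 2 + r%:R) * (delta * eps) / M%:R + Mq * (2 * eps / M%:R) ^+ 2.
Proof.
move=> e0 d0 M0 tay [h1 [h2 [h3 [h4 [h5 h6]]]]] [h1' [h2' [h3' [h4' [h5' h6']]]]] du dl.
pose z := fun i : 'I_m => u i; pose z' := fun i : 'I_m => u' i.
pose l := fun j : 'I_r => u (m + j)%N; pose l' := fun j : 'I_r => u' (m + j)%N.
set e := 2 * eps / M%:R in du *.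
have e0' : 0 <= e by rewrite /e divr_ge0 // mulr_ge0 // ltW.
have zb i : `|z i| <= eps by rewrite ler_norml; apply/andP; exact: h1.
have zb' i : `|z' i| <= eps by rewrite ler_norml; apply/andP; exact: h1'.
have dz i : `|z' i - z i| <= e by apply: du.
have T j := tay j z z' e e0' zb zb' dz.
(* Both families of weights sum to 1, so [v'] can be subtracted in the second sum, where [P j z']
   differs from it by at most [delta * eps]. *)
have -> : v' - v = \sum_j l j * (P j z' - P j z) + \sum_j (l' j - l j) * (P j z' - v').
  have S0 : \sum_j (l' j - l j) * v' = 0 by rewrite -mulr_suml sumrB h3 h3' subrr mul0r.
  transitivity (\sum_j l j * (P j z' - P j z) + (\sum_j (l' j - l j) * (P j z')
     - \sum_j (l' j - l j) * v')).
    rewrite S0 subr0 -big_split /= {1}h4' {1}h4 -sumrB; apply: eq_bigr => j _.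
    rewrite -/(l' j) -/(l j) -/z -/z'; ring.
  by congr (_ + _); rewrite -sumrB; apply: eq_bigr => j _; rewrite mulrBr.
have lj j : 0 <= l j by apply: h2.
have b1 : \sum_j l j * (P j z' - P j z) <= m%:R * 2 * (delta * eps) / M%:R + Mq * e ^+ 2.
  have -> : Mq * e ^+ 2 = \sum_j l j * (Mq * e ^+ 2) by rewrite -mulr_suml h3 mul1r.
  apply: (@le_trans _ _ (\sum_j (l j * (\sum_i G j i z * (z' i - z i)) + l j * (Mq * e ^+ 2)))).
    apply: ler_sum => j _; rewrite -mulrDr; apply: ler_wpM2l => //.
    rewrite -lerBlDl; exact: le_trans (ler_norm _) (T j).
  rewrite big_split /= lerD2r.
  under eq_bigr do rewrite mulr_sumr.
  rewrite exchange_big /=.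
  apply: (@le_trans _ _ (\sum_(i < m) delta * e)).
    apply: ler_sum => i _.
    have -> : \sum_(j < r) l j * (G j i z * (z' i - z i)) = (\sum_j l j * G j i z) * (z' i - z i).
      by rewrite mulr_suml; apply: eq_bigr => j _; rewrite mulrA.
    apply: le_trans (ler_norm _) _; rewrite normrM ler_pM //.
    by rewrite ler_norml; apply/andP; split; case: (h6 i).
  rewrite sumr_const card_ord -mulr_natr /e le_eqVlt; apply/orP; left; apply/eqP; ring.
have b2 : \sum_j (l' j - l j) * (P j z' - v') <= r%:R * (delta * eps) / M%:R.
  apply: (@le_trans _ _ (\sum_(j < r) M%:R^-1 * (delta * eps))).
    apply: ler_sum => j _; apply: le_trans (ler_norm _) _; rewrite normrM ler_pM //.
      by apply: dl; rewrite leq_addr ltn_add2l /=.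
    by rewrite ler_norml; apply/andP; split; case: (h5' j) => // a b; rewrite lerNl opprB.
  rewrite sumr_const card_ord -mulr_natr le_eqVlt; apply/orP; left; apply/eqP; ring.
apply: le_trans (lerD b1 b2) _; rewrite le_eqVlt; apply/orP; left; apply/eqP; ring.
Qed.

(** An interval of near critical values has length at most [C * (delta * eps)]: cut it into [K]
    steps, more than all alternations of the comparisons of the selection with [M.+1] thresholds per
    coordinate. On some step nothing alternates, so the selection moves by one mesh at most and
    [near_crit_increment] bounds the step by a multiple of [delta * eps / M] up to a term in
    [M ^- 2]. Multiply by [K], which is of order [M], and let [M] grow. Hence consecutive values of
    [v] are separated by a value that is not near critical, and alternations bound the count. *)
Lemma near_crit_packing (d : nat) : exists (N : nat) (C : R), 0 <= C /\
  forall (cP : 'I_r -> seq 'I_m -> R) (cG : 'I_r -> 'I_m -> seq 'I_m -> R)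
    (eps delta Mq : R), 0 < eps -> 0 <= delta ->
  (forall j (z z' : 'I_m -> R) e, 0 <= e -> (forall i, `|z i| <= eps) ->
    (forall i, `|z' i| <= eps) -> (forall i, `|z' i - z i| <= e) ->
    `|peval d (cP j) z' - peval d (cP j) z -
      \sum_i peval d (cG j i) z * (z' i - z i)| <= Mq * e ^+ 2) ->
  forall v : nat -> R, (forall k, v k + C * (delta * eps) < v k.+1) ->
  forall L, (count (fun k => `[< exists u, near_crit (v k) eps delta
    (fun j => peval d (cP j)) (fun j i => peval d (cG j i)) u >]) (iota 0 L) <= N)%N.
Proof.
have [N hN] := @near_crit_changes R m r d.
(* The number [K] of steps used below is at most [A * M]. *)
pose A : R := ((q * 2 * N).+1)%:R.
pose C := A * (m%:R * 2 + r%:R).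
have C0 : 0 <= C by rewrite mulr_ge0 // addr_ge0 // mulr_ge0.
exists N, C; split=> // cP cG eps delta Mq e0 d0 tay.
have [hV hL] := hN cP cG eps delta.
pose nc (v : R) (u : nat -> R) := near_crit v eps delta (fun j => peval d (cP j))
  (fun j i => peval d (cG j i)) u.
pose V (x : R) := exists u, nc x u.
(* The sign of [Mq] follows from the expansion of any piece; without pieces there is no candidate,
   as the weights sum to 1. *)
have Mq0 : 0 <= Mq \/ r = 0%N.
  case: (posnP r) => [->|r0]; [by right|left].
  have b1 (i : 'I_m) : `|0 : R| <= eps by rewrite normr0 ltW.
  have b2 (i : 'I_m) : `|0 - 0 : R| <= 1 by rewrite subrr normr0.
  have := tay (Ordinal r0) (fun=> 0) (fun=> 0) 1 ler01 b1 b1 b2.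
  by rewrite expr1n mulr1; apply: le_trans.
have interval (s t : R) : s < t -> (forall x, s <= x <= t -> V x) -> t - s <= C * (delta * eps).
  move=> st Vst.
  have {}Mq0 : 0 <= Mq.
    case: Mq0 => // r0; have Vs : V s by apply: Vst; rewrite lexx ltW.
    have [u [_ [_ [S1 _]]]] := Vs; exfalso; move: S1.
    rewrite big1; last by case=> j jr; exfalso; move: jr; rewrite r0.
    by move/eqP; rewrite eq_sym oner_eq0.
  have key (M : nat) : (0 < M)%N -> t - s <= A * ((m%:R * 2 + r%:R) * (delta * eps) +
      Mq * 4 * eps ^+ 2 / M%:R).
    (* One more than the total of the alternations of the [q * M.+1] comparisons. *)
    move=> M0; pose K := (q * M.+1 * N).+1.
    pose v k := s + k%:R * ((t - s) / K%:R).
    have K0 : 0 < K%:R :> R by [].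
    have hv : {homo v : i j / (i < j)%N >-> i < j}.
      by move=> i j ij; rewrite /v ltrD2l ltr_pM2r ?ltr_nat // divr_gt0 ?subr_gt0.
    have Vv k : (k <= K)%N -> V (v k).
      move=> kK; apply: Vst; rewrite /v lerDl mulr_ge0 ?divr_ge0 ?subr_ge0 ?(ltW st) //=.
      rewrite -lerBrDl mulrCA ler_piMr ?subr_ge0 ?(ltW st) //.
      by rewrite ler_pdivrMr // mul1r ler_nat.
    have /choice[u hu] : forall k, exists u, (k <= K)%N ->
        nc (v k) u /\ forall u', nc (v k) u' -> lexle q u u'.
      move=> k; case: (leqP k K) => kK; last by exists (fun=> 0).
      have [||u hu] := @lexmin_near_crit R m r (v k) eps delta _ _ _ _ (Vv k kK).
      - by move=> j; exists d, (cP j).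
      - by move=> j i; exists d, (cG j i).
      by exists u.
    pose lo c : R := if (c < m)%N then - eps else 0.
    pose hi c : R := if (c < m)%N then eps else 1.
    pose y (c : 'I_q) (k : 'I_M.+1) : R := lo c + (hi c - lo c) * k%:R / M%:R.
    pose b (ck : 'I_q * 'I_M.+1) k := `[< exists u, (nc (v k) u /\
       forall u', nc (v k) u' -> lexle q u u') /\ u ck.1 <= y ck.1 ck.2 >].
    have uniq k u1 : (k <= K)%N -> nc (v k) u1 ->
        (forall u', nc (v k) u' -> lexle q u1 u') -> forall c : 'I_q, u1 c = u k c.
      move=> kK h1 h2 c; have [g1 g2] := hu k kK.
      have l1 := h2 _ g1; have l2 := g2 _ h1.
      suff : forall n (c : 'I_q), (c < n)%N -> u1 c = u k c by move=> /(_ c.+1 c); exact.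
      elim=> // n IH c' c'n; apply/eqP; rewrite eq_le l1 ?l2 //= => i ic.
        by apply: esym; apply: IH; apply: leq_trans ic _.
      by apply: IH; apply: leq_trans ic _.
    have bE ck k : (k <= K)%N -> b ck k = (u k ck.1 <= y ck.1 ck.2).
      move=> kK; apply/asboolP/idP => [[u1 [[h1 h2]]]|h]; first by rewrite (uniq k).
      by exists (u k); split=> //; exact: hu.
    have [i iK nochange] : exists2 i, (i < K)%N & forall ck, b ck i = b ck i.+1.
      have : (count (fun i => [exists ck, b ck i != b ck i.+1]) (iota 0 K) < K)%N.
        apply: leq_ltn_trans (count_exists_le _ _) _.
        apply: (@leq_ltn_trans (\sum_(ck : 'I_q * 'I_M.+1) N)).
          by apply: leq_sum => -[c k] _; apply: (hL c (y c k) v K).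
        by rewrite sum_nat_const card_prod !card_ord ltnS.
      rewrite -[X in (_ < X)%N](size_iota 0 K) ltn_neqAle -all_count => /andP[+ _].
      rewrite -has_predC => /hasP[i].
      rewrite mem_iota add0n /= => iK; rewrite negb_exists => /forallP h.
      by exists i => // ck; apply/eqP; have := h ck; rewrite negbK.
    have [n1 _] := hu i (ltnW iK); have [n2 _] := hu i.+1 iK.
    have close c : (c < q)%N -> `|u i.+1 c - u i c| <= (hi c - lo c) / M%:R.
      move=> cq; rewrite distrC; apply: grid_close => //.
      - exact: near_crit_bounds n1 _ cq.
      - exact: near_crit_bounds n2 _ cq.
      move=> k kM; have := nochange (Ordinal cq, Ordinal (kM : (k < M.+1)%N)).
      by rewrite !bE // ltnW.
    have := near_crit_increment e0 d0 M0 tay n1 n2.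
    have c1 c : (c < m)%N -> `|u i.+1 c - u i c| <= 2 * eps / M%:R.
      move=> cm; have := close c (leq_trans cm (leq_addr _ _)).
      by have -> : hi c - lo c = 2 * eps by rewrite /hi /lo cm; ring.
    have c2 c : (m <= c < q)%N -> `|u i.+1 c - u i c| <= M%:R^-1.
      move=> /andP[mc cq]; have := close c cq.
      by rewrite /hi /lo ltnNge mc /= subr0 mul1r.
    move=> /(_ c1 c2) {c1 c2}.
    have -> : v i.+1 - v i = (t - s) / K%:R by rewrite /v -[in i.+1%:R]addn1 natrD; ring.
    rewrite ler_pdivrMr // => H; apply: le_trans H _.
    have Mp : 0 < M%:R :> R by rewrite ltr0n.
    have -> : (m%:R * 2 + r%:R) * (delta * eps) / M%:R + Mq * (2 * eps / M%:R) ^+ 2 =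
       ((m%:R * 2 + r%:R) * (delta * eps) + Mq * 4 * eps ^+ 2 / M%:R) / M%:R.
      by field; rewrite gt_eqF.
    rewrite mulrAC -mulrA mulrC; apply: ler_wpM2r.
      rewrite addr_ge0 // ?divr_ge0 // ?mulr_ge0 // ?addr_ge0 ?mulr_ge0 ?exprn_ge0 ?(ltW e0) //.
    rewrite ler_pdivrMr // /A -natrM ler_nat /K [(q * M.+1 * N)%N]mulnAC [(q * 2 * N)%N]mulnAC.
    move: (q * N)%N => a; clear -M0; nia.
  rewrite leNgt; apply/negP => H.
  (* [D / M] is the contribution of the quadratic remainder to [key]; for [M] above [D / g] it is
     smaller than the excess [g] over the claimed bound. *)
  pose D := A * (Mq * 4 * eps ^+ 2).
  have D0 : 0 <= D.
    apply: mulr_ge0 => //; apply: mulr_ge0; last exact: sqr_ge0.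
    exact: mulr_ge0.
  pose g := t - s - C * (delta * eps).
  have g0 : 0 < g by rewrite subr_gt0.
  have [M MP] : exists M : nat, D / g < M%:R.
    exists (Num.truncn (D / g)).+1; exact: truncnS_gt.
  have M0 : (0 < M)%N by rewrite -(ltr_nat R); apply: le_lt_trans MP; rewrite divr_ge0 // ltW.
  have Mp : 0 < M%:R :> R by rewrite ltr0n.
  have := key M M0; rewrite mulrDr mulrA -/C -lerBlDl -/g.
  have -> : A * (Mq * 4 * eps ^+ 2 / M%:R) = D / M%:R by rewrite mulrA.
  by rewrite ler_pdivlMr // leNgt mulrC -ltr_pdivrMr // MP.
move=> v hv L.
have ce0 : 0 <= C * (delta * eps) by rewrite !mulr_ge0 // ltW.
have vlt k : v k < v k.+1 by apply: le_lt_trans (hv k); rewrite lerDl.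
have /choice[w hw] : forall k, exists w, [/\ v k < w, w < v k.+1 & ~ V w].
  move=> k; apply: contrapT => H.
  pose g := v k.+1 - v k - C * (delta * eps).
  have g0 : 0 < g by rewrite /g; have := hv k; lra.
  have := interval (v k + g / 4) (v k.+1 - g / 4).
  have h1 : v k + g / 4 < v k.+1 - g / 4 by rewrite /g in g0 *; lra.
  move=> /(_ h1) h2.
  suff : v k.+1 - g / 4 - (v k + g / 4) <= C * (delta * eps) by rewrite /g in g0 *; lra.
  apply: h2 => x /andP[x1 x2]; apply: contrapT => nV; apply: H; exists x.
  by split=> //; lra.
(* Interleaving [v] with the gap points [w] turns each near critical [v k] into an alternation. *)
pose s k := if odd k then w k./2 else v k./2.
have hs : {homo s : i j / (i < j)%N >-> i < j}.
  apply: homo_ltn; first exact: lt_trans.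
  move=> i; rewrite /s /= uphalf_half; case: (odd i) => /=.
    by have [_ + _] := hw i./2; rewrite add1n.
  by have [+ _ _] := hw i./2; rewrite add0n.
apply: leq_trans (hV s L.*2 hs).
rewrite /changes; elim: L => [//|L IH].
rewrite -addn1 iotaD count_cat /= addn0 add0n.
rewrite doubleD -[1.*2]/(1 + 1)%N addnA iotaD iotaD !count_cat /= !addn0 !add0n.
rewrite -addnA leq_add // /s addn1 /= odd_double /= doubleK uphalf_double.
case: asboolP => // VvL; apply: (leq_trans _ (leq_addr _ _)).
case: asboolP => // VwL.
by have [_ _ []] := hw L.
Qed.

End Packing.

(** * Sard's theorem *)

Section Sard.
Context {R : realType} {m' : nat}.
Local Notation m := m'.+1.
Implicit Types (x y z : 'rV[R]_m) (g h : 'rV[R]_m -> R).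
Local Notation partial i g := ('D_(delta_mx 0 i) g).
Local Notation CD := continuously_differentiable.

Lemma grid_cell (M t : R) (n : nat) : 0 < M -> (0 < n)%N -> - M <= t <= M ->
  exists k : 'I_n, `|t - (- M + (2 * k%:R + 1) * (M / n%:R))| <= M / n%:R.
Proof.
move=> M0 n0 /andP[t1 t2]; pose e := M / n%:R.
have np : 0 < n%:R :> R by rewrite ltr0n.
have e0 : 0 < e by rewrite divr_gt0.
have ne : n%:R * e = M by rewrite /e mulrC divfK // gt_eqF.
have ex : exists k : nat, t <= - M + (2 * k.+1%:R) * e.
  exists n.-1; rewrite prednK //; rewrite -mulrA ne; lra.
case: (ex_minnP ex) => k kt kmin.
have kn : (k < n)%N.
  have := kmin n.-1; rewrite prednK // -mulrA ne => /(_ _).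
  by move=> /(_ ltac:(lra)) kn; rewrite (leq_ltn_trans kn) // prednK.
have lb : - M + 2 * k%:R * e <= t.
  case: k kt kmin kn => [|k] kt kmin kn; first by rewrite mulr0 mul0r addr0.
  by rewrite leNgt; apply/negP => h; have := kmin k (ltW h); rewrite ltnn.
exists (Ordinal kn) => /=; rewrite -/e ler_norml.
move: kt; rewrite -addn1 natrD => kt.
have -> : (2 * k%:R + 1) * e = 2 * k%:R * e + e by ring.
have kt' : t <= - M + (2 * k%:R * e + 2 * e) by apply: le_trans kt _; rewrite le_eqVlt; apply/orP; left; apply/eqP; ring.
move: lb kt'; move: (2 * k%:R * e) => A lb kt'.
by apply/andP; split; lra.
Qed.

(** This is [near_crit] for the Taylor polynomials at [x] of the pieces in [S], with [delta] equal
    to [2 * eta * eps ^+ m'], so that [delta * eps] is the tolerance on the values. *)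
Definition taylor_crit (J : finType) (g : J -> 'rV[R]_m -> R) (S : {set J}) x
    (eps eta v : R) : Prop :=
  exists z (l : J -> R),
    [/\ `|z| <= eps, forall j, 0 <= l j & \sum_(j in S) l j = 1] /\
    [/\ v = \sum_(j in S) l j * taylor m (g j) x z,
        forall j, j \in S -> `|taylor m (g j) x z - v| <= 2 * eta * eps ^+ m &
        forall i, `|\sum_(j in S) l j * taylor m' (partial i (g j)) x z|
                    <= 2 * eta * eps ^+ m'].

(** The packing bound is applied to the pieces of [S] numbered by an ordinal; summing its constants
    over all subsets makes them independent of [S]. *)
Lemma taylor_packing (J : finType) (g : J -> 'rV[R]_m -> R) :
  (forall j, CD m (g j)) -> exists (N : nat) (C : R), 0 <= C /\
  forall (S : {set J}) x (eps eta : R), 0 < eps -> 0 <= eta ->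
  forall v : nat -> R, (forall k, v k + C * (2 * eta * eps ^+ m) < v k.+1) ->
  forall L, (count (fun k => `[< taylor_crit g S x eps eta (v k) >]) (iota 0 L) <= N)%N.
Proof.
move=> cg.
have /choice[N /choice[C hNC]] := fun r : nat => @near_crit_packing R m r m.
exists (\sum_(S : {set J}) N #|S|)%N, (\sum_(S : {set J}) C #|S|); split.
  by apply: sumr_ge0 => S _; case: (hNC #|S|).
move=> S x eps eta e0 eta0 v hv L.
apply: (@leq_trans (N #|S|)); last by rewrite (bigD1 S) //= leq_addr.
have [CS0 pack] := hNC #|S|.
pose G' (j : 'I_#|S|) := g (enum_val j).
have /choice[cP hcP] : forall j : 'I_#|S|, exists c, forall z : 'I_m -> R,
  taylor m (G' j) x (\row_i z i) = peval m c z.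
  by move=> j; exact: is_poly_taylor.
have /choice[cG hcG] : forall ji : 'I_#|S| * 'I_m, exists c, forall z : 'I_m -> R,
  taylor m' (partial ji.2 (G' ji.1)) x (\row_i z i) = peval m c z.
  by move=> ji; apply: (@is_poly_leq _ _ m' m); [|exact: is_poly_taylor].
(* These Lipschitz constants depend on [x] and [eps]. This is harmless, since [Mq] does not enter
   the conclusion of [near_crit_packing]. *)
have /choice[Lp hLp] : forall ji : 'I_#|S| * 'I_m, exists Lp, 0 <= Lp /\
    forall (z z' : 'I_m -> R) (e : R), 0 <= e -> (forall i, `|z i| <= eps) -> (forall i, `|z' i| <= eps) ->
    (forall i, `|z' i - z i| <= e) -> `|peval m (cG ji) z' - peval m (cG ji) z| <= Lp * e.
  by move=> ji; have [Lp Lp0 h] := peval_lipschitz m (cG ji) (ltW e0); exists Lp.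
pose delta := 2 * eta * eps ^+ m'.
have d0 : 0 <= delta by rewrite !mulr_ge0 // exprn_ge0 // ltW.
have dE : delta * eps = 2 * eta * eps ^+ m by rewrite /delta exprSr; ring.
have tay : forall j (z z' : 'I_m -> R) e, 0 <= e -> (forall i, `|z i| <= eps) ->
    (forall i, `|z' i| <= eps) -> (forall i, `|z' i - z i| <= e) ->
    `|peval m (cP j) z' - peval m (cP j) z -
      \sum_i peval m (cG (j, i)) z * (z' i - z i)| <= (\sum_ji Lp ji) * e ^+ 2.
  move=> j z z' e ee hz hz' hzz; rewrite -!hcP.
  have dT i y : derivable (taylor m (G' j) x) y (delta_mx 0 i).
    by have [] := @taylor_derive R m m' (G' j) x y i (cg _).
  have dT' i y : partial i (taylor m (G' j) x) y = taylor m' (partial i (G' j)) x y.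
    by have [] := @taylor_derive R m m' (G' j) x y i (cg _).
  have [xi [-> hxi]] := coord_mvt (\row_i z i) (\row_i z' i) dT.
  rewrite -sumrB; apply: le_trans (ler_norm_sum _ _ _) _.
  apply: (@le_trans _ _ (\sum_(i < m) Lp (j, i) * e ^+ 2)).
    apply: ler_sum => i _; rewrite dT' !mxE.
    have -> : xi i = \row_l (xi i 0 l) by apply/rowP => l; rewrite mxE.
    rewrite (hcG (j, i)) [X in _ - X]mulrC -mulrBr normrM expr2 mulrCA.
    apply: ler_pM => //; case: (hLp (j, i)) => _; apply => //= l.
      have [t /andP[t0 t1] ->] := hxi i l; rewrite !mxE.
      have -> : z l + t * (z' l - z l) = (1 - t) * z l + t * z' l by ring.
      apply: le_trans (ler_normD _ _) _; rewrite !normrM (ger0_norm t0).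
      have s0 : 0 <= 1 - t by rewrite subr_ge0.
      rewrite (ger0_norm s0); have -> : eps = (1 - t) * eps + t * eps by ring.
      by apply: lerD; apply: ler_wpM2l.
    have [t /andP[t0 t1] ->] := hxi i l; rewrite !mxE addrC addKr normrM (ger0_norm t0).
    by apply: le_trans (hzz l); rewrite ler_piMl.
  rewrite -mulr_suml ler_wpM2r ?sqr_ge0 //.
  rewrite [leRHS](bigID (fun ji : 'I_#|S| * 'I_m => ji.1 == j)) /=.
  rewrite -[leLHS]addr0; apply: lerD; last by apply: sumr_ge0 => ji _; case: (hLp ji).
  rewrite le_eqVlt; apply/orP; left; apply/eqP.
  rewrite (reindex_onto (fun i => (j, i)) (fun ji => ji.2)) /=.
    by apply: eq_bigl => i; rewrite !eqxx.
  by move=> [j' i] /= /eqP ->.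
have hv' k : v k + C #|S| * (delta * eps) < v k.+1.
  apply: le_lt_trans (hv k); rewrite lerD2l -dE; apply: ler_wpM2r.
    by rewrite mulr_ge0 // ltW.
  rewrite (bigD1 S) //= lerDl; apply: sumr_ge0 => S' _; by case: (hNC #|S'|).
apply: leq_trans (pack cP (fun j i => cG (j, i)) eps delta _ e0 d0 tay v hv' L).
apply: sub_count => k /asboolP[z [l [[zle l0 l1] [vE hP hG]]]]; apply/asboolP.
pose u i := if insub i is Some a then (z 0 (a : 'I_m)) else
  if insub (i - m)%N is Some b then l (enum_val (b : 'I_#|S|)) else 0.
have uz : (fun i : 'I_m => u i) = fun i => z 0 i by apply/funext => i; rewrite /u valK.
have ul (j : 'I_#|S|) : u (m + j)%N = l (enum_val j).
  by rewrite /u insubF ?addKn ?valK // ltnNge leq_addr.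
have sumS (F : J -> R) : \sum_(j < #|S|) l (enum_val j) * F (enum_val j) = \sum_(j in S) l j * F j.
  by rewrite [RHS]big_enum_val.
have Pz j : peval m (cP j) (fun i => u i) = taylor m (g (enum_val j)) x z.
  rewrite uz -hcP; congr (taylor _ _ _ _).
  by apply/rowP => i; rewrite mxE.
have Gz j i : peval m (cG (j, i)) (fun i => u i) = taylor m' (partial i (g (enum_val j))) x z.
  rewrite uz -hcG; congr (taylor _ _ _ _).
  by apply/rowP => i'; rewrite mxE.
exists u; split.
  move=> i; rewrite (congr1 (fun f => f i) uz).
  by apply/andP; rewrite -ler_norml (le_trans (ler_coord_norm z i)).
split; first by move=> j; rewrite ul.
split; first by under eq_bigr do rewrite ul; rewrite -l1 [RHS]big_enum_val.
split.
  by under eq_bigr do rewrite ul Pz; rewrite (sumS (fun j => taylor m (g j) x z)).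
split.
  move=> j; rewrite Pz dE; have := hP _ (enum_valP j); rewrite ler_norml => /andP[h1 h2].
  by split=> //; rewrite -opprB lerNl.
move=> i; under eq_bigr do rewrite ul Gz.
rewrite (sumS (fun j => taylor m' (partial i (g j)) x z)).
by have := hG i; rewrite ler_norml => /andP[h1 h2]; split.
Qed.

End Sard.

Section SardTheorem.
Context {R : realType} {m' : nat}.
Local Notation m := m'.+1.
Implicit Types (x y z : 'rV[R]_m) (g h : 'rV[R]_m -> R).
Local Notation partial i g := ('D_(delta_mx 0 i) g).
Local Notation CD := continuously_differentiable.

(** Membership in the closed pieces is forgotten and only equality of the values with positive
    weight is kept, which leaves a statement about smooth functions alone. *)
Definition crit_value (J : finType) (g : J -> 'rV[R]_m -> R) (M v : R) : Prop :=
  exists x (l : J -> R), [/\ `|x| <= M, forall j, 0 <= l j, \sum_j l j = 1,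
    forall j, l j != 0 -> g j x = v & forall i, \sum_j l j * partial i (g j) x = 0].

(** [v] need not be a convex combination of Taylor values, so it is moved to [v']. This costs one
    [eta * eps ^+ m], and comparing each piece with [v] costs another: hence the factors 2 in
    [taylor_crit]. *)
Lemma crit_value_taylor (J : finType) (g : J -> 'rV[R]_m -> R) (M eps eta v : R) x0 x (l : J -> R) :
  0 < eps -> 0 <= eta ->
  (forall j z, `|z| <= eps -> `|g j (z + x0) - taylor m (g j) x0 z| <= eta * eps ^+ m) ->
  (forall j i z, `|z| <= eps -> `|partial i (g j) (z + x0) - taylor m' (partial i (g j)) x0 z| <= eta * eps ^+ m') ->
  (forall j, 0 <= l j) -> \sum_j l j = 1 -> (forall j, l j != 0 -> g j x = v) ->
  (forall i, \sum_j l j * partial i (g j) x = 0) -> `|x - x0| <= eps ->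
  exists2 v', taylor_crit g [set j | l j != 0]%SET x0 eps eta v' & `|v' - v| <= eta * eps ^+ m.
Proof.
move=> e0 eta0 hT hG l0 l1 lv lg xx0.
pose z := x - x0; have zx : z + x0 = x by rewrite /z subrK.
pose S := [set j | l j != 0]%SET.
have sumS (F : J -> R) : \sum_(j in S) l j * F j = \sum_j l j * F j.
  rewrite [RHS](bigID (mem S)) /= [X in _ + X]big1 ?addr0 // => j.
  by rewrite finset.in_set negbK => /eqP ->; rewrite mul0r.
have sumS1 : \sum_(j in S) l j = 1.
  rewrite -l1 [RHS](bigID (mem S)) /= [X in _ + X]big1 ?addr0 // => j.
  by rewrite finset.in_set negbK => /eqP ->.
pose v' := \sum_(j in S) l j * taylor m (g j) x0 z.
have Tv j : j \in S -> `|taylor m (g j) x0 z - v| <= eta * eps ^+ m.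
  by rewrite finset.in_set => lj; rewrite distrC -(lv j lj) -{1}zx; apply: hT.
have vv : `|v' - v| <= eta * eps ^+ m.
  have -> : v' - v = \sum_(j in S) l j * (taylor m (g j) x0 z - v).
    rewrite -{1}(mul1r v) -sumS1 mulr_suml -sumrB.
    by apply: eq_bigr => j _; rewrite mulrBr.
  apply: le_trans (ler_norm_sum _ _ _) _.
  rewrite -[leRHS]mul1r -sumS1 mulr_suml; apply: ler_sum => j jS.
  by rewrite normrM (ger0_norm (l0 j)); apply: ler_wpM2l => //; apply: Tv.
exists v' => //; exists z, l; split; split=> //.
- move=> j jS; have -> : taylor m (g j) x0 z - v' = (taylor m (g j) x0 z - v) - (v' - v) by ring.
  apply: le_trans (ler_normB _ _) _.
  have -> : 2 * eta * eps ^+ m = eta * eps ^+ m + eta * eps ^+ m by ring.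
  by apply: lerD => //; apply: Tv.
move=> i; rewrite sumS.
have -> : \sum_j l j * taylor m' (partial i (g j)) x0 z =
    \sum_j (l j * taylor m' (partial i (g j)) x0 z - l j * partial i (g j) x).
  by rewrite sumrB lg subr0.
apply: le_trans (ler_norm_sum _ _ _) _.
apply: (@le_trans _ _ (\sum_j l j * (eta * eps ^+ m'))).
  apply: ler_sum => j _; rewrite -mulrBr normrM (ger0_norm (l0 j)).
  by apply: ler_wpM2l => //; rewrite distrC -{1}zx; apply: hG.
rewrite -mulr_suml l1 mul1r -mulrA ler_peMl ?mulr_ge0 ?exprn_ge0 ?(ltW e0) //.
by rewrite ler1n.
Qed.

(* Pigeonhole over the cubes of a grid: with n0 ^ m cubes of side M / n0, the
   o(eps ^ m) Taylor estimates leave most of [a, b] noncritical. *)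
Lemma sard (J : finType) (g : J -> 'rV[R]_m -> R) (M a b : R) :
  (forall j, CD m (g j)) -> 0 < M -> a < b ->
  exists2 v, a <= v <= b & ~ crit_value g M v.
Proof.
move=> cg M0 ab; apply: contrapT => H.
have crit v : a <= v <= b -> crit_value g M v.
  by move=> hv; apply: contrapT => nc; apply: H; exists v.
have [N [C [C0 pack]]] := taylor_packing cg.
pose T := #|{: {set J}}|.
(* Chosen for [big] below, and independent of the mesh: [n0] comes later because the radii of
   validity of the Taylor bounds depend on [eta]. *)
pose eta := (b - a) / (4 * (T * N).+1%:R * (C + 1) * M ^+ m).
have den0 : 0 < 4 * (T * N).+1%:R * (C + 1) * M ^+ m.
  by rewrite !mulr_gt0 ?exprn_gt0 // ltr_wpDl.
have eta0 : 0 < eta by rewrite divr_gt0 // subr_gt0.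
have /choice[r1 hr1] : forall j, exists r0, 0 < r0 /\ forall x, `|x| <= M ->
    forall r, 0 < r -> r <= r0 -> forall z, `|z| <= r ->
    `|g j (z + x) - taylor m (g j) x z| <= eta * r ^+ m.
  by move=> j; have [r0 ? ?] := taylor_bound M (cg j) eta0; exists r0.
have /choice[r2 hr2] : forall ji : J * 'I_m, exists r0, 0 < r0 /\ forall x, `|x| <= M ->
    forall r, 0 < r -> r <= r0 -> forall z, `|z| <= r ->
    `|partial ji.2 (g ji.1) (z + x) - taylor m' (partial ji.2 (g ji.1)) x z| <= eta * r ^+ m'.
  move=> [j i]; have [r0 ? ?] := taylor_bound M (CD_partial i (cg j)) eta0.
  by exists r0.
have [|ra ra0 hra] := @finite_lower_bound R _ r1; first by move=> j; case: (hr1 j).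
have [|rb rb0 hrb] := @finite_lower_bound R _ r2; first by move=> j; case: (hr2 j).
have rab : 0 < Num.min ra rb by rewrite lt_min ra0.
pose n0 := (Num.truncn (M / Num.min ra rb)).+1.
have n0p : 0 < n0%:R :> R by [].
pose eps := M / n0%:R.
have e0 : 0 < eps by rewrite divr_gt0.
have ne : n0%:R * eps = M by rewrite /eps mulrC divfK // gt_eqF.
have er : eps <= Num.min ra rb.
  by rewrite /eps ler_pdivrMr // mulrC -ler_pdivrMr // ltW // truncnS_gt.
pose X (k : {ffun 'I_m -> 'I_n0}) : 'rV[R]_m := \row_i (- M + (2 * (k i)%:R + 1) * eps).
have XM k : `|X k| <= M.
  apply: rV_norm_leP => [|i]; first exact: ltW.
  rewrite mxE ler_norml lerDl mulr_ge0 ?addr_ge0 ?mulr_ge0 ?(ltW M0) ?(ltW e0) //=.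
  have kn : (2 * (k i)%:R + 1) * eps <= 2 * n0%:R * eps.
    rewrite ler_wpM2r ?(ltW e0) // -natrM natr1 -natrM ler_nat.
    by rewrite ltn_mul2l ltn_ord.
  by move: kn; rewrite -mulrA ne => kn; lra.
(* One sample more than the pairs of a cube and a set of active pieces can account for. *)
pose L := (#|{: {ffun 'I_m -> 'I_n0} * {set J}}| * N).+1.
pose h := (b - a) / L%:R.
have h0 : 0 < h by rewrite divr_gt0 ?subr_gt0.
pose w (k : nat) := a + k%:R * h.
have wab (k0 : nat) : (k0 < L)%N -> a <= w k0 <= b.
  move=> kL; rewrite /w lerDl mulr_ge0 ?(ltW h0) //= -lerBrDl /h.
  rewrite mulrCA ler_piMr ?subr_ge0 ?(ltW ab) // ler_pdivrMr // mul1r ler_nat.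
  exact: ltnW.
(* For each cube and set of pieces the samples are moved by at most [eta * eps ^+ m] onto a near
   critical value, if there is one; [big] keeps the moved samples spaced. *)
have pick (kS : {ffun 'I_m -> 'I_n0} * {set J}) (i0 : nat) : exists v : R,
    `|v - w i0| <= eta * eps ^+ m /\
    ((exists2 v', taylor_crit g kS.2 (X kS.1) eps eta v' & `|v' - w i0| <= eta * eps ^+ m) ->
      taylor_crit g kS.2 (X kS.1) eps eta v).
  case: (pselect (exists2 v', taylor_crit g kS.2 (X kS.1) eps eta v' & `|v' - w i0| <= eta * eps ^+ m)).
    by move=> [v' h1 h2]; exists v'.
  move=> no; exists (w i0); split=> //; rewrite subrr normr0 mulr_ge0 ?(ltW eta0) //.
  by rewrite exprn_ge0 // ltW.
have [v0 hv0] := choice (fun kSi : _ * nat => pick kSi.1 kSi.2).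
pose v kS i := v0 (kS, i); have hv kS i := hv0 (kS, i).
have big : C * (2 * eta * eps ^+ m) + 2 * (eta * eps ^+ m) < h.
  have -> : C * (2 * eta * eps ^+ m) + 2 * (eta * eps ^+ m) = 2 * (C + 1) * eta * eps ^+ m by ring.
  have -> : 2 * (C + 1) * eta * eps ^+ m = (b - a) / (2 * (T * N).+1%:R * n0%:R ^+ m).
    rewrite /eps /eta expr_div_n; field.
    by rewrite !gt_eqF ?exprn_gt0 // ltr_wpDl.
  rewrite /h ltr_pM2l ?subr_gt0 // ltf_pV2 ?posrE ?mulr_gt0 ?exprn_gt0 //.
  rewrite -natrX -!natrM ltr_nat /L card_prod card_ffun !card_ord -/T.
  have np : (0 < n0 ^ m)%N by rewrite expn_gt0.
  have aux (p t : nat) : (0 < p)%N -> ((p * t).+1 < 2 * t.+1 * p)%N by clear; nia.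
  by rewrite -mulnA; apply: aux.
have cnt kS : (count (fun k => `[< taylor_crit g kS.2 (X kS.1) eps eta (v kS k) >]) (iota 0 L) <= N)%N.
  apply: pack => //; first exact: ltW.
  move=> i1; have [h1 _] := hv kS i1; have [h2 _] := hv kS i1.+1.
  have wS : w i1.+1 = w i1 + h by rewrite /w -[in i1.+1%:R]addn1 natrD; ring.
  move: h1 h2; rewrite wS !ler_norml => /andP[a1 a2] /andP[a3 a4].
  rewrite /v; move: big a1 a2 a3 a4; move: (eta * eps ^+ m) (C * _) (v0 _) (v0 _) => A B V1 V2; lra.
have : (L <= \sum_(kS : {ffun 'I_m -> 'I_n0} * {set J}) N)%N.
  apply: (@leq_trans (\sum_(kS : {ffun 'I_m -> 'I_n0} * {set J})
      count (fun k => `[< taylor_crit g kS.2 (X kS.1) eps eta (v kS k) >]) (iota 0 L))%N).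
    2: by apply: leq_sum => kS _; exact: cnt.
  apply: leq_trans (count_exists_le _ _).
  rewrite -{1}(size_iota 0 L) -{1}(count_predT (iota 0 L)) leq_eqVlt; apply/orP; left.
  apply/eqP; apply: eq_in_count => i1; rewrite mem_iota add0n /= => kL; apply/esym.
  have [x [l [xM l0 l1 lv lg]]] := crit _ (wab i1 kL).
  have /choice[kap hkap] : forall i, exists k : 'I_n0, `|x 0 i - (- M + (2 * k%:R + 1) * eps)| <= eps.
    move=> ii; apply: grid_cell => //.
    by rewrite -ler_norml; apply: le_trans (ler_coord_norm x ii) xM.
  pose K := [ffun ii => kap ii].
  have xX : `|x - X K| <= eps.
    by apply: rV_norm_leP => [|ii]; [exact: ltW|rewrite !mxE ffunE].
  apply/existsP; exists (K, [set j | l j != 0]%SET); apply/asboolP.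
  have [_ +] := hv (K, [set j | l j != 0]%SET) i1; apply => /=.
  apply: (crit_value_taylor (x := x) M e0 (ltW eta0)) => //.
    move=> j z zle; have [_ hh] := hr1 j; apply: hh => //.
    by apply: le_trans er _; rewrite ge_min hra.
  move=> j ii z zle; have [_ hh] := hr2 (j, ii); apply: hh => //.
  by apply: le_trans er _; rewrite ge_min hrb orbT.
by rewrite sum_nat_const ltnn.
Qed.

End SardTheorem.

(** * Descent along limit curves *)

Definition cell (R : realType) (T : R) (n i : nat) : R := T * i%:R / n%:R.

Section ZeroSet.
Context {R : realType}.
Local Notation mu := (@lebesgue_measure R).

Lemma lipschitz_continuous_R (psi : R -> R) (L : R) :
  (forall s t, `|psi t - psi s| <= L * `|t - s|) -> continuous psi.
Proof.
move=> hL x; apply/cvgrPdist_le => e e0.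
pose d := e / (`|L| + 1); have d0 : 0 < d by rewrite divr_gt0 // ltr_wpDl.
near=> y; apply: le_trans (hL _ _) _.
have yd : `|x - y| <= d by near: y; apply: cvgr_dist_le => //; exact: cvg_id.
apply: (@le_trans _ _ ((`|L| + 1) * d)); last by rewrite /d mulrCA mulfV ?mulr1 // gt_eqF // ltr_wpDl.
apply: (@le_trans _ _ ((`|L| + 1) * `|x - y|)).
  by apply: ler_wpM2r => //; apply: le_trans (ler_norm _) _; rewrite lerDl.
by apply: ler_wpM2l => //; rewrite addr_ge0.
Unshelve. all: by end_near. Qed.

Lemma closed_segment_extrema (Z : set R) (s t : R) : closed Z ->
  (exists2 u, s <= u <= t & Z u) ->
  exists a b, [/\ s <= a <= t, s <= b <= t, Z a, Z b &
    forall u, s <= u <= t -> Z u -> a <= u <= b].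
Proof.
move=> cZ [u0 u0st Zu0]; pose A := `[s, t]%classic `&` Z.
have cA : compact A by apply: compact_closedI => //; exact: segment_compact.
have A0 : A !=set0 by exists u0; split=> //=; rewrite in_itv.
have cid : {within A, continuous (@idfun R)} by apply: continuous_subspaceT => x; exact: cvg_id.
have [a /set_mem[ast Za] amin] := compact_EVT_min A0 cA cid.
have [b /set_mem[bst Zb] bmax] := compact_EVT_max A0 cA cid.
exists a, b; split=> //.
move=> u ust Zu; have Au : u \in A by apply/mem_set; split=> //=; rewrite in_itv.
by rewrite [a <= _]amin // [_ <= b]bmax.
Qed.

(* The increments of psi over the cells that meet its zero set are controlled
   by the measure of the small neighbourhood of the zero set, zero set excluded. *)
Lemma zero_cells_variation (psi : R -> R) (L T e : R) : 0 <= L ->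
  (forall s t, `|psi t - psi s| <= L * `|t - s|) -> 0 < T -> 0 < e ->
  exists2 d, 0 < d & forall n, (0 < n)%N -> T / n%:R <= d ->
    \sum_(i < n) (if `[< exists2 u, cell T n i <= u <= cell T n i.+1 & psi u = 0 >]
                  then `|psi (cell T n i.+1) - psi (cell T n i)| else 0) <= e.
Proof.
move=> L0 hL T0 e0.
pose Z := [set u | psi u = 0].
have cpsi := lipschitz_continuous_R hL.
have cZ : closed Z := closed_continuous_eq cpsi.
pose N d : set R := \bigcup_(z in Z) ball z d.
have oN d : open (N d) by apply: bigcup_open => z _; exact: ball_open.
pose B d := N d `\` Z.
have mB d : measurable (B d).
  by apply: measurableD; [exact: open_measurable|exact: closed_measurable].
pose I t : set R := `[0, t[%classic.
have mI t : measurable (I t) by exact: measurable_itv.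
have muI t : (mu (I t) < +oo)%E.
  by rewrite lebesgue_measure_itv /=; case: ifP => // _; rewrite -EFinB ltry.
have mIB d t : measurable (I t `&` B d) by exact: (measurableI _ _ (mI t) (mB d)).
have fin d t : mu (I t `&` B d) \is a fin_num.
  rewrite ge0_fin_numE //; apply: le_lt_trans (muI t).
  by apply: le_measure; rewrite ?inE; [exact: mIB|exact: mI|exact: subIsetl].
(* Distribution function of the measure carried by [B d]; increments of [F d] bound the lengths of
   intervals contained in [B d]. *)
pose F d t := fine (mu (I t `&` B d)).
have Fle d s t : s <= t -> F d s <= F d t.
  move=> st; apply: fine_le; rewrite ?fin //.
  apply: le_measure; rewrite ?inE; try exact: mIB.
  move=> u [+ Bu]; rewrite /I /= !in_itv /= => /andP[u0 us]; split=> //=.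
  by rewrite u0 (lt_le_trans us).
have Fgap d p q : 0 <= p -> p <= q -> (forall u, p < u < q -> B d u) -> q - p <= F d q - F d p.
  move=> p0; rewrite le_eqVlt => /orP[/eqP->|pq] hB; first by rewrite !subrr.
  have mq : measurable (`]p, q[%classic : set R) by exact: measurable_itv.
  have muq : mu `]p, q[%classic = (q - p)%:E.
    by rewrite lebesgue_measure_itv /= lte_fin pq EFinB.
  rewrite lerBrDr -lee_fin EFinD -muq /F !fineK ?fin //.
  rewrite -measureU //; last 2 first.
  - exact: mIB.
  - apply/seteqP; split=> // u [] /=; rewrite in_itv /= => /andP[pu _] [].
    by rewrite /I /= in_itv /= => /andP[_ /(lt_trans pu)]; rewrite ltxx.
  apply: le_measure; rewrite ?inE.
  - by apply: measurableU => //; exact: mIB.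
  - exact: mIB.
  move=> u [] /=.
    rewrite in_itv /= => /andP[pu uq]; split; last by apply: hB; rewrite pu.
    by rewrite /I /= in_itv /= uq (le_trans p0 (ltW pu)).
  move=> [+ Bu]; rewrite /I /= !in_itv /= => /andP[u0 us]; split=> //=.
  by rewrite u0 (lt_trans us).
(* [Z] is closed, so the sets [B d] decrease to the empty set as [d] tends to 0, and their measure
   in the bounded window tends to 0. *)
have [d d0 Fd] : exists2 d, 0 < d & L * F d T <= e.
  pose G (k : nat) := I T `&` B k.+1%:R^-1.
  have : (mu \o G) k @[k --> \oo] --> mu (\bigcap_k G k).
    apply: nonincreasing_cvg_mu.
    - by apply: le_lt_trans (muI T); apply: le_measure; rewrite ?inE; [exact: mIB|exact: mI|exact: subIsetl].
    - by move=> k; exact: mIB.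
    - by apply: bigcapT_measurable => k; exact: mIB.
    move=> k l kl; apply/subsetPset => u [Iu [[z Zz zu] nZ]]; split=> //; split=> //.
    by exists z => //; apply: le_ball zu; rewrite lef_pV2 ?posrE // ler_nat ltnS.
  have -> : \bigcap_k G k = set0.
    apply/seteqP; split=> // u hu; have [_ [_ nZ]] := hu 0%N Logic.I.
    apply: nZ; apply: cZ => A /nbhs_ballP[r /= r0 rA].
    have [k hk] : exists k : nat, (k.+1%:R^-1 : R) < r.
      by exists (Num.truncn r^-1); rewrite invf_plt ?posrE // truncnS_gt.
    have [_ [[z Zz zu] _]] := hu k Logic.I; exists z; split=> //; apply: rA.
    by apply: le_ball (ball_sym zu); exact: ltW.
  rewrite measure0 => /fine_cvg; rewrite /= => /cvgrPdist_le.
  have e' : 0 < e / (L + 1) by rewrite divr_gt0 // ltr_wpDl.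
  move=> /(_ _ e')[k _ /(_ k (leqnn k))] /=; rewrite sub0r normrN => Fk.
  exists k.+1%:R^-1 => //; rewrite /F -/(G k).
  apply: le_trans (ler_wpM2l L0 (le_trans (ler_norm _) Fk)) _.
  by rewrite mulrCA ler_piMr ?(ltW e0) // ler_pdivrMr ?mul1r ?lerDl // ltr_wpDl.
exists (d / 2); first by rewrite divr_gt0.
move=> n n0 nd; pose c := cell T n; rewrite -/c.
have np : 0 < n%:R :> R by rewrite ltr0n.
have cS i : c i.+1 = c i + T / n%:R by rewrite /c /cell -[in i.+1%:R]addn1 natrD; ring.
have c0 i : 0 <= c i by rewrite /c /cell divr_ge0 // mulr_ge0 // ltW.
have cle i : c i <= c i.+1 by rewrite cS lerDl divr_ge0 // ltW.
apply: (@le_trans _ _ (\sum_(i < n) L * (F d (c i.+1) - F d (c i)))).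
  apply: ler_sum => i _; case: asboolP => [zi|_]; last first.
    by rewrite mulr_ge0 // subr_ge0 Fle.
  (* [psi] vanishes at the first and last zeros [a] and [b] of the cell, so its increment comes from
     the two end stretches. They avoid [Z] and, the cell being no longer than [d / 2], lie in
     [B d]. *)
  have [a [b [/andP[sa at_] /andP[sb bt] Za Zb ab]]] := closed_segment_extrema cZ zi.
  have hB u z : c i <= u <= c i.+1 -> c i <= z <= c i.+1 -> Z z -> ~ Z u -> B d u.
    move=> /andP[u1 u2] /andP[z1 z2] Zz nZ; split=> //; exists z => //=.
    rewrite -ball_normE /=; apply: (@le_lt_trans _ _ (d / 2)); last by lra.
    apply: le_trans nd; have := cS i; rewrite ler_norml; move: (T / n%:R) => h ch.
    by apply/andP; split; lra.
  have g1 : a - c i <= F d a - F d (c i).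
    apply: Fgap => // u /andP[u1 u2].
    have us : c i <= u <= c i.+1 by rewrite (ltW u1) (ltW (lt_le_trans u2 at_)).
    apply: (hB u a) => //; first by rewrite sa.
    by move=> Zu; have /andP[+ _] := ab u us Zu; rewrite leNgt u2.
  have g2 : c i.+1 - b <= F d (c i.+1) - F d b.
    apply: Fgap => //; first exact: le_trans sb.
    move=> u /andP[u1 u2].
    have us : c i <= u <= c i.+1 by rewrite (ltW u2) (ltW (le_lt_trans sb u1)).
    apply: (hB u b) => //; first by rewrite sb.
    by move=> Zu; have /andP[_ +] := ab u us Zu; rewrite leNgt u1.
  have ab' : F d a <= F d b.
    have sbt : c i <= b <= c i.+1 by rewrite sb.
    by apply: Fle; have /andP[] := ab b sbt Zb.
  have -> : psi (c i.+1) - psi (c i) = (psi (c i.+1) - psi b) + (psi a - psi (c i)).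
    by rewrite Za Zb; ring.
  apply: le_trans (ler_normD _ _) _.
  apply: le_trans (lerD (hL b (c i.+1)) (hL (c i) a)) _.
  rewrite -mulrDr ler_wpM2l // !ger0_norm ?subr_ge0 //; lra.
rewrite -mulr_sumr.
have -> : \sum_(i < n) (F d (c i.+1) - F d (c i)) = F d (c n) - F d (c 0%N).
  by rewrite -(telescope_sumr (fun i => F d (c i))) // big_mkord.
apply: le_trans Fd; rewrite ler_wpM2l //.
have -> : c n = T by rewrite /c /cell mulfK // gt_eqF.
by rewrite gerBl; apply: fine_ge0.
Qed.

End ZeroSet.

(** Induction on the set of functions still in use: follow [phis j] up to the last time [s1] at
    which [phi] meets it; after [s1] the index [j] is never selected. *)
Lemma lipschitz_selection (R : realType) (J : finType) (phi : R -> R)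
  (phis : J -> R -> R) (L : R) : continuous phi ->
  (forall j s t, `|phis j t - phis j s| <= L * `|t - s|) ->
  (forall t, exists j, phi t = phis j t) ->
  forall s t, `|phi t - phi s| <= L * `|t - s|.
Proof.
move=> cphi hL sel.
have cphis j := lipschitz_continuous_R (hL j).
(* The left end is excluded because [j] is still in use at [s1] itself; continuity of [phi] recovers
   it. *)
have key : forall n (A : {set J}), (#|A| <= n)%N -> forall s t, s < t ->
    (forall u, s < u <= t -> exists2 j, j \in A & phi u = phis j u) ->
    `|phi t - phi s| <= L * (t - s).
  elim=> [|n IH] A cA s t st hA.
    have [|j jA _] := hA t; first by rewrite st lexx.
    by move: cA; rewrite (cardsD1 j) jA.
  have step s' : s < s' <= t -> `|phi t - phi s'| <= L * (t - s').
    move=> /andP[ss' s't]; have [|j jA E] := hA s'; first by rewrite ss'.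
    have cZ : closed [set u | phi u - phis j u = 0].
      by apply: closed_continuous_eq; apply: contB.
    have hex : exists2 u, s' <= u <= t & [set u | phi u - phis j u = 0] u.
      by exists s'; rewrite ?lexx //= E subrr.
    have [s0 [s1 [_ /andP[s's1 s1t] _ Z1 hmax]]] := closed_segment_extrema cZ hex.
    have E1 : phi s1 = phis j s1 by apply/eqP; rewrite -subr_eq0; apply/eqP.
    have d1 : `|phi s1 - phi s'| <= L * (s1 - s').
      by rewrite E E1 -[s1 - s']ger0_norm ?subr_ge0.
    move: s1t; rewrite le_eqVlt => /orP[/eqP <-//|s1t].
    have d2 : `|phi t - phi s1| <= L * (t - s1).
      apply: (IH (A :\ j)%SET) => //.
        by move: cA; rewrite (cardsD1 j) jA.
      move=> u /andP[s1u ut]; have [|k kA Ek] := hA u.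
        by rewrite (lt_trans ss' (le_lt_trans s's1 s1u)).
      exists k => //; rewrite finset.in_setD1 kA andbT; apply/eqP => kj.
      have us : s' <= u <= t by rewrite ut (ltW (le_lt_trans s's1 s1u)).
      have Zu : phi u - phis j u = 0 by rewrite Ek kj subrr.
      by have /andP[_] := hmax u us Zu; rewrite leNgt s1u.
    have -> : phi t - phi s' = (phi t - phi s1) + (phi s1 - phi s') by ring.
    have -> : L * (t - s') = L * (t - s1) + L * (s1 - s') by ring.
    exact: le_trans (ler_normD _ _) (lerD d2 d1).
  apply/ler_addgt0Pr => e e0.
  have L0 : 0 <= L.
    have [j _] := sel 0; have := hL j 0 1; rewrite subr0 normr1 mulr1.
    exact: le_trans.
  have /cvgrPdist_le /(_ e e0) := cphi s.
  rewrite -nbhs_nearE => /nbhs_ballP[r /= r0 hr].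
  pose s' := Num.min (s + r / 2) t.
  have ss' : s < s' <= t by rewrite lt_min st ge_min lexx orbT ltrDl divr_gt0.
  have /andP[s1 s2] := ss'.
  have hs' : `|phi s - phi s'| <= e.
    apply: hr; rewrite -ball_normE /= ltr0_norm ?subr_lt0 // opprB ltrBlDl.
    by rewrite (@le_lt_trans _ _ (s + r / 2)) ?ge_min ?lexx // ltrD2l; lra.
  have -> : phi t - phi s = (phi t - phi s') + (phi s' - phi s) by ring.
  apply: le_trans (ler_normD _ _) _; apply: lerD; last by rewrite distrC.
  apply: le_trans (step s' ss') _; apply: ler_wpM2l => //.
  by rewrite lerD2l lerN2 ltW.
have key' s t : s < t -> `|phi t - phi s| <= L * `|t - s|.
  move=> st; rewrite [`|t - s|]gtr0_norm ?subr_gt0 //; apply: (key #|J| [set: J]%SET) => //.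
    by rewrite cardsT.
  by move=> u _; have [j E] := sel u; exists j => //; rewrite finset.in_setT.
move=> s t; have [/key'//|/key'|->] := ltgtP s t.
  by rewrite distrC [`|s - t|]distrC.
by rewrite !subrr normr0 mulr0.
Qed.

Section ChainRule.
Context {R : realType} {m : nat} {J : finType}.
Implicit Types (x y z : 'rV[R]_m).
Local Notation partial i g := ('D_(delta_mx 0 i) g).
Local Notation CD := continuously_differentiable.
Variables (C : J -> set 'rV[R]_m) (g : J -> 'rV[R]_m -> R) (f : 'rV[R]_m -> R).
Hypothesis g2 : forall j, CD 2 (g j).
Hypothesis cf : continuous f.
Hypothesis fg : forall j x, C j x -> f x = g j x.

(* gamma solves gamma' in - conv {grad g_j (gamma) : gamma in C_j} in integrated
   form; Lam j t is the time spent up to t on the piece j. *)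
Record limit_curve (M La B : R) (gam : R -> 'rV[R]_m) (Lam : J -> R -> R) : Prop :=
  LimitCurve {
    curve_bounded : forall t, `|gam t| <= M;
    curve_lipschitz : forall s t, `|gam t - gam s| <= La * `|t - s|;
    curve_mono : forall j s t, s <= t -> Lam j s <= Lam j t;
    curve_total : forall s t, 0 <= s -> s <= t -> \sum_j (Lam j t - Lam j s) = t - s;
    curve_inclusion : forall s t i, 0 <= s -> s <= t ->
      `|gam t 0 i - gam s 0 i + \sum_j (Lam j t - Lam j s) * partial i (g j) (gam s)|
        <= B * (t - s) ^+ 2;
    curve_visit : forall j s t, 0 <= s -> s <= t -> Lam j s < Lam j t ->
      exists2 u, s <= u <= t & C j (gam u);
    curve_covered : forall t, exists j, C j (gam t) }.

Variables (M La B : R) (gam : R -> 'rV[R]_m) (Lam : J -> R -> R).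
Hypothesis hc : limit_curve M La B gam Lam.

Let La0 : 0 <= La.
Proof.
by have := curve_lipschitz hc 0 1; rewrite subr0 normr1 mulr1; apply: le_trans.
Qed.

Lemma curve_continuous : continuous gam.
Proof.
move=> t; apply: cvg_rV => i.
apply: (@lipschitz_continuous_R _ (fun u => gam u 0 i) La) => s u.
apply: le_trans (curve_lipschitz hc s u).
by have := ler_coord_norm (gam u - gam s) i; rewrite !mxE.
Qed.

(** [f] is only assumed continuous, but along the curve it is a continuous selection among the
    Lipschitz functions [g j (gam t)]. *)
Lemma curve_pieces_lipschitz : exists2 L, 0 <= L &
  (forall j s t, `|g j (gam t) - g j (gam s)| <= L * `|t - s|) /\
  (forall s t, `|f (gam t) - f (gam s)| <= L * `|t - s|).
Proof.
have /choice[L hL] : forall j, exists L, 0 <= L /\ forall x y, `|x| <= M -> `|y| <= M ->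
    `|g j y - g j x| <= L * `|y - x|.
  move=> j; have c1 : CD 1 (g j) by exact: CD_leq (g2 j).
  by have [L ? ?] := CD1_lipschitz M c1; exists L.
have L0 j : 0 <= L j by case: (hL j).
have gl j s t : `|g j (gam t) - g j (gam s)| <= (\sum_k L k) * La * `|t - s|.
  have [_ h] := hL j; apply: le_trans (h _ _ (curve_bounded hc s) (curve_bounded hc t)) _.
  rewrite -mulrA; apply: ler_pM => //; last exact: (curve_lipschitz hc).
  by rewrite (bigD1 j) //= lerDl; apply: sumr_ge0.
exists ((\sum_k L k) * La); first by rewrite mulr_ge0 // sumr_ge0.
split=> //; apply: (@lipschitz_selection R J (fun t => f (gam t)) (fun j t => g j (gam t))) => //.
  by move=> t; apply: (@continuous_comp _ _ _ gam f); [exact: curve_continuous|exact: cf].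
by move=> t; have [j Cj] := curve_covered hc t; exists j; apply: fg.
Qed.

Lemma curve_descent (T : R) : 0 < T ->
  f (gam T) - f (gam 0) <= - (\sum_i (gam T 0 i - gam 0 0 i) ^+ 2) / T.
Proof.
move=> T0.
have [L L0 [gL fL]] := curve_pieces_lipschitz.
have /choice[Bg hBg] : forall j, exists L, 0 <= L /\ forall x y, `|x| <= M -> `|y| <= M ->
    `|g j y - g j x - \sum_i partial i (g j) x * (y 0 i - x 0 i)| <= L * `|y - x| ^+ 2.
  by move=> j; have [L' ? ?] := CD2_taylor M (g2 j); exists L'.
pose psi j t := f (gam t) - g j (gam t).
have psiL j s t : `|psi j t - psi j s| <= (L + L) * `|t - s|.
  have -> : psi j t - psi j s = (f (gam t) - f (gam s)) - (g j (gam t) - g j (gam s)).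
    by rewrite /psi; ring.
  by rewrite mulrDl; apply: le_trans (ler_normB _ _) _; apply: lerD.
(* Mean velocity. On a cell of length [h], completing the square bounds [- dy ^+ 2] by
   [h * (w ^+ 2 * h - 2 * w * dy)], which is linear in the increment [dy]; the sum over cells then
   telescopes to minus the squared displacement over [T]. *)
pose w i := (gam T 0 i - gam 0 0 i) / T.
pose K := m%:R * La * `|B| + (\sum_j Bg j) * La ^+ 2.
have K0 : 0 <= K.
  rewrite addr_ge0 ?mulr_ge0 ?sqr_ge0 ?sumr_ge0 // => j _.
  by case: (hBg j).
have one (s t : R) : 0 <= s -> s < t -> f (gam t) - f (gam s) <=
    \sum_i (w i ^+ 2 * (t - s) - 2 * w i * (gam t 0 i - gam s 0 i)) + K * (t - s) ^+ 2 +
    \sum_j (if `[< exists2 u, s <= u <= t & psi j u = 0 >] then `|psi j t - psi j s| else 0).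
  move=> s0 st; pose h := t - s; have h0 : 0 < h by rewrite subr_gt0.
  pose dL j := Lam j t - Lam j s.
  have dL0 j : 0 <= dL j by rewrite subr_ge0; apply: curve_mono hc _ _ _ (ltW st).
  have dLh : \sum_j dL j = h by apply: curve_total hc _ _ s0 (ltW st).
  pose dy i := gam t 0 i - gam s 0 i.
  have dyl : `|gam t - gam s| <= La * h.
    by have := curve_lipschitz hc s t; rewrite (gtr0_norm h0).
  have dyi i : `|dy i| <= La * h.
    by apply: le_trans dyl; have := ler_coord_norm (gam t - gam s) i; rewrite !mxE.
  (* The increment of [f] is averaged over the pieces with the times spent on them as weights, and
     [f] is written as [g j + psi j] on each. *)
  have E : h * (f (gam t) - f (gam s)) =
      \sum_j dL j * (g j (gam t) - g j (gam s)) + \sum_j dL j * (psi j t - psi j s).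
    rewrite -dLh mulr_suml -big_split /=; apply: eq_bigr => j _.
    by rewrite /psi; ring.
  have b1 : \sum_j dL j * (g j (gam t) - g j (gam s)) <=
      h * (\sum_i (w i ^+ 2 * h - 2 * w i * dy i)) + h * (K * h ^+ 2).
    have c1 j : dL j * (g j (gam t) - g j (gam s)) <=
        dL j * (\sum_i partial i (g j) (gam s) * dy i) + dL j * ((\sum_j Bg j) * La ^+ 2 * h ^+ 2).
      rewrite -mulrDr; apply: ler_wpM2l => //; rewrite -lerBlDl.
      have [Bg0 hB] := hBg j.
      apply: le_trans (ler_norm _) _.
      apply: le_trans (hB _ _ (curve_bounded hc s) (curve_bounded hc t)) _.
      rewrite -mulrA -exprMn; apply: ler_pM => //.
        by rewrite (bigD1 j) //= lerDl; apply: sumr_ge0 => k _; case: (hBg k).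
      by rewrite lerXn2r ?nnegrE // mulr_ge0 // ltW.
    apply: le_trans (ler_sum _ (fun j _ => c1 j)) _.
    rewrite big_split /= -mulr_suml dLh.
    have -> : \sum_j dL j * (\sum_i partial i (g j) (gam s) * dy i) =
        \sum_i (\sum_j dL j * partial i (g j) (gam s)) * dy i.
      under eq_bigr do rewrite mulr_sumr.
      rewrite exchange_big /=; apply: eq_bigr => i _; rewrite mulr_suml.
      by apply: eq_bigr => j _; rewrite mulrA.
    have c2 i : (\sum_j dL j * partial i (g j) (gam s)) * dy i <=
        h * (w i ^+ 2 * h - 2 * w i * dy i) + h * (La * `|B| * h ^+ 2).
      have := curve_inclusion hc i s0 (ltW st); rewrite -/h -/(dy i).
      set A := \sum_j _ => hA.
      have -> : A * dy i = - (dy i) ^+ 2 + (dy i + A) * dy i by ring.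
      apply: lerD.
        rewrite -subr_ge0.
        have -> : h * (w i ^+ 2 * h - 2 * w i * dy i) - - dy i ^+ 2 = (w i * h - dy i) ^+ 2 by ring.
        exact: sqr_ge0.
      apply: le_trans (ler_norm _) _; rewrite normrM.
      have -> : h * (La * `|B| * h ^+ 2) = (`|B| * h ^+ 2) * (La * h) by ring.
      apply: ler_pM => //; apply: le_trans hA _; apply: ler_wpM2r; first exact: sqr_ge0.
      exact: ler_norm.
    apply: le_trans (lerD (ler_sum _ (fun i _ => c2 i)) (lexx _)) _.
    rewrite big_split /= -mulr_sumr -addrA lerD2l sumr_const card_ord -mulr_natr /K.
    rewrite le_eqVlt; apply/orP; left; apply/eqP; ring.
  have b2 : \sum_j dL j * (psi j t - psi j s) <= h * \sum_j
     (if `[< exists2 u, s <= u <= t & psi j u = 0 >] then `|psi j t - psi j s| else 0).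
    rewrite mulr_sumr; apply: ler_sum => j _.
    have dLj : dL j <= h by rewrite -dLh (bigD1 j) //= lerDl; apply: sumr_ge0.
    case: asboolP => [_|nz].
      apply: le_trans (ler_norm _) _; rewrite normrM (ger0_norm (dL0 j)).
      by apply: ler_wpM2r.
    (* A piece without a zero of [psi j] on the cell is not visited there, so its weight
       vanishes. *)
    have -> : dL j = 0; last by rewrite mul0r mulr0.
    apply/eqP; rewrite eq_le dL0 andbT leNgt subr_gt0; apply/negP => lt.
    have [u us Cu] := curve_visit hc s0 (ltW st) lt; apply: nz; exists u => //.
    by rewrite /psi (fg Cu) subrr.
  rewrite -(ler_pM2l h0) E; apply: le_trans (lerD b1 b2) _.
  by rewrite -/h -/dy; rewrite !mulrDr.
apply/ler_addgt0Pr => e e0.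
pose e1 := e / 2 / (#|J|%:R + 1).
have e10 : 0 < e1 by rewrite !divr_gt0 // ltr_wpDl.
have LL : 0 <= L + L by rewrite addr_ge0.
have /choice[d hd] : forall j, exists d, 0 < d /\ forall n, (0 < n)%N -> T / n%:R <= d ->
    \sum_(i < n) (if `[< exists2 u, cell T n i <= u <= cell T n i.+1 & psi j u = 0 >]
                  then `|psi j (cell T n i.+1) - psi j (cell T n i)| else 0) <= e1.
  by move=> j; have [d ? ?] := zero_cells_variation LL (psiL j) T0 e10; exists d.
have [|d0 d00 hd0] := @finite_lower_bound R _ d; first by move=> j; case: (hd j).
(* The mesh is fine enough for all the zero sets, and the quadratic errors sum to [K * T * (T / n)],
   at most [e / 2]. *)
pose d1 := Num.min d0 (e / 2 / (K * T + 1)).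
have KT0 : 0 < K * T + 1 by rewrite ltr_wpDl // mulr_ge0 // ltW.
have d10 : 0 < d1 by rewrite lt_min d00 /= !divr_gt0.
pose n := (Num.truncn (T / d1)).+1.
have np : 0 < n%:R :> R by [].
have nd : T / n%:R <= d1.
  by rewrite ler_pdivrMr // mulrC -ler_pdivrMr // ltW // truncnS_gt.
pose c := cell T n.
have cS i : c i.+1 = c i + T / n%:R by rewrite /c /cell -[in i.+1%:R]addn1 natrD; ring.
have Tn0 : 0 < T / n%:R by rewrite divr_gt0.
have cn : c n = T by rewrite /c /cell mulfK // gt_eqF.
have c0 : c 0%N = 0 by rewrite /c /cell mulr0 mul0r.
have ci i : 0 <= c i by rewrite /c /cell divr_ge0 // mulr_ge0 // ltW.
have -> : f (gam T) - f (gam 0) = \sum_(i < n) (f (gam (c i.+1)) - f (gam (c i))).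
  by rewrite -(big_mkord xpredT (fun i => f (gam (c i.+1)) - f (gam (c i)))) telescope_sumr // cn c0.
have st (i : 'I_n) : c i < c i.+1 by rewrite cS ltrDl.
apply: le_trans; first by apply: ler_sum => i _; exact: (one _ _ (ci i) (st i)).
rewrite 2!big_split /=.
have h1 : \sum_(i < n) \sum_l (w l ^+ 2 * (c i.+1 - c i) - 2 * w l * (gam (c i.+1) 0 l - gam (c i) 0 l))
    = - (\sum_l (gam T 0 l - gam 0 0 l) ^+ 2) / T.
  rewrite exchange_big /= -sumrN mulr_suml; apply: eq_bigr => l _.
  rewrite sumrB -!mulr_sumr.
  rewrite -(big_mkord xpredT (fun i => c i.+1 - c i)) telescope_sumr // cn c0.
  rewrite -(big_mkord xpredT (fun i => gam (c i.+1) 0 l - gam (c i) 0 l)).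
  rewrite (telescope_sumr (fun i => gam (c i) 0 l)) // cn c0 subr0 /w.
  by field; rewrite gt_eqF.
have h2 : \sum_(i < n) K * (c i.+1 - c i) ^+ 2 <= e / 2.
  apply: (@le_trans _ _ (\sum_(i < n) K * (T / n%:R) ^+ 2)).
    by apply: ler_sum => i _; rewrite cS addrC addKr.
  rewrite sumr_const card_ord -[leLHS]mulr_natr.
  have -> : K * (T / n%:R) ^+ 2 * n%:R = K * T * (T / n%:R) by field; rewrite gt_eqF.
  apply: (@le_trans _ _ ((K * T + 1) * d1)).
    apply: ler_pM => //; rewrite ?mulr_ge0 ?(ltW T0) ?lerDl ?invr_ge0 //.
  by rewrite mulrC -ler_pdivlMr // ge_min lexx orbT.
have h3 : \sum_(i < n) \sum_j (if `[< exists2 u, c i <= u <= c i.+1 & psi j u = 0 >]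
    then `|psi j (c i.+1) - psi j (c i)| else 0) <= e / 2.
  rewrite exchange_big /=; apply: (@le_trans _ _ (\sum_(j : J) e1)).
    apply: ler_sum => j _; have [_ h] := hd j; apply: h => //.
    apply: le_trans nd _; apply: le_trans _ (hd0 j).
    by rewrite ge_min lexx.
  rewrite sumr_const -[leLHS]mulr_natr /e1 mulrAC ler_pdivrMr; last by rewrite ltr_wpDl.
  by rewrite ler_wpM2l ?lerDl // divr_ge0 // ltW.
by rewrite h1 -addrA lerD2l [leRHS]splitr lerD.
Qed.

End ChainRule.

(** * Gordan's alternative *)

Section Gordan.
Context {R : realType}.

(** Take the point [p l] of least norm in the convex hull. If it is not 0 it separates: should some
    [a j] have a product with [p l] below [N l], moving slightly towards [a j] would shorten the
    norm. *)
Lemma gordan_ord (m q : nat) (a : 'I_q -> 'I_m -> R) :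
  (exists l : 'I_q -> R, [/\ forall j, 0 <= l j, \sum_j l j = 1 &
     forall i, \sum_j l j * a j i = 0]) \/
  (exists (w : 'I_m -> R) (c : R), 0 < c /\ forall j, c <= \sum_i a j i * w i).
Proof.
have [q0|q0] := posnP q.
  right; exists (fun=> 0), 1; split=> // -[j jq]; exfalso.
  by move: jq; rewrite q0.
pose A := [set l : 'rV[R]_q | (forall j, 0 <= l 0 j) /\ \sum_j l 0 j = 1].
have coord j : continuous (fun l : 'rV[R]_q => l 0 j) by exact: coord_continuous.
have cA : compact A.
  apply: bounded_closed_compact.
    exists 1; split; first by rewrite num_real.
    move=> M M1 l [l0 l1] /=; apply: rV_norm_leP => [|j]; first exact: ltW (lt_trans ltr01 M1).
    rewrite ger0_norm //; apply: le_trans (ltW M1); rewrite -l1 (bigD1 j) //= lerDl.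
    by apply: sumr_ge0.
  apply: closed_and; first by apply: closed_forall => j; exact: closed_continuous_ge.
  by apply: closed_continuous_eq; apply: cont_sum.
pose e j : 'rV[R]_q := delta_mx 0 j.
have Ae j : A (e j).
  split=> [k|]; first by rewrite mxE; case: (_ && _).
  rewrite (bigD1 j) //= mxE !eqxx big1 ?addr0 // => k kj.
  by rewrite mxE eqxx (negbTE kj).
have A0 : A !=set0 by exists (e (Ordinal q0)).
pose p (l : 'rV[R]_q) i := \sum_j l 0 j * a j i.
pose N l := \sum_i p l i ^+ 2.
have cN : continuous N.
  apply: cont_sum => i; have cp : continuous (p ^~ i).
    by apply: cont_sum => j; apply: contM => //; exact: cst_continuous.
  exact: contM.
have [l /set_mem[l0 l1] lmin] := EVT_min_rV A0 cA (continuous_subspaceT cN).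
have [Nl0|Nl0] := eqVneq (N l) 0.
  left; exists (fun j => l 0 j); split=> // i.
  have := Nl0; rewrite /N => /eqP; rewrite psumr_eq0 => [|k _]; last exact: sqr_ge0.
  by move=> /allP /(_ i); rewrite mem_index_enum sqrf_eq0 => /(_ isT) /eqP.
right; exists (p l), (N l); split.
  by rewrite lt_neqAle eq_sym Nl0 sumr_ge0 // => i _; exact: sqr_ge0.
move=> j; rewrite leNgt; apply/negP => lt.
pose D := N l - \sum_i a j i * p l i; have D0 : 0 < D by rewrite subr_gt0.
pose Q := \sum_i (a j i - p l i) ^+ 2.
have Q0 : 0 <= Q by apply: sumr_ge0 => i _; exact: sqr_ge0.
(* The squared norm becomes [N l - 2 * t * D + t ^+ 2 * Q]; this [t] keeps [t * Q] below [D]. *)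
pose t := Num.min 1 (D / (Q + 1)).
have Q1 : 0 < Q + 1 by rewrite ltr_wpDl.
have t0 : 0 < t by rewrite lt_min ltr01 /= divr_gt0.
have t1 : t <= 1 by rewrite ge_min lexx.
have tQ : t * (Q + 1) <= D by rewrite -ler_pdivlMr // ge_min lexx orbT.
have Al : A ((1 - t) *: l + t *: e j).
  have [e0 e1] := Ae j; split=> [k|].
    by rewrite !mxE addr_ge0 // mulr_ge0 ?subr_ge0 ?(ltW t0) // ?ler0n.
  under eq_bigr do rewrite mxE [X in X + _]mxE [X in _ + X]mxE.
  by rewrite big_split /= -!mulr_sumr l1 e1 !mulr1 subrK.
have := lmin _ (mem_set Al).
have pE i : p ((1 - t) *: l + t *: e j) i = p l i + t * (a j i - p l i).
  have -> : a j i = \sum_k (e j) 0 k * a k i.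
    rewrite (bigD1 j) //= mxE !eqxx mul1r big1 ?addr0 // => k kj.
    by rewrite mxE eqxx (negbTE kj) mul0r.
  rewrite -sumrB mulr_sumr -big_split /=; apply: eq_bigr => k _.
  by rewrite !mxE; ring.
have -> : N ((1 - t) *: l + t *: e j) = N l - 2 * t * D + t ^+ 2 * Q.
  transitivity (\sum_i (p l i ^+ 2 - 2 * t * (p l i ^+ 2 - a j i * p l i) +
    t ^+ 2 * (a j i - p l i) ^+ 2)).
    by apply: eq_bigr => i _; rewrite pE; ring.
  by rewrite big_split /= sumrB -!mulr_sumr sumrB.
apply/negP; rewrite -ltNge.
have -> : N l - 2 * t * D + t ^+ 2 * Q = N l - (t * (2 * D) - t * (t * Q)) by ring.
rewrite gtrBl subr_gt0 ltr_pM2l //; apply: (@lt_le_trans _ _ (t * (Q + 1))); first by rewrite ltr_pM2l // ltrDl.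
by apply: le_trans tQ _; lra.
Qed.

Lemma gordan (m : nat) (J : finType) (S : {set J}) (a : J -> 'I_m -> R) :
  (exists l : J -> R, [/\ forall j, 0 <= l j, \sum_j l j = 1,
     forall j, l j != 0 -> j \in S & forall i, \sum_j l j * a j i = 0]) \/
  (exists (w : 'I_m -> R) (c : R), 0 < c /\ forall j, j \in S -> c <= \sum_i a j i * w i).
Proof.
have [[l [l0 l1 la]]|[w [c [c0 h]]]] := gordan_ord (fun (j : 'I_#|S|) => a (enum_val j)).
  left; pose l' j := \sum_(k < #|S| | enum_val k == j) l k.
  have sum (F : J -> R) : \sum_j l' j * F j = \sum_k l k * F (enum_val k).
    rewrite [RHS](partition_big (fun k => enum_val k) xpredT) //=.
    apply: eq_bigr => j _; rewrite mulr_suml; apply: eq_bigr => k /eqP <- //.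
  exists l'; split.
  - by move=> j; apply: sumr_ge0.
  - have := sum (fun=> 1); under eq_bigr do rewrite mulr1; move=> ->.
    by under eq_bigr do rewrite mulr1.
  - move=> j; apply: contraR => jS; rewrite /l' big_pred0 // => k.
    by apply/eqP => kj; move: jS; rewrite -kj enum_valP.
  by move=> i; rewrite sum.
right; exists w, c; split=> // j jS.
by have := h (enum_rank_in jS j); rewrite enum_rankK_in.
Qed.

End Gordan.

Section StrictDescent.
Context {R : realType} {m : nat} {J : finType}.
Implicit Types (x y z : 'rV[R]_m).
Local Notation partial i g := ('D_(delta_mx 0 i) g).
Local Notation CD := continuously_differentiable.

Definition crit_point (C : J -> set 'rV[R]_m) (g : J -> 'rV[R]_m -> R) x : Prop :=
  exists l : J -> R, [/\ forall j, 0 <= l j, \sum_j l j = 1,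
    forall j, l j != 0 -> C j x & forall i, \sum_j l j * partial i (g j) x = 0].

(** Gordan's alternative gives a direction [w] along which all active pieces have slope at least
    [c]. For a short time only they are visited, so the curve has moved against [w]; its
    displacement is nonzero and [curve_descent] is strict. *)
Lemma curve_strict_descent (C : J -> set 'rV[R]_m) (g : J -> 'rV[R]_m -> R)
  (f : 'rV[R]_m -> R) (M La B : R) (gam : R -> 'rV[R]_m) (Lam : J -> R -> R) :
  (forall j, CD 2 (g j)) -> continuous f -> (forall j x, C j x -> f x = g j x) ->
  (forall j, closed (C j)) -> limit_curve C g M La B gam Lam ->
  ~ crit_point C g (gam 0) -> exists2 T, 0 < T & f (gam T) < f (gam 0).
Proof.
move=> g2 cf fg clC hc ncrit.
have La0 : 0 <= La.
  by have := curve_lipschitz hc 0 1; rewrite subr0 normr1 mulr1; apply: le_trans.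
pose S := [set j | `[< C j (gam 0) >]]%SET.
have [[l [l0 l1 lS lg]]|[w [c [c0 hw]]]] := gordan S (fun j i => partial i (g j) (gam 0)).
  exfalso; apply: ncrit; exists l; split=> // j /lS.
  by rewrite finset.in_set => /asboolP.
have /choice[r hr] : forall j, exists r, 0 < r /\ (j \notin S -> forall y,
    `|gam 0 - y| < r -> ~ C j y).
  move=> j; case: (boolP (j \in S)) => jS; first by exists 1.
  have nb : nbhs (gam 0) (~` C j).
    apply: open_nbhs_nbhs; split; first by rewrite openC.
    by move=> Cj; move: jS; rewrite finset.in_set => /asboolP; apply.
  by move: nb => /nbhs_normP[r /= r0 h]; exists r; split=> // _ y yr; apply: h.
have [|r0 r00 hr0] := @finite_lower_bound R _ r; first by move=> j; case: (hr j).
pose W := \sum_i `|w i|; have W0 : 0 <= W by apply: sumr_ge0.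
pose D := `|B| * W + 1; have D0 : 0 < D by rewrite ltr_wpDl // mulr_ge0.
(* The first bound keeps the curve away from the inactive pieces, the second makes the quadratic
   error smaller than the drift [c * T]. *)
pose T := Num.min (r0 / (La + 1)) (c / D) / 2.
have La1 : 0 < La + 1 by rewrite ltr_wpDl.
have T0 : 0 < T by rewrite divr_gt0 // lt_min !divr_gt0.
have Tm : T < Num.min (r0 / (La + 1)) (c / D).
  by rewrite /T gtr_pMr ?invf_lt1 ?ltr1n // lt_min !divr_gt0.
have Tr : La * T < r0.
  move: Tm; rewrite lt_min => /andP[+ _]; rewrite ltr_pdivlMr // => h.
  by apply: le_lt_trans h; rewrite mulrC ler_wpM2l ?lerDl // ltW.
have TD : T * D < c by move: Tm; rewrite lt_min => /andP[_]; rewrite ltr_pdivlMr.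
exists T => //.
pose dL j := Lam j T - Lam j 0.
have dL0 j : 0 <= dL j by rewrite subr_ge0; apply: curve_mono hc _ _ _ (ltW T0).
have dLS j : j \notin S -> dL j = 0.
  move=> jS; apply/eqP; rewrite eq_le dL0 andbT leNgt subr_gt0; apply/negP => lt.
  have [u /andP[u0 uT] Cu] := curve_visit hc (lexx 0) (ltW T0) lt.
  have [_ /(_ jS) h] := hr j; apply: h Cu.
  apply: (@lt_le_trans _ _ r0); last exact: hr0.
  apply: le_lt_trans Tr; rewrite distrC; apply: le_trans (curve_lipschitz hc 0 u) _.
  by rewrite subr0 ger0_norm // ler_wpM2l.
have tot : \sum_j dL j = T by rewrite (curve_total hc (lexx 0) (ltW T0)) subr0.
have neg : \sum_i w i * (gam T 0 i - gam 0 0 i) < 0.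
  have e1 i : w i * (gam T 0 i - gam 0 0 i) <= `|w i| * (`|B| * T ^+ 2) -
      \sum_j dL j * (partial i (g j) (gam 0) * w i).
    have := curve_inclusion hc i (lexx 0) (ltW T0); rewrite subr0.
    set A := \sum_j _ => hA.
    have -> : \sum_j dL j * (partial i (g j) (gam 0) * w i) = A * w i.
      by rewrite mulr_suml; apply: eq_bigr => j _; rewrite mulrA.
    rewrite lerBrDr [A * w i]mulrC -mulrDr; apply: le_trans (ler_norm _) _.
    rewrite normrM; apply: ler_wpM2l => //; apply: le_trans hA _.
    by apply: ler_wpM2r; [exact: sqr_ge0|exact: ler_norm].
  apply: (@le_lt_trans _ _ (W * (`|B| * T ^+ 2) - c * T)).
    apply: le_trans (ler_sum _ (fun i _ => e1 i)) _.
    rewrite sumrB -mulr_suml lerD2l lerN2 exchange_big /= -tot mulr_sumr.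
    apply: ler_sum => j _; rewrite -mulr_sumr.
    case: (boolP (j \in S)) => jS; last by rewrite dLS // !mul0r mulr0.
    by rewrite mulrC; apply: ler_wpM2l => //; exact: hw.
  rewrite subr_lt0.
  have -> : W * (`|B| * T ^+ 2) = (T * (`|B| * W)) * T by ring.
  rewrite ltr_pM2r //; apply: le_lt_trans TD; apply: ler_wpM2l; first exact: ltW.
  by rewrite /D lerDl.
have := curve_descent g2 cf fg hc T0.
rewrite -subr_lt0 => h; apply: le_lt_trans h _.
rewrite mulNr oppr_lt0 divr_gt0 // lt_neqAle eq_sym sumr_ge0 ?andbT; last by move=> i _; exact: sqr_ge0.
apply/negP; rewrite psumr_eq0 => [/allP h|i _]; last exact: sqr_ge0.
move: neg; rewrite big1 ?ltxx // => i _.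
by have := h i; rewrite mem_index_enum sqrf_eq0 => /(_ isT) /eqP ->; rewrite mulr0.
Qed.

End StrictDescent.

Lemma ultra_color (U : set_system nat) (UU : UltraFilter U) (J : finType)
  (c : nat -> J) : exists j, U [set k | c k = j].
Proof.
apply: contrapT => H.
have h j : U (~` [set k | c k = j]).
  by have [h|//] := in_ultra_setVsetC [set k | c k = j] UU; exfalso; apply: H; exists j.
have : U (fun k => forall j, (~` [set k | c k = j]) k) by apply: filter_forall.
by move=> /filter_ex[k /(_ (c k))]; apply.
Qed.

(** * Convergence of bounded iterates *)

Section Clock.
Context {R : realType}.
Variable a : nat -> R.
Hypothesis a0 : forall k, 0 < a k.
Hypothesis adiv : forall k t, exists l, t <= \sum_(k <= i < l) a i.

Definition clock (k l : nat) : R := \sum_(k <= i < l) a i.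

Lemma clock_ge0 k l : 0 <= clock k l.
Proof. by apply: sumr_ge0 => i _; exact: ltW. Qed.

Lemma clockD k l n : (k <= l)%N -> (l <= n)%N -> clock k n = clock k l + clock l n.
Proof. by move=> kl ln; rewrite /clock (big_cat_nat kl ln). Qed.

Lemma clock_id k : clock k k = 0. Proof. by rewrite /clock big_geq. Qed.

Lemma clockS k l : (k <= l)%N -> clock k l.+1 = clock k l + a l.
Proof. by move=> kl; rewrite /clock big_nat_recr. Qed.

Lemma clock_le k l n : (k <= l)%N -> (l <= n)%N -> clock k l <= clock k n.
Proof. by move=> kl ln; rewrite (clockD kl ln) lerDl clock_ge0. Qed.

Lemma stop_ex k t : exists l, (k <= l)%N && (t <= clock k l).
Proof.
have [l hl] := adiv k t; exists (maxn k l); rewrite leq_maxl /=.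
apply: le_trans hl _; case: (leqP k l) => [//|lk].
by rewrite big_geq ?clock_ge0 // ltnW.
Qed.

Definition stop k t : nat := ex_minn (stop_ex k t).

Lemma stopP k t : [/\ (k <= stop k t)%N, t <= clock k (stop k t) &
  forall l, (k <= l)%N -> t <= clock k l -> (stop k t <= l)%N].
Proof.
rewrite /stop; case: ex_minnP => l /andP[kl tl] lmin; split=> // n kn tn.
by apply: lmin; rewrite kn.
Qed.

Lemma stop_ge k t : (k <= stop k t)%N. Proof. by case: (stopP k t). Qed.

Lemma stop_mono k s t : s <= t -> (stop k s <= stop k t)%N.
Proof.
move=> st; have [ks _ smin] := stopP k s; have [kt tt _] := stopP k t.
by apply: smin => //; exact: le_trans tt.
Qed.

(** The overshoot is at most one step. For [t <= 0] the index is [k] itself, whence the maximum;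
    allowing every real [t] avoids sign conditions on times. *)
Lemma clock_stop k t A : (forall i, (k <= i)%N -> a i <= A) ->
  `|clock k (stop k t) - Num.max t 0| <= A.
Proof.
move=> hA; have A0 : 0 <= A by apply: le_trans (ltW (a0 k)) (hA k (leqnn k)).
have [ks ts smin] := stopP k t.
have [t0|t0] := leP t 0.
  have -> : stop k t = k.
    by apply/eqP; rewrite eqn_leq ks andbT; apply: smin => //; rewrite clock_id.
  by rewrite clock_id subrr normr0.
rewrite ger0_norm ?subr_ge0 //.
move: ks ts smin; case: (stop k t) => [|l] ks ts smin.
  by move: ts; rewrite /clock big_geq // leNgt t0.
move: ks; rewrite leq_eqVlt => /orP[/eqP kl|ks].
  by move: ts; rewrite -kl clock_id leNgt t0.
rewrite ltnS in ks; rewrite clockS // lerBlDl.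
have lt : clock k l < t.
  by rewrite ltNge; apply/negP => /(smin l ks); rewrite ltnn.
by apply: lerD; [exact: ltW|exact: hA].
Qed.

Hypothesis acvg : a k @[k --> \oo] --> 0.

Lemma clock_stop_cvg t : clock k (stop k t) @[k --> \oo] --> Num.max t 0.
Proof.
apply/cvgrPdist_le => e e0; move/cvgrPdist_le : acvg => /(_ e e0)[N _ hN].
exists N => // k /= Nk; rewrite distrC; apply: clock_stop => i ki.
by have := hN i (leq_trans Nk ki); rewrite sub0r normrN gtr0_norm.
Qed.

Lemma steps_bounded : exists2 A, 0 <= A & forall k, a k <= A.
Proof.
move/cvgrPdist_le : acvg => /(_ 1 ltr01)[N _ hN].
exists (1 + \sum_(i < N) a i); first by rewrite addr_ge0 // sumr_ge0 // => i _; exact: ltW.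
move=> k; have [kN|Nk] := ltnP k N.
  rewrite (bigD1 (Ordinal kN)) //= addrCA lerDl addr_ge0 // sumr_ge0 // => i _.
  exact: ltW.
have := hN k Nk; rewrite sub0r normrN gtr0_norm // => h; apply: le_trans h _.
by rewrite lerDl sumr_ge0 // => i _; exact: ltW.
Qed.

End Clock.

Section LimitCurveExists.
Context {R : realType} {m : nat} {J : finType}.
Implicit Types (y z : 'rV[R]_m).
Local Notation partial i g := ('D_(delta_mx 0 i) g).
Local Notation CD := continuously_differentiable.
Variables (C : J -> set 'rV[R]_m) (g : J -> 'rV[R]_m -> R).
Hypothesis clC : forall j, closed (C j).
Hypothesis g2 : forall j, CD 2 (g j).
Variables (a : nat -> R) (x : nat -> 'rV[R]_m) (jj : nat -> J) (M La : R).
Hypothesis a0 : forall k, 0 < a k.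
Hypothesis acvg : a k @[k --> \oo] --> 0.
Hypothesis adiv : forall k t, exists l, t <= \sum_(k <= i < l) a i.
Hypothesis xC : forall k, C (jj k) (x k).
Hypothesis xM : forall k, `|x k| <= M.
Hypothesis step : forall k, `|x k.+1 - x k| <= La * a k.
Local Notation clock := (clock a).
Local Notation stop := (stop a0 adiv).
Definition noise (k : nat) : 'rV[R]_m :=
  x k.+1 - x k + a k *: gradient (g (jj k)) (x k).
Hypothesis noise_cvg : forall t, \sum_(k <= i < stop k t) noise i @[k --> \oo] --> (0 : 'rV[R]_m).

Let La0 : 0 <= La.
Proof. by have := le_trans (normr_ge0 _) (step 0); rewrite pmulr_lge0. Qed.

Lemma path_length k l : (k <= l)%N -> `|x l - x k| <= La * clock k l.
Proof.
move=> /subnK <-; elim: (l - k)%N => [|n IH]; first by rewrite subrr normr0 clock_id mulr0.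
rewrite addSn clockS ?leq_addl //.
have -> : x (n + k).+1 - x k = (x (n + k).+1 - x (n + k)) + (x (n + k) - x k).
  by rewrite addrA subrK.
by rewrite mulrDr [leRHS]addrC; apply: le_trans (ler_normD _ _) _; apply: lerD.
Qed.

Lemma path_length2 k l n : (k <= l)%N -> (k <= n)%N ->
  `|x l - x n| <= La * `|clock k l - clock k n|.
Proof.
move=> kl kn; wlog ln : l n kl kn / (n <= l)%N => [H|].
  have [ln|/ltnW nl] := leqP n l; first exact: H.
  by rewrite distrC [`|clock k l - _|]distrC; exact: H.
have -> : clock k l - clock k n = clock n l by rewrite (clockD a kn ln) addrC addKr.
by rewrite (ger0_norm (clock_ge0 a0 _ _)); exact: path_length.
Qed.

Variables (U : set_system nat).
Hypothesis UU : UltraFilter U.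
Hypothesis oU : \oo `<=` U.

(** Positions and occupation times converge along [U] separately for every time, and the properties
    of the curve pass to the limit. The last clause covers arbitrary indices at a convergent clock
    time, in particular hitting times. *)
Lemma limit_curve_exists : exists (B : R) (gam : R -> 'rV[R]_m) (Lam : J -> R -> R),
  limit_curve C g M La B gam Lam /\
  forall (idx : nat -> nat) u, (forall k, (k <= idx k)%N) ->
    clock k (idx k) @[k --> U] --> u -> x (idx k) @[k --> U] --> gam u.
Proof.
have PU : ProperFilter U by exact: ultra_proper.
have FU : Filter U by exact: filter_filter.
have /choice[gam hgam] : forall t, exists l : 'rV[R]_m, x (stop k t) @[k --> U] --> l.
  by move=> t; apply: (@ultra_cvg_rV R m U UU _ M).
have toU (T : topologicalType) (h : nat -> T) (l : T) :
    h k @[k --> \oo] --> l -> h k @[k --> U] --> l by move=> hl A /hl /oU.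
have cl t : clock k (stop k t) @[k --> U] --> Num.max t 0.
  by apply: toU; exact: clock_stop_cvg.
have idxP (idx : nat -> nat) u : (forall k, (k <= idx k)%N) ->
    clock k (idx k) @[k --> U] --> u -> x (idx k) @[k --> U] --> gam u.
  move=> hidx cu.
  have u0 : 0 <= u by apply: (cvgr_to_ge cu); apply: filterE => k; exact: clock_ge0.
  have d0 : x (idx k) - x (stop k u) @[k --> U] --> (0 : 'rV[R]_m).
    apply/cvgr0Pnorm_le => e e0.
    have dc : La * `|clock k (idx k) - clock k (stop k u)| @[k --> U] --> La * `|u - Num.max u 0|.
      by apply: cvgM; [exact: cvg_cst|apply: cvg_norm; exact: cvgB cu (cl u)].
    have lim0 : La * `|u - Num.max u 0| < e by rewrite max_l // subrr normr0 mulr0.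
    apply: filterS (cvgr_le _ dc _ lim0) => k; apply: le_trans.
    exact: path_length2 (hidx k) (stop_ge a0 adiv k u).
  have -> : (fun k => x (idx k)) = (fun k => x (idx k) - x (stop k u) + x (stop k u)).
    by apply/funext => k; rewrite subrK.
  by rewrite -[gam u]add0r; exact: cvgD.
(* Clock time spent on the piece [j] between the index [k] and the clock time [t] after it. *)
pose Lk j k t := \sum_(k <= i < stop k t | jj i == j) a i.
have [A A0 hA] := steps_bounded a0 acvg.
have Lk0 j k t : 0 <= Lk j k t by apply: sumr_ge0 => i _; exact: ltW.
have Lktot k t : \sum_j Lk j k t = clock k (stop k t).
  rewrite /Lk /clock (exchange_big_dep xpredT) //=; apply: eq_bigr => i _.
  by rewrite (big_pred1 (jj i)) // => j; rewrite eq_sym.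
have /choice[Lam' hLam'] : forall jt : J * R, exists l : R, Lk jt.1 k jt.2 @[k --> U] --> l.
  move=> [j t]; apply: (@ultra_cvg_R R U UU _ (Num.max t 0 + A)) => k /=.
  rewrite ger0_norm //; apply: (@le_trans _ _ (clock k (stop k t))).
    by rewrite -Lktot (bigD1 j) //= lerDl; apply: sumr_ge0.
  rewrite -lerBlDl; apply: le_trans (ler_norm _) _.
  by apply: clock_stop => i _.
pose Lam j t := Lam' (j, t); have hLam j t : Lk j k t @[k --> U] --> Lam j t := hLam' (j, t).
have /choice[LG hLG] : forall ji : J * 'I_m, exists L, 0 <= L /\ forall y z, `|y| <= M -> `|z| <= M ->
    `|partial ji.2 (g ji.1) z - partial ji.2 (g ji.1) y| <= L * `|z - y|.
  by move=> [j i]; have [L ? ?] := CD1_lipschitz M (CD_partial i (g2 j)); exists L.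
pose G := \sum_ji LG ji.
have LGle ji : LG ji <= G.
  by rewrite /G (bigD1 ji) //= lerDl; apply: sumr_ge0 => k _; case: (hLG k).
have G0 : 0 <= G by apply: sumr_ge0 => k _; case: (hLG k).
exists (G * La), gam, Lam; split=> //; split.
- move=> t; apply: (cvgr_to_le (cvg_norm (hgam t))); exact: filterE.
- move=> s t.
  have dc : La * `|clock k (stop k t) - clock k (stop k s)| @[k --> U] -->
      La * `|Num.max t 0 - Num.max s 0|.
    by apply: cvgM; [exact: cvg_cst|apply: cvg_norm; exact: cvgB (cl t) (cl s)].
  apply: (@le_trans _ _ (La * `|Num.max t 0 - Num.max s 0|)); last first.
    apply: ler_wpM2l => //; rewrite !maxEle.
    by case: (leP t 0) => t0; case: (leP s 0) => s0; rewrite !ler_norml; move: (ler_norm (t - s)) (ler_norm (- (t - s))); rewrite normrN; lra.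
  rewrite -subr_ge0; apply: (cvgr_to_ge (cvgB dc (cvg_norm (cvgB (hgam t) (hgam s))))).
  apply: filterE => k /=; rewrite subr_ge0.
  exact: path_length2 (stop_ge a0 adiv k t) (stop_ge a0 adiv k s).
- move=> j s t st; rewrite -subr_ge0; apply: (cvgr_to_ge (cvgB (hLam j t) (hLam j s))).
  apply: filterE => k; rewrite subr_ge0 /Lk.
  rewrite [leRHS](big_cat_nat (stop_ge a0 adiv k s) (stop_mono a0 adiv k st)) /= lerDl.
  by apply: sumr_ge0 => i _; exact: ltW.
- move=> s t s0 st.
  have tot u : 0 <= u -> \sum_j Lam j u = u.
    move=> u0; have h1 := @cvg_sumr R nat U FU J (index_enum J) (fun j k => Lk j k u) (Lam^~ u) (fun j => hLam j u).
    have h2 : \sum_j Lk j k u @[k --> U] --> u.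
      have := cl u; rewrite max_l //; apply: cvg_trans; apply: near_eq_cvg.
      by apply: filterE => k; rewrite Lktot.
    exact: (cvg_unique (@Rhausdorff R) h1 h2).
  by rewrite sumrB !tot // (le_trans s0).
- move=> s t i s0 st.
  pose D k := \sum_j (Lk j k t - Lk j k s) * partial i (g j) (x (stop k s)).
  (* The second term is the cost of freezing the gradients at the first point of the window: a
     Lipschitz constant [G] times the path length, summed over the window. *)
  pose V k := `|(\sum_(k <= l < stop k t) noise l - \sum_(k <= l < stop k s) noise l) 0 i| +
     G * La * (clock k (stop k t) - clock k (stop k s)) ^+ 2.
  have bound k : `|x (stop k t) 0 i - x (stop k s) 0 i + D k| <= V k.
    have ks := stop_ge a0 adiv k s; have skt := stop_mono a0 adiv k st.
    pose p := stop k s; pose q := stop k t.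
    have DE : D k = \sum_(p <= l < q) a l * partial i (g (jj l)) (x p).
      have h j : Lk j k t - Lk j k s = \sum_(p <= l < q | jj l == j) a l.
        by rewrite /Lk (big_cat_nat ks skt) /= addrAC subrr add0r.
      rewrite /D; under eq_bigr do rewrite h mulr_suml.
      rewrite (exchange_big_dep xpredT) //=; apply: eq_bigr => l _.
      by rewrite (big_pred1 (jj l)) // => j; rewrite eq_sym.
    have XE : x q 0 i - x p 0 i = (\sum_(k <= l < q) noise l - \sum_(k <= l < p) noise l) 0 i
        - \sum_(p <= l < q) a l * partial i (g (jj l)) (x l).
      have -> : \sum_(k <= l < q) noise l - \sum_(k <= l < p) noise l = \sum_(p <= l < q) noise l.
        by rewrite (big_cat_nat ks skt) /= addrAC subrr add0r.
      have -> : x q 0 i - x p 0 i = (x q - x p) 0 i by rewrite !mxE.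
      rewrite -(telescope_sumr (fun l => x l) skt) !summxE -sumrB.
      by apply: eq_bigr => l _; rewrite /noise !mxE addrK.
    rewrite XE DE -addrA; apply: le_trans (ler_normD _ _) _; rewrite lerD2l.
    rewrite addrC -sumrB; apply: le_trans (ler_norm_sum _ _ _) _.
    have -> : clock k q - clock k p = clock p q by rewrite (clockD a ks skt) addrC addKr.
    rewrite expr2 mulrA [leRHS]mulrC {1}/clock mulr_suml big_seq [leRHS]big_seq.
    apply: ler_sum => l; rewrite mem_index_iota => /andP[pl lq].
    rewrite -mulrBr normrM (gtr0_norm (a0 l)) ler_pM2l // distrC.
    have [_ h] := hLG (jj l, i); apply: le_trans (h _ _ (xM p) (xM l)) _ => /=.
    rewrite -mulrA; apply: ler_pM => //; first by case: (hLG (jj l, i)).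
    apply: le_trans (path_length pl) _; apply: ler_wpM2l => //.
    exact: (clock_le a0 pl (ltnW lq)).
  have cD : D k @[k --> U] --> \sum_j (Lam j t - Lam j s) * partial i (g j) (gam s).
    have hD j : (Lk j k t - Lk j k s) * partial i (g j) (x (stop k s)) @[k --> U] -->
        (Lam j t - Lam j s) * partial i (g j) (gam s).
      have cp : continuous (partial i (g j)) := CD_continuous (CD_partial i (g2 j)).
      exact: (cvgM (cvgB (hLam j t) (hLam j s)) (cvg_comp _ _ (hgam s) (cp (gam s)))).
    exact: (@cvg_sumr R nat U FU J (index_enum J) _ _ hD).
  have cN : (\sum_(k <= l < stop k t) noise l - \sum_(k <= l < stop k s) noise l) @[k --> U]
      --> (0 - 0 : 'rV[R]_m).
    by apply: toU; apply: cvgB; exact: noise_cvg.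
  rewrite subr0 in cN.
  have cV : V k @[k --> U] --> G * La * (t - s) ^+ 2.
    have h1 : `|(\sum_(k <= l < stop k t) noise l - \sum_(k <= l < stop k s) noise l) 0 i|
        @[k --> U] --> `|(0 : 'rV[R]_m) 0 i| by apply: cvg_norm; exact: cvg_coord cN.
    rewrite mxE normr0 in h1.
    have ct := cl t; have cs := cl s; rewrite max_l ?(le_trans s0) // in ct; rewrite max_l // in cs.
    have h2 : clock k (stop k t) - clock k (stop k s) @[k --> U] --> t - s by exact: cvgB.
    rewrite -[G * La * _]add0r expr2; apply: cvgD => //.
    by apply: cvgM; [exact: cvg_cst|exact: cvgM].
  have cL : `|x (stop k t) 0 i - x (stop k s) 0 i + D k| @[k --> U] -->
      `|gam t 0 i - gam s 0 i + \sum_j (Lam j t - Lam j s) * partial i (g j) (gam s)|.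
    apply: cvg_norm; apply: cvgD => //; apply: cvgB; exact: cvg_coord.
  rewrite -subr_ge0; apply: (cvgr_to_ge (cvgB cV cL)); apply: filterE => k.
  by rewrite subr_ge0; exact: bound.
- move=> j s t s0 st lt.
  have ev : \forall k \near U, Lk j k s < Lk j k t.
    have h : Lk j k t - Lk j k s @[k --> U] --> Lam j t - Lam j s by exact: cvgB.
    have : \forall k \near U, 0 < Lk j k t - Lk j k s by apply: (cvgr_gt _ h); rewrite subr_gt0.
    by apply: filterS => k; rewrite subr_gt0.
  (* An index of the window on the piece [j]; the default [stop k s] occurs only when there is none,
     which happens for no [k] in some set of [U]. *)
  have /choice[idx hidx] : forall k, exists l, (stop k s <= l)%N /\
      (Lk j k s < Lk j k t -> (l < stop k t)%N /\ jj l = j).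
    move=> k; case: (pselect (exists2 l, (stop k s <= l < stop k t)%N & jj l = j)).
      by move=> [l /andP[h1 h2] h3]; exists l.
    move=> no; exists (stop k s); split=> // ltk; exfalso.
    move: ltk; rewrite /Lk (big_cat_nat (stop_ge a0 adiv k s) (stop_mono a0 adiv k st)) /=.
    rewrite [X in _ + X]big_nat_cond [X in _ + X]big_pred0 ?addr0 ?ltxx // => l.
    by apply/negP => /andP[h1 /eqP h2]; apply: no; exists l.
  have kidx k : (k <= idx k)%N by case: (hidx k) => h _; apply: leq_trans (stop_ge a0 adiv k s) h.
  have lower k : s <= clock k (idx k).
    have [_ h _] := stopP a0 adiv k s; apply: le_trans h _; apply: (clock_le a0).
      exact: stop_ge.
    by case: (hidx k).
  have upper : \forall k \near U, clock k (idx k) <= t.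
    apply: filterS ev => k /(proj2 (hidx k))[lt1 _].
    rewrite leNgt; apply/negP => h; have [_ _ hmin] := stopP a0 adiv k t.
    by have := hmin (idx k) (kidx k) (ltW h); rewrite leqNgt lt1.
  (* The bound by [t] holds only along [U], whereas compactness is stated for sequences bounded
     everywhere; hence the truncation. *)
  have [c hc] : exists c : R, (Num.min (clock k (idx k)) t) @[k --> U] --> c.
    apply: (@ultra_cvg_R R U UU _ t) => k; rewrite ger0_norm ?ge_min ?lexx ?orbT //.
    by rewrite le_min (le_trans s0 (lower k)) (le_trans s0 st).
  have hc' : clock k (idx k) @[k --> U] --> c.
    apply: cvg_trans hc; apply: near_eq_cvg; apply: filterS upper => k h.
    by rewrite min_l.
  exists c.
    by rewrite (cvgr_to_ge hc') ?(cvgr_to_le hc') //; exact: filterE.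
  have nC : \forall k \near U, C j (x (idx k)).
    by apply: filterS ev => k /(proj2 (hidx k))[_ <-].
  exact: (@closed_cvg nat 'rV[R]_m U PU (fun k => x (idx k)) (C j) (@clC j) nC (gam c) (idxP idx c kidx hc')).
move=> t; have [j hj] := ultra_color UU (fun k => jj (stop k t)).
exists j; have nC : \forall k \near U, C j (x (stop k t)).
  by apply: filterS hj => k <-.
exact: (@closed_cvg nat 'rV[R]_m U PU (fun k => x (stop k t)) (C j) (@clC j) nC (gam t) (hgam t)).
Qed.

End LimitCurveExists.

Section Convergence.
Context {R : realType} {m' : nat} {J : finType}.
Local Notation m := m'.+1.
Implicit Types (y z : 'rV[R]_m).
Local Notation partial i g := ('D_(delta_mx 0 i) g).
Local Notation CD := continuously_differentiable.
Variables (C : J -> set 'rV[R]_m) (g : J -> 'rV[R]_m -> R) (f : 'rV[R]_m -> R).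
Hypothesis clC : forall j, closed (C j).
Hypothesis g2 : forall j, CD 2 (g j).
Hypothesis gm : forall j, CD m (g j).
Hypothesis cf : continuous f.
Hypothesis fg : forall j y, C j y -> f y = g j y.
Variables (a : nat -> R) (x : nat -> 'rV[R]_m) (jj : nat -> J) (M La : R).
Hypothesis M0 : 0 < M.
Hypothesis a0 : forall k, 0 < a k.
Hypothesis acvg : a k @[k --> \oo] --> 0.
Hypothesis adiv : forall k t, exists l, t <= \sum_(k <= i < l) a i.
Hypothesis xC : forall k, C (jj k) (x k).
Hypothesis xM : forall k, `|x k| <= M.
Hypothesis step : forall k, `|x k.+1 - x k| <= La * a k.
Hypothesis noise_cvg : forall t,
  \sum_(k <= i < stop a0 adiv k t) noise g a x jj i @[k --> \oo] --> (0 : 'rV[R]_m).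
Local Notation clock := (clock a).
Local Notation stop := (stop a0 adiv).

Let curve (U : set_system nat) (UU : UltraFilter U) (oU : \oo `<=` U) :=
  limit_curve_exists clC g2 acvg xC xM step noise_cvg UU oU.

Let cvg_f (U : set_system nat) (v : nat -> 'rV[R]_m) y :
  v k @[k --> U] --> y -> f (v k) @[k --> U] --> f y.
Proof. by move=> hv; exact: (cvg_comp _ _ hv (@cf y)). Qed.

(** Rescale at the last passage below [r] before each crossing. The limit curve starts at level [r],
    at a noncritical point, so it is strictly below [r] at some [T]. The crossing must be over by
    then, so the curve also reaches level [r'] at some time, which contradicts descent. *)
Lemma no_upcrossing (r r' : R) : ~ crit_value g M r -> r < r' ->
  (forall N, exists2 k, (N <= k)%N & f (x k) <= r) ->
  (forall N, exists2 k, (N <= k)%N & r' <= f (x k)) -> False.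
Proof.
move=> ncr rr' low high.
pose P k := f (x k) <= r /\ exists l, [/\ (k < l)%N, r' <= f (x l) &
  forall i, (k < i <= l)%N -> r < f (x i)].
have [N|U [UU oU UP]] := @ultra_infinite P.
  have [k0 Nk0 fk0] := low N.
  have [l0 kl0 fl0] := high k0.
  have ex : exists k, (k <= l0)%N && (f (x k) <= r).
    by exists k0; rewrite kl0.
  have ub k : (k <= l0)%N && (f (x k) <= r) -> (k <= l0)%N by case/andP.
  case: (ex_maxnP ex ub) => k /andP[kl fk] kmax; exists k.
    by apply: leq_trans Nk0 _; apply: kmax; rewrite kl0.
  split=> //; exists l0; split=> //.
    rewrite ltn_neqAle kl andbT; apply/eqP => kl'.
    by move: fk; rewrite kl' leNgt (lt_le_trans rr' fl0).
  move=> i /andP[ki il]; rewrite ltNge; apply/negP => fi.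
  by have := kmax i; rewrite il fi leqNgt ki => /(_ isT).
have PU : ProperFilter U by exact: ultra_proper.
have FU : Filter U by exact: filter_filter.
have [B [gam [Lam [hc hidx]]]] := curve UU oU.
have c0 : x k @[k --> U] --> gam 0.
  apply: (hidx id 0) => //; apply: cvg_near_cst; apply: filterE => k.
  by rewrite clock_id.
(* The values at [k] and [k.+1] lie on either side of [r], and both points tend to [gam 0]: this
   pins [f (gam 0)] to [r]. *)
have c1 : x k.+1 @[k --> U] --> gam 0.
  apply: (hidx S 0) => [k|]; first exact: leqnSn.
  have -> : (fun k => clock k k.+1) = a.
    by apply/funext => k; rewrite clockS // clock_id add0r.
  by move=> A /acvg; exact: oU.
have f0 : f (gam 0) = r.
  apply/eqP; rewrite eq_le; apply/andP; split.
    apply: (cvgr_to_le (cvg_f c0)); apply: filterS UP => k [] //.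
  apply: (cvgr_to_ge (cvg_f c1)); apply: filterS UP => k [_ [l [kl _ h]]].
  by apply: ltW; apply: h; rewrite ltnSn.
have nc : ~ crit_point C g (gam 0).
  move=> [l [l0 l1 lC lg]]; apply: ncr; exists (gam 0), l; split=> //.
    exact: (curve_bounded hc).
  by move=> j /lC Cj; rewrite -f0 (fg Cj).
have [T T0 fT] := curve_strict_descent g2 cf fg clC hc nc.
have /choice[l hl] : forall k, exists l, (k <= l)%N /\ (P k -> [/\ (k < l)%N, r' <= f (x l) &
  forall i, (k < i <= l)%N -> r < f (x i)]).
  move=> k; case: (pselect (P k)) => [[_ [l [h1 h2 h3]]]|nP]; last by exists k.
  by exists l; split=> //; exact: ltnW.
have sT : x (stop k T) @[k --> U] --> gam T.
  apply: hidx => [k|]; first exact: stop_ge.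
  have h := @clock_stop_cvg R a a0 adiv acvg T.
  by rewrite max_l ?(ltW T0) // in h; move=> A /h; exact: oU.
have evT : \forall k \near U, f (x (stop k T)) < r.
  by apply: (cvgr_lt _ (cvg_f sT)); rewrite -f0.
(* Otherwise [stop k T] would fall in the stretch up to [l k], on which [f] stays above [r]. *)
have upper : \forall k \near U, clock k (l k) <= T.
  apply: filterS (filterI evT UP) => k [h1 Pk]; have [_ /(_ Pk)[kl _ h]] := hl k.
  have [ks Ts smin] := stopP a0 adiv k T.
  rewrite leNgt; apply/negP => Tl.
  have sl : (stop k T <= l k)%N by apply: smin; [exact: ltnW|exact: ltW].
  have ks' : (k < stop k T)%N.
    rewrite ltn_neqAle ks andbT; apply/eqP => E; move: Ts; rewrite -E clock_id.
    by rewrite leNgt T0.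
  by have := h (stop k T); rewrite ks' sl => /(_ isT); rewrite ltNge (ltW h1).
have [c hcc] : exists c : R, (Num.min (clock k (l k)) T) @[k --> U] --> c.
  apply: (@ultra_cvg_R R U UU _ T) => k; rewrite ger0_norm ?ge_min ?lexx ?orbT //.
  by rewrite le_min (clock_ge0 a0) ltW.
have hcl : clock k (l k) @[k --> U] --> c.
  apply: cvg_trans hcc; apply: near_eq_cvg; apply: filterS upper => k h.
  by rewrite min_l.
have cl : x (l k) @[k --> U] --> gam c by apply: hidx => // k; case: (hl k).
have fc : r' <= f (gam c).
  apply: (cvgr_to_ge (cvg_f cl)); apply: filterS UP => k Pk.
  by have [_ /(_ Pk)[]] := hl k.
have c0' : 0 <= c by apply: (cvgr_to_ge hcl); apply: filterE => k; exact: clock_ge0.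
move: c0'; rewrite le_eqVlt => /orP[/eqP c0'|c0'].
  by move: fc; rewrite -c0' f0 leNgt rr'.
have := curve_descent g2 cf fg hc c0'.
rewrite f0 => h; have : f (gam c) - r <= 0.
  apply: le_trans h _; rewrite mulNr oppr_le0 divr_ge0 ?(ltW c0') //.
  by apply: sumr_ge0 => i _; exact: sqr_ge0.
by rewrite subr_le0 leNgt (lt_le_trans rr' fc).
Qed.

Lemma f_iterates_cvg : exists l : R, f (x k) @[k --> \oo] --> l.
Proof.
have [U [UU oU _]] := @ultra_infinite setT (fun N => ex_intro2 _ _ N (leqnn N) Logic.I).
have [B B0 fB] := continuous_bounded M cf.
have fxB k : `|f (x k)| <= B by apply: fB.
have [l hl] := @ultra_cvg_R R U UU (fun k => f (x k)) B fxB.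
have freq (V : set_system nat) (VV : UltraFilter V) (oV : \oo `<=` V) (q : R) :
    f (x k) @[k --> V] --> q ->
    (forall p, q < p -> forall N, exists2 k, (N <= k)%N & f (x k) <= p) /\
    (forall p, p < q -> forall N, exists2 k, (N <= k)%N & p <= f (x k)).
  move=> {}hl; have PV : ProperFilter V by exact: ultra_proper.
  have UN N : V [set k | (N <= k)%N] by apply: oV; exists N.
  split=> p lp N.
    by have [k [h1 h2]] := filter_ex (filterI (UN N) (cvgr_le _ hl _ lp)); exists k.
  by have [k [h1 h2]] := filter_ex (filterI (UN N) (cvgr_ge _ hl _ lp)); exists k.
have two (l1 l2 : R) : l1 < l2 ->
    (forall p, l1 < p -> forall N, exists2 k, (N <= k)%N & f (x k) <= p) ->
    (forall p, p < l2 -> forall N, exists2 k, (N <= k)%N & p <= f (x k)) -> False.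
  (* The noncritical level [r] is taken in the second quarter of the gap, so that [r + d] stays
     below [l2]. *)
  move=> ll low high; pose d := (l2 - l1) / 4.
  have d0 : 0 < d by rewrite divr_gt0 // subr_gt0.
  have ab : l1 + d < l1 + 2 * d by lra.
  have [r /andP[r1 r2] ncr] := sard gm M0 ab.
  have d4 : l2 = l1 + 4 * d by rewrite /d; lra.
  apply: (@no_upcrossing r (r + d) ncr); first by lra.
    by apply: low; lra.
  by apply: high; lra.
exists l; apply/cvgrPdist_le => e e0; apply: contrapT => H.
have inf N : exists2 k, (N <= k)%N & e < `|l - f (x k)|.
  apply: contrapT => H2; apply: H; exists N => // k /= Nk.
  by rewrite leNgt; apply/negP => h; apply: H2; exists k.
have [U' [UU' oU' UA]] := ultra_infinite inf.
have PU' : ProperFilter U' by exact: ultra_proper.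
have [l' hl'] := @ultra_cvg_R R U' UU' (fun k => f (x k)) B fxB.
have [low high] := freq U UU oU l hl.
have [low' high'] := freq U' UU' oU' l' hl'.
have : e <= `|l - l'|.
  have h : `|l - f (x k)| @[k --> U'] --> `|l - l'|.
    by apply: cvg_norm; apply: cvgB => //; exact: cvg_cst.
  by apply: (cvgr_to_ge h); apply: filterS UA => k /ltW.
have [ll|ll|->] := ltgtP l l'.
- by move=> _; exact: two ll low high'.
- by move=> _; exact: two ll low' high.
by rewrite subrr normr0 leNgt e0.
Qed.

(** From a noncritical [y] the limit curve would lower [f] at some [T], but [f (gam 0)] and
    [f (gam T)] both equal the limit of the whole sequence of values. *)
Lemma limit_point_crit (U : set_system nat) (UU : UltraFilter U) (oU : \oo `<=` U) y :
  x k @[k --> U] --> y -> crit_point C g y.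
Proof.
move=> xy; apply: contrapT => nc.
have PU : ProperFilter U by exact: ultra_proper.
have FU : Filter U by exact: filter_filter.
have [l hl] := f_iterates_cvg.
have [B [gam [Lam [hc hidx]]]] := curve UU oU.
have c0 : x k @[k --> U] --> gam 0.
  apply: (hidx id 0) => //; apply: cvg_near_cst; apply: filterE => k.
  by rewrite clock_id.
have y0 : y = gam 0 by exact: (cvg_unique (@norm_hausdorff _ _) xy c0).
rewrite y0 in nc.
have [T T0 fT] := curve_strict_descent g2 cf fg clC hc nc.
have sT : x (stop k T) @[k --> U] --> gam T.
  apply: hidx => [k|]; first exact: stop_ge.
  have h := @clock_stop_cvg R a a0 adiv acvg T.
  by rewrite max_l ?(ltW T0) // in h; move=> A /h; exact: oU.
have l0 : f (x k) @[k --> U] --> l by move=> A /hl; exact: oU.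
have lT : f (x (stop k T)) @[k --> U] --> l.
  move=> A /hl[N _ hN]; apply: oU; exists N => // k /= Nk; apply: hN => /=.
  exact: leq_trans Nk (stop_ge a0 adiv k T).
have e0 : f (gam 0) = l by exact: (cvg_unique (@Rhausdorff R) (cvg_f c0) l0).
have eT : f (gam T) = l by exact: (cvg_unique (@Rhausdorff R) (cvg_f sT) lT).
by move: fT; rewrite e0 eT ltxx.
Qed.

End Convergence.

(** * Limit points of a bounded sequence *)

Section LimitPoints.
Context {R : realType} {m : nat}.
Implicit Types (y z : 'rV[R]_m).

Lemma enorm_le y : enorm y <= m%:R * `|y|.
Proof.
rewrite /enorm -[leRHS]ger0_norm ?mulr_ge0 // -sqrtr_sqr ler_wsqrtr // exprMn.
apply: (@le_trans _ _ (\sum_(i < m) `|y| ^+ 2)).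
  apply: ler_sum => i _; rewrite -real_normK ?num_real // ler_sqr ?nnegrE //.
  exact: ler_coord_norm.
rewrite sumr_const card_ord -[leLHS]mulr_natl ler_wpM2r ?sqr_ge0 //.
by rewrite -natrX ler_nat; case: (m) => // k; rewrite expnS leq_pmulr.
Qed.

Lemma norm_le_enorm y : `|y| <= enorm y.
Proof.
apply/rV_norm_leP; first exact: sqrtr_ge0.
move=> i; rewrite -sqrtr_sqr ler_wsqrtr // (bigD1 i) //= lerDl.
by apply: sumr_ge0 => j _; exact: sqr_ge0.
Qed.

Variable x : nat -> 'rV[R]_m.

Definition frequently_near y :=
  forall e N, 0 < e -> exists2 k, (N <= k)%N & `|x k - y| < e.

Lemma limit_pointsP y : limit_points x y <-> frequently_near y.
Proof.
split=> [[phi [hphi xy]] e N e0|H].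
  have phige k : (k <= phi k)%N.
    by elim: k => [//|k IH]; apply: leq_ltn_trans IH _; exact: hphi.
  move/cvgrPdist_lt : xy => /(_ e e0)[N' _ hN].
  exists (phi (maxn N N')); first exact: leq_trans (leq_maxl N N') (phige _).
  by rewrite distrC; apply: hN => /=; exact: leq_maxr.
have /choice[h hh] : forall Nn : nat * nat, exists k, (Nn.1 <= k)%N /\ `|x k - y| < Nn.2.+1%:R^-1.
  by move=> [N n]; have [|k ? ?] := H n.+1%:R^-1 N; [rewrite invr_gt0|exists k].
pose phi := fix F n := if n is n'.+1 then h ((F n').+1, n) else h (0%N, 0%N).
exists phi; split.
  apply: homo_ltn => [? ? ?|k]; first exact: ltn_trans.
  by have [] := hh ((phi k).+1, k.+1).
apply/cvgrPdist_lt => e e0.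
have [N _ hN] : \forall n \near \oo, (n.+1%:R^-1 : R) < e.
  by near=> n; near: n; exact: near_infty_natSinv_lt (PosNum e0).
exists N => // n /= /hN; apply: lt_trans; rewrite distrC.
by case: n => [|n] /=; [have [] := hh (0%N, 0%N)|have [] := hh ((phi n).+1, n.+1)].
Unshelve. all: by end_near. Qed.

Lemma ultra_limit_point (U : set_system nat) (UU : UltraFilter U) (oU : \oo `<=` U) y :
  x k @[k --> U] --> y -> limit_points x y.
Proof.
move=> xy; apply/limit_pointsP => e N e0.
have PU : ProperFilter U by exact: ultra_proper.
have UN : U [set k | (N <= k)%N] by apply: oU; exists N.
move/cvgrPdist_lt : xy => /(_ e e0) h.
have [k [h1 h2]] := filter_ex (filterI UN h).
by exists k => //; rewrite distrC.
Qed.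

Variable M : R.
Hypothesis xM : forall k, `|x k| <= M.

Lemma dist_to_cvg0 (S : set 'rV[R]_m) :
  (forall U : set_system nat, UltraFilter U -> \oo `<=` U ->
    forall y, x k @[k --> U] --> y -> S y) ->
  dist_to (x k) S @[k --> \oo] --> 0%E.
Proof.
move=> limS.
have near0 e : 0 < e -> exists N, forall k, (N <= k)%N -> exists2 y, S y & `|x k - y| < e.
  move=> e0; apply: contrapT => H.
  pose A := [set k | ~ exists2 y, S y & `|x k - y| < e].
  have [N|U [UU oU UA]] := @ultra_infinite A.
    apply: contrapT => H1; apply: H; exists N => k Nk; apply: contrapT => H2.
    by apply: H1; exists k.
  have PU : ProperFilter U by exact: ultra_proper.
  have [y xy] := @ultra_cvg_rV R m U UU x M xM.
  have := xy; move/cvgrPdist_lt => /(_ e e0) h.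
  have [k [h1 h2]] := filter_ex (filterI UA h); apply: h1.
  by exists y; [exact: (limS U UU oU)|rewrite distrC].
move=> A [e /= e0 hA].
(* The Euclidean norm is at most [m] times the sup norm. *)
have e1 : 0 < e / (m%:R + 1) by rewrite divr_gt0 // ltr_wpDl.
have [N hN] := near0 _ e1; exists N => // k /= /hN[y Sy xy].
have lo : (0 <= dist_to (x k) S)%E.
  by apply: le_ereal_inf_tmp => _ [z Sz <-]; rewrite lee_fin sqrtr_ge0.
have hi : (dist_to (x k) S < e%:E)%E.
  apply: (@le_lt_trans _ _ (enorm (x k - y))%:E); first by apply: ereal_inf_lbound; exists y.
  rewrite lte_fin; apply: le_lt_trans (enorm_le _) _.
  apply: (@le_lt_trans _ _ (m%:R * (e / (m%:R + 1)))).
    by apply: ler_wpM2l => //; exact: ltW.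
  by rewrite mulrA ltr_pdivrMr ?ltr_wpDl // mulrDr mulr1 mulrC ltrDl.
move: lo hi; case: (dist_to _ _) => [r| |] //; rewrite lee_fin lte_fin => r0 re.
by apply: hA => /=; rewrite sub0r normrN ger0_norm.
Qed.

Hypothesis stepcvg : x k.+1 - x k @[k --> \oo] --> (0 : 'rV[R]_m).

(** Two separated parts of the set of limit points would lie at a positive distance [d]. The
    sequence leaves the [d / 3] neighbourhood of the first part infinitely often; since its steps
    vanish, a limit of such exits fits neither part. *)
Lemma connected_limit_points : connected (limit_points x).
Proof.
set L := limit_points x.
move=> B [y0 By0] [Oo opO BO] [F clF BF].
apply/seteqP; split=> z; first by rewrite BO => -[].
move=> Lz; apply: contrapT => nBz.
have nOz : ~ Oo z by move=> Oz; apply: nBz; rewrite BO.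
have Fsep v : L v -> F v -> Oo v.
  by move=> Lv Fv; have : (L `&` F) v by []; rewrite -BF BO => -[].
(* Otherwise pairs at vanishing distance have a common limit, a limit point that lies in the closed
   set [F] and outside the open set [Oo], against [Fsep]. *)
have [d d0 hd] : exists2 d, 0 < d &
    forall u v, L u -> F u -> L v -> ~ Oo v -> d <= `|u - v|.
  apply: contrapT => H.
  have /choice[uv huv] : forall n : nat, exists uv : 'rV[R]_m * 'rV[R]_m,
      [/\ L uv.1, F uv.1, L uv.2, ~ Oo uv.2 & `|uv.1 - uv.2| < n.+1%:R^-1].
    move=> n; apply: contrapT => H1; apply: H; exists n.+1%:R^-1; first by rewrite invr_gt0.
    move=> u v Lu Fu Lv Ov; rewrite leNgt; apply/negP => h; apply: H1.
    by exists (u, v).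
  have [U [UU oU _]] := @ultra_infinite setT (fun N => ex_intro2 _ _ N (leqnn N) Logic.I).
  have PU : ProperFilter U by exact: ultra_proper.
  have FU : Filter U by exact: filter_filter.
  have Lb v : L v -> `|v| <= M + 1.
    move=> /limit_pointsP /(_ 1 0%N ltr01)[k _ h].
    have -> : v = x k - (x k - v) by rewrite opprB addrC subrK.
    by apply: le_trans (ler_normB _ _) _; apply: lerD => //; exact: ltW.
  have [u hu] := @ultra_cvg_rV R m U UU (fun n => (uv n).1) (M + 1) (fun n => Lb _ (let: And5 h _ _ _ _ := huv n in h)).
  have hdiff : (uv n).2 - (uv n).1 @[n --> U] --> (0 : 'rV[R]_m).
    apply/cvgr0Pnorm_lt => e e0; apply: oU.
    have [N _ hN] : \forall n \near \oo, (n.+1%:R^-1 : R) < e.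
      by near=> n; near: n; exact: near_infty_natSinv_lt (PosNum e0).
    exists N => // n /= /hN; apply: lt_trans; rewrite distrC.
    by case: (huv n).
  have hv : (uv n).2 @[n --> U] --> u.
    have h : (uv n).2 - (uv n).1 + (uv n).1 @[n --> U] --> 0 + u by exact: cvgD.
    rewrite add0r in h; have E : (fun n => (uv n).2) = (fun n => (uv n).2 - (uv n).1 + (uv n).1).
      by apply/funext => n; rewrite subrK.
    by rewrite E.
  have Fu : F u.
    apply: (@closed_cvg nat 'rV[R]_m U PU (fun n => (uv n).1) F clF _ u hu).
    by apply: filterE => n; case: (huv n).
  have Ou : (~` Oo) u.
    apply: (@closed_cvg nat 'rV[R]_m U PU (fun n => (uv n).2) (~` Oo) _ _ u hv).
      exact: open_closedC.
    by apply: filterE => n; case: (huv n).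
  apply: Ou; apply: Fsep => //; apply/limit_pointsP => e N e0.
  have e2 : 0 < e / 2 by rewrite divr_gt0.
  move/cvgrPdist_lt : hu => /(_ _ e2) /filter_ex[n h1].
  have [/limit_pointsP/(_ _ N e2)[k Nk h2] _ _ _ _] := huv n.
  exists k => //; have -> : x k - u = (x k - (uv n).1) - (u - (uv n).1) by rewrite opprB addrA subrK.
  by apply: le_lt_trans (ler_normB _ _) _; rewrite [ltRHS]splitr ltrD.
have d3 : 0 < d / 3 by rewrite divr_gt0.
pose Q k := exists u, [/\ L u, F u & `|x k - u| < d / 3].
have nQ k v : L v -> ~ Oo v -> `|x k - v| < d / 3 -> ~ Q k.
  move=> Lv Ov h [u [Lu Fu h2]]; have := hd u v Lu Fu Lv Ov.
  have -> : u - v = (x k - v) - (x k - u) by rewrite opprB [RHS]addrC addrA subrK.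
  rewrite leNgt => /negP; apply; apply: le_lt_trans (ler_normB _ _) _.
  by move: h h2; clear -d0; set p := `|_|; set q := `|_|; lra.
have Qio N : exists2 k, (N <= k)%N & Q k.
  move: (By0); rewrite BF => -[Ly Fy]; have [k Nk h] := (limit_pointsP y0).1 Ly _ N d3.
  by exists k => //; exists y0.
have nQio N : exists2 k, (N <= k)%N & ~ Q k.
  have [k Nk h] := (limit_pointsP z).1 Lz _ N d3.
  by exists k => //; exact: (nQ k z).
(* Exits recur: [Q] and its negation both hold infinitely often, and [Q] persists until an exit. *)
have [N|U [UU oU UA]] := @ultra_infinite [set k | Q k /\ ~ Q k.+1].
  have [k0 Nk0 Qk0] := Qio N; have [k1 Nk1 Qk1] := nQio k0.
  apply: contrapT => H; apply: Qk1; rewrite -(subnK Nk1); elim: (k1 - k0)%N => [//|i IH].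
  apply: contrapT => H2; apply: H; exists (i + k0)%N => //.
  by apply: leq_trans Nk0 _; exact: leq_addl.
have PU : ProperFilter U by exact: ultra_proper.
have FU : Filter U by exact: filter_filter.
have [l xl] := @ultra_cvg_rV R m U UU x M xM.
have Ll : L l by exact: ultra_limit_point xl.
have sU : x k.+1 - x k @[k --> U] --> (0 : 'rV[R]_m) by move=> A /stepcvg; exact: oU.
have xl1 : x k.+1 @[k --> U] --> l.
  have h : x k.+1 - x k + x k @[k --> U] --> 0 + l by exact: cvgD.
  rewrite add0r in h; have E : (fun k => x k.+1) = (fun k => x k.+1 - x k + x k).
    by apply/funext => n; rewrite subrK.
  by rewrite E.
case: (pselect (Oo l)) => Ol.
  have Fl : F l by have : (L `&` Oo) l by []; rewrite -BO BF => -[].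
  move/cvgrPdist_lt : xl1 => /(_ _ d3) h.
  have [k [[_ nq] h2]] := filter_ex (filterI UA h); apply: nq; exists l; split=> //.
  by rewrite distrC.
move/cvgrPdist_lt : xl => /(_ _ d3) h.
have [k [[q _] h2]] := filter_ex (filterI UA h).
by apply: (nQ k l) q => //; rewrite distrC.
Unshelve. all: by end_near. Qed.

End LimitPoints.

(** * Null sets and step sizes *)

Section CubeCovers.
Context {R : realType} {m' : nat}.
Local Notation m := m'.+1.
Implicit Types (A B : set 'rV[R]_m) (c x y : 'rV[R]_m).

(** Cubes are balls of the sup norm, and volumes are counted with half sides, without the factor
    [2 ^+ m]. Bounding every finite sum over distinct indices replaces a series and makes reindexing
    by a countable type easy. *)
Definition small_cover A (e : R) := exists (c : nat -> 'rV[R]_m) (r : nat -> R),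
  [/\ forall t, 0 <= r t, forall x, A x -> exists t, `|x - c t| <= r t &
      forall s, uniq s -> \sum_(t <- s) r t ^+ m <= e].

Definition cube_null A := forall e, 0 < e -> small_cover A e.

Lemma small_cover_countable (T : countType) A e (c : T -> 'rV[R]_m) (r : T -> R) :
  (forall t, 0 <= r t) -> (forall x, A x -> exists t, `|x - c t| <= r t) ->
  (forall s, uniq s -> \sum_(t <- s) r t ^+ m <= e) -> small_cover A e.
Proof.
move=> r0 cov vol.
(* Codes of no element get radius 0, hence volume 0 since the exponent is positive. *)
exists (fun n => odflt 0 (omap c (pickle_inv n))), (fun n => odflt 0 (omap r (pickle_inv n))).
split=> [n|x /cov[t h]|s us].
- by case: pickle_inv => [t|] /=; rewrite ?r0.
- by exists (pickle t); rewrite pickleK_inv.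
have /(vol _) := pmap_uniq (@pickle_invK T) us; apply: le_trans; rewrite le_eqVlt; apply/orP; left.
apply/eqP; elim: s {us} => [|n s IH] /=; first by rewrite !big_nil.
rewrite big_cons IH; case: pickle_inv => [t|] /=; first by rewrite big_cons.
by rewrite expr0n add0r.
Qed.

Lemma small_cover_sub A B e : A `<=` B -> small_cover B e -> small_cover A e.
Proof. by move=> AB [c [r [r0 h v]]]; exists c, r; split=> // x /AB/h. Qed.

Lemma small_cover_le A e e' : e <= e' -> small_cover A e -> small_cover A e'.
Proof.
by move=> ee [c [r [r0 h v]]]; exists c, r; split=> // s us; apply: le_trans (v s us) ee.
Qed.

Lemma small_cover_bigcup (T : countType) (F : T -> set 'rV[R]_m) (e : T -> R) E :
  (forall t, small_cover (F t) (e t)) ->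
  (forall s, uniq s -> \sum_(t <- s) e t <= E) ->
  small_cover [set x | exists t, F t x] E.
Proof.
move=> /choice[c /choice[r hr]] hE.
apply: (@small_cover_countable (T * nat)%type _ _ (fun p => c p.1 p.2) (fun p => r p.1 p.2)).
- by move=> [t n]; case: (hr t).
- by move=> x [t Ft]; have [_ /(_ x Ft)[n h] _] := hr t; exists (t, n).
move=> s us; apply: (@le_trans _ _ (\sum_(t <- undup (map fst s)) e t)); last first.
  by apply: hE; exact: undup_uniq.
have -> : \sum_(p <- s) r p.1 p.2 ^+ m =
    \sum_(p <- s) \sum_(t <- undup (map fst s) | t == p.1) r p.1 p.2 ^+ m.
  rewrite big_seq [RHS]big_seq; apply: eq_bigr => p ps.
  rewrite big_mkcond (bigD1_seq p.1) ?undup_uniq ?mem_undup ?map_f //= eqxx big1 ?addr0 //.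
  by move=> t /negPf ->.
rewrite (exchange_big_dep xpredT) //=; apply: ler_sum => t _.
have [_ _ vol] := hr t.
have u2 : uniq [seq p.2 | p <- s & t == p.1].
  rewrite map_inj_in_uniq ?filter_uniq // => -[a b] [a' b'].
  by rewrite !mem_filter /= => /andP[/eqP<- _] /andP[/eqP<- _] ->.
have := vol _ u2; rewrite big_map big_filter; apply: le_trans.
by rewrite le_eqVlt; apply/orP; left; apply/eqP; apply: eq_bigr => p /eqP ->.
Qed.

Lemma ler_sum_uniq_range (v : nat -> R) (s : seq nat) : (forall k, 0 <= v k) -> uniq s ->
  \sum_(k <- s) v k <= \sum_(0 <= k < (\max_(k <- s) k).+1) v k.
Proof.
move=> v0 us; rewrite [leRHS](bigID (mem s)) /= -[leLHS]addr0; apply: lerD; last exact: sumr_ge0.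
rewrite -[leRHS]big_filter le_eqVlt; apply/orP; left; apply/eqP.
apply: perm_big; apply: uniq_perm => //; first by rewrite filter_uniq // iota_uniq.
move=> k; rewrite mem_filter mem_index_iota /=; case ks : (k \in s) => //=.
by rewrite ltnS; apply/esym; exact: leq_bigmax_seq.
Qed.

Lemma geometric_uniq (s : seq nat) : uniq s -> \sum_(k <- s) (2 : R) ^- k.+1 <= 1.
Proof.
move=> us; pose N := (\max_(k <- s) k).+1.
apply: (@le_trans _ _ (\sum_(k < N) (2 : R) ^- k.+1)); last first.
  suff -> : \sum_(k < N) (2 : R) ^- k.+1 = 1 - 2 ^- N by rewrite lerBlDr lerDl invr_ge0 exprn_ge0.
  elim: N => [|N IH]; first by rewrite big_ord0 expr0 invr1 subrr.
  rewrite big_ord_recr /= IH; have -> : (2 : R) ^- N = 2 * 2 ^- N.+1.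
    by rewrite exprS invfM mulrA divff ?mul1r.
  by ring.
rewrite -(big_mkord xpredT (fun k => (2 : R) ^- k.+1)); apply: ler_sum_uniq_range us => k.
by rewrite invr_ge0 exprn_ge0.
Qed.

Lemma geometric_weights (T : countType) (s : seq T) (e : R) : 0 <= e -> uniq s ->
  \sum_(t <- s) e * 2 ^- (pickle t).+1 <= e.
Proof.
move=> e0 us; rewrite -mulr_sumr -{2}[e]mulr1; apply: ler_wpM2l => //.
have := @geometric_uniq (map pickle s).
by rewrite big_map map_inj_uniq; [apply|exact: (pcan_inj (@pickleK T))].
Qed.

Lemma cube_null_sub A B : A `<=` B -> cube_null B -> cube_null A.
Proof. by move=> AB nB e /nB; exact: small_cover_sub. Qed.

Lemma cube_null_bigcup (T : countType) (F : T -> set 'rV[R]_m) :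
  (forall t, cube_null (F t)) -> cube_null [set x | exists t, F t x].
Proof.
move=> nF e e0; apply: (@small_cover_bigcup T F (fun t => e * 2 ^- (pickle t).+1)).
  by move=> t; apply: nF; rewrite mulr_gt0 // invr_gt0 exprn_gt0.
by move=> s us; apply: geometric_weights us; exact: ltW.
Qed.

Lemma cube_nullU A B : cube_null A -> cube_null B -> cube_null (A `|` B).
Proof.
move=> nA nB; pose F (b : bool) := if b then A else B.
apply: (@cube_null_sub _ [set x | exists t, F t x]) => [x [Ax|Bx]|].
- by exists true.
- by exists false.
by apply: cube_null_bigcup => -[].
Qed.

Lemma prod_thicken (s : 'I_m -> R) (e : R) : 0 < e ->
  exists2 d, 0 < d & \prod_i (s i + d) <= \prod_i s i + e.
Proof.
move=> e0; pose p : {poly R} := \prod_i ((s i)%:P + 'X).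
have pE d : p.[d] = \prod_i (s i + d).
  by rewrite horner_prod; apply: eq_bigr => i _; rewrite !hornerE.
have := @continuous_horner R p 0; move/cvgrPdist_le => /(_ e e0)[d /= d0 hd].
exists (d / 2); first by rewrite divr_gt0.
have /hd : `|0 - d / 2| < d by rewrite sub0r normrN gtr0_norm ?divr_gt0 // ltr_pdivrMr // mulr_natr mulr2n ltrDl.
rewrite pE distrC pE => h; have {h} := le_trans (ler_norm _) h.
rewrite lerBlDl => h; apply: le_trans h _; rewrite lerD2r //.
by under eq_bigr do rewrite addr0.
Qed.

(** The number [K i] of cells of side [d] may be twice [S i / d], but counting volumes with half
    sides absorbs the factor 2. Thickening the box by [d] makes [S i / d] at least 1, even for a
    flat box. *)
Lemma small_cover_box (a b : 'rV[R]_m) (e : R) : (forall i, a 0 i <= b 0 i) -> 0 < e ->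
  small_cover (box a b) (\prod_i (b 0 i - a 0 i) + e).
Proof.
move=> ab e0; have [d d0 hd] := prod_thicken (fun i => b 0 i - a 0 i) e0.
pose S i := b 0 i - a 0 i + d.
have Sd i : d <= S i by rewrite /S lerDr subr_ge0.
pose K i := (Num.truncn (S i / d)).+1.
have Sd1 i : 1 <= S i / d by rewrite ler_pdivlMr // mul1r.
have K2 i : (K i)%:R <= 2 * (S i / d).
  rewrite /K -natr1 [2 * _]mulr_natl mulr2n; apply: lerD => //.
  by have /andP[] := truncn_itv (le_trans ler01 (Sd1 i)).
(* A common range for all directions; multi-indices beyond some [K i] get radius 0. *)
pose Km := (\max_i K i).+1.
pose F i (k : 'I_Km) : R := if (k < K i)%N then d / 2 else 0.
pose r (z : {ffun 'I_m -> 'I_Km}) : R := if [forall i, z i < K i]%N then d / 2 else 0.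
have d20 : 0 <= d / 2 by rewrite divr_ge0 // ltW.
have rE z : r z ^+ m = \prod_i F i (z i).
  rewrite /r; case: ifPn => [/forallP h|/forallPn[i hi]].
    by rewrite -[m in LHS]card_ord -prodr_const; apply: eq_bigr => i _; rewrite /F h.
  by rewrite expr0n (bigD1 i) //= /F (negPf hi) mul0r.
apply: (@small_cover_countable {ffun 'I_m -> 'I_Km} _ _
  (fun z => \row_i (a 0 i + d * (z i)%:R + d / 2)) r).
- by move=> z; rewrite /r; case: ifP.
- move=> x hx; pose k i := Num.truncn ((x 0 i - a 0 i) / d).
  have kK i : (k i < K i)%N.
    rewrite /k /K ltnS; apply: le_truncn; apply: ler_wpM2r; first by rewrite invr_ge0 ltW.
    rewrite /S -[leLHS]addr0; apply: lerD; last exact: ltW.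
    by rewrite lerD2r; case/andP: (hx i).
  have kKm i : (k i < Km)%N.
    by apply: ltn_trans (kK i) _; rewrite ltnS; apply: leq_bigmax.
  exists [ffun i => Ordinal (kKm i)]; rewrite /r.
  have -> : [forall i, [ffun i => Ordinal (kKm i)] i < K i]%N.
    by apply/forallP => i; rewrite ffunE /= kK.
  apply/rV_norm_leP => // i; rewrite !mxE ffunE /=.
  have q0 : 0 <= (x 0 i - a 0 i) / d.
    by rewrite divr_ge0 ?(ltW d0) // subr_ge0; case/andP: (hx i).
  have /andP[] := truncn_itv q0; rewrite -/(k i) ler_pdivlMr // ltr_pdivrMr // -natr1.
  by move: (k i)%:R (x 0 i) (a 0 i) => kk xx aa; rewrite ler_norml; lra.
move=> s us; apply: le_trans hd; rewrite -/(S _).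
apply: (@le_trans _ _ (\sum_z r z ^+ m)).
  rewrite [leRHS](bigID (mem s)) /= -[leLHS]addr0; apply: lerD; last first.
    by apply: sumr_ge0 => z _; rewrite exprn_ge0 // /r; case: ifP.
  rewrite -[leRHS]big_filter le_eqVlt; apply/orP; left; apply/eqP.
  apply: perm_big; apply: uniq_perm => //; first by rewrite filter_uniq // index_enum_uniq.
  by move=> z; rewrite mem_filter mem_index_enum andbT.
rewrite (eq_bigr _ (fun z _ => rE z)).
rewrite -(bigA_distr_bigA F); apply: ler_prod => i _.
apply/andP; split; first by apply: sumr_ge0 => k _; rewrite /F; case: ifP.
rewrite /F -big_mkcond sumr_const -[leLHS]mulr_natl.
apply: (@le_trans _ _ ((K i)%:R * (d / 2))).
  apply: ler_wpM2r => //; rewrite ler_nat.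
  pose h (k : 'I_Km) : 'I_(K i) := inord k.
  rewrite -[leqRHS]card_ord; rewrite -(@card_in_image _ _ h [pred k : 'I_Km | (k < K i)%N]).
    exact: max_card.
  by move=> k l; rewrite !inE => kk ll /(congr1 val); rewrite /= !inordK // => /val_inj.
apply: le_trans (ler_wpM2r d20 (K2 i)) _.
have -> : 2 * (S i / d) * (d / 2) = S i by move: (S i) => q; field; rewrite gt_eqF.
exact: lexx.
Qed.

Lemma lebesgue_cube_null A : lebesgue_null A -> cube_null A.
Proof.
move=> nA e e0; have e2 : 0 < e / 2 by rewrite divr_gt0.
have : (lebesgue_outer A < (e / 2)%:E)%E by rewrite nA lte_fin.
move=> /ereal_inf_lt[_ [a [b [ab cov ->]]] lt].
apply: (@small_cover_sub _ [set x | exists k, box (a k) (b k) x]).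
  by move=> x /cov[k _ h]; exists k.
have v0 k : 0 <= \prod_(i < m) (b k 0 i - a k 0 i).
  by apply: prodr_ge0 => i _; rewrite subr_ge0.
apply: (@small_cover_bigcup nat _
  (fun k => \prod_(i < m) (b k 0 i - a k 0 i) + (e / 2) * 2 ^- k.+1)).
  by move=> k; apply: small_cover_box => //; rewrite mulr_gt0 // invr_gt0 exprn_gt0.
move=> s us; rewrite big_split /= [leRHS]splitr; apply: lerD; last first.
  have := @geometric_weights nat s _ (ltW e2) us; apply: le_trans.
  by [].
pose v k := \prod_(i < m) (b k 0 i - a k 0 i).
apply: le_trans (@ler_sum_uniq_range v s v0 us) _.
rewrite -lee_fin -sumEFin; apply: le_trans (ltW lt).
by apply: nneseries_lim_ge => k _ _; rewrite lee_fin; exact: v0.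
Qed.

Lemma cube_lebesgue_null A : cube_null A -> lebesgue_null A.
Proof.
move=> nA; apply/eqP; rewrite eq_le; apply/andP; split; last first.
  apply: le_ereal_inf_tmp => _ [a [b [ab _ ->]]]; apply: nneseries_ge0 => k _ _.
  by rewrite lee_fin; apply: prodr_ge0 => i _; rewrite subr_ge0.
apply/lee_addgt0Pr => e e0; rewrite add0e.
(* The division turns half sides into sides of boxes. *)
have [|c [r [r0 cov vol]]] := nA (e / 2 ^+ m); first by rewrite divr_gt0 // exprn_gt0.
apply: ge_ereal_inf; exists (\sum_(0 <= k <oo) ((2 * r k) ^+ m)%:E)%E; last first.
  apply: lime_le; first by apply: is_cvg_nneseries => k _ _; rewrite lee_fin exprn_ge0 // mulr_ge0.
  apply: filterE => N; rewrite sumEFin lee_fin.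
  under eq_bigr do rewrite exprMn.
  by rewrite -mulr_sumr mulrC -ler_pdivlMr ?exprn_gt0 //; apply: vol; exact: iota_uniq.
exists (fun k => c k - const_mx (r k)), (fun k => c k + const_mx (r k)); split.
- by move=> k i; rewrite !mxE lerD2l ge0_cp // r0.
- move=> x /cov[k h]; exists k => // i; rewrite !mxE.
  have := le_trans (ler_coord_norm _ i) h; rewrite !mxE ler_norml.
  by move: (x 0 i) (c k 0 i) (r k) => ? ? ?; lra.
apply: congr_lim; apply/funext => N; apply: eq_bigr => k _; congr EFin.
rewrite -[m in LHS]card_ord -prodr_const; apply: eq_bigr => i _; rewrite !mxE.
by move: (c k 0 i) (r k) => ? ?; ring.
Qed.

End CubeCovers.

(** * Preimages of null sets under a gradient step *)

Section StepMap.
Context {R : realType} {m' : nat}.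
Local Notation m := m'.+1.
Implicit Types (x y : 'rV[R]_m) (g : 'rV[R]_m -> R).
Local Notation partial i g := ('D_(delta_mx 0 i) g).
Local Notation CD := continuously_differentiable.

(* [1 / al] is an eigenvalue of the Hessian of [g] at [x]. *)
Definition singular g (al : R) x := exists2 v : 'rV[R]_m, `|v| = 1 &
  forall i, v 0 i = al * \sum_j v 0 j * partial j (partial i g) x.

Definition grad_step g (al : R) x := x - al *: gradient g x.

Lemma ultra_nat : exists U : set_system nat, UltraFilter U /\ \oo `<=` U.
Proof.
have [U [UU oU _]] := @ultra_infinite setT (fun N => ex_intro2 _ _ N (leqnn N) Logic.I).
by exists U.
Qed.

Lemma cvg_sandwich_inv (V : normedModType R) (U : set_system nat) (FU : Filter U)
  (oU : \oo `<=` U) (h : nat -> V) l :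
  (forall n, `|h n - l| <= n.+1%:R^-1) -> h n @[n --> U] --> l.
Proof.
move=> hl; apply/cvgrPdist_lt => e e0; apply: oU.
have [N _ hN] : \forall n \near \oo, (n.+1%:R^-1 : R) < e.
  by near=> n; near: n; exact: near_infty_natSinv_lt (PosNum e0).
by exists N => // n /= /hN; apply: le_lt_trans; rewrite distrC.
Unshelve. all: by end_near. Qed.

(** Only this half of the inverse function theorem is needed. If it fails, the normalised
    differences of bad pairs converge to a fixed vector of [al] times the Hessian. A single [n]
    serves as radius and constant, so that countably many cases suffice. *)
Lemma grad_step_expands g al x0 : CD 2 g -> ~ singular g al x0 ->
  exists n : nat, forall x y, `|x - x0| <= n.+1%:R^-1 -> `|y - x0| <= n.+1%:R^-1 ->
    `|x - y| <= n.+1%:R * `|grad_step g al x - grad_step g al y|.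
Proof.
move=> g2 ns; apply: contrapT => H; apply: ns.
have /choice[p hp] : forall n : nat, exists p : 'rV[R]_m * 'rV[R]_m,
    [/\ `|p.1 - x0| <= n.+1%:R^-1, `|p.2 - x0| <= n.+1%:R^-1 &
     n.+1%:R * `|grad_step g al p.1 - grad_step g al p.2| < `|p.1 - p.2|].
  move=> n; apply: contrapT => H1; apply: H; exists n => x y hx hy.
  by rewrite leNgt; apply/negP => h; apply: H1; exists (x, y).
have /choice[xi hxi] : forall ni : nat * 'I_m, exists xi : 'I_m -> 'rV[R]_m,
    partial ni.2 g (p ni.1).1 - partial ni.2 g (p ni.1).2 =
      \sum_j ((p ni.1).1 0 j - (p ni.1).2 0 j) * partial j (partial ni.2 g) (xi j) /\
    forall j, `|xi j - x0| <= ni.1.+1%:R^-1.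
  move=> [n i] /=.
  have dg j z : derivable (partial i g) z (delta_mx 0 j).
    by apply: (@CD_derivable _ _ 0); exact: CD_partial.
  have [xi [E hxi]] := coord_mvt (p n).2 (p n).1 dg.
  exists xi; split=> // j; apply/rV_norm_leP; first by rewrite invr_ge0.
  move=> l; have [t /andP[t0 t1] hl] := hxi j l; rewrite !mxE hl.
  have [h1 h2 _] := hp n.
  have := le_trans (ler_coord_norm _ l) h1; have := le_trans (ler_coord_norm _ l) h2.
  rewrite !mxE; move: ((p n).1 0 l) ((p n).2 0 l) (x0 0 l) (n.+1%:R^-1) t0 t1 => a b c d t0 t1.
  clear -t0 t1; rewrite !ler_norml => /andP[b1 b2] /andP[a1 a2].
  have -> : b + t * (a - b) - c = (1 - t) * (b - c) + t * (a - c) by ring.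
  by apply/andP; split; nra.
have [U [UU oU]] := ultra_nat.
have PU : ProperFilter U by exact: ultra_proper.
have FU : Filter U by exact: filter_filter.
pose d n := (p n).1 - (p n).2; pose v n := `|d n|^-1 *: d n.
have d0 n : 0 < `|d n|.
  have [_ _ h] := hp n; apply: le_lt_trans h; by rewrite mulr_ge0.
have v1 n : `|v n| = 1.
  by rewrite /v normrZ normfV normr_id mulVf // gt_eqF.
have [l hl] := @ultra_cvg_rV R m U UU v 1 (fun n => eq_ind_r (fun z => z <= 1) (lexx 1) (v1 n)).
exists l.
  have h1 : `|v n| @[n --> U] --> `|l| by exact: cvg_norm.
  have h2 : `|v n| @[n --> U] --> (1 : R).
    by apply: cvg_near_cst; apply: filterE => n; exact: v1.
  exact: (cvg_unique (@Rhausdorff R) h1 h2).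
move=> i; apply/eqP; rewrite -subr_eq0; apply/eqP.
pose w n := v n 0 i - al * \sum_j v n 0 j * partial j (partial i g) (xi (n, i) j).
have w0 : w n @[n --> U] --> 0.
  apply: cvg_sandwich_inv => // n; rewrite subr0.
  have -> : w n = `|d n|^-1 * (grad_step g al (p n).1 - grad_step g al (p n).2) 0 i.
    have [E _] := hxi (n, i); rewrite /= in E.
    rewrite /w /grad_step !mxE.
    have -> : \sum_j v n 0 j * partial j (partial i g) (xi (n, i) j) =
        `|d n|^-1 * (partial i g (p n).1 - partial i g (p n).2).
      by rewrite E mulr_sumr; apply: eq_bigr => j _; rewrite /v !mxE mulrA.
    move: (partial i g (p n).1) (partial i g (p n).2) => a b; rewrite ?mxE.
    by move: ((p n).1 0 i) ((p n).2 0 i) (`|d n|^-1) => ? ? ?; ring.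
  have [_ _ h] := hp n.
  rewrite normrM normfV normr_id; apply: le_trans (ler_wpM2l _ (ler_coord_norm _ i)) _.
    by rewrite invr_ge0.
  rewrite mulrC ler_pdivrMr // -ler_pdivrMl ?invr_gt0 // invrK; exact: ltW.
have w1 : w n @[n --> U] --> l 0 i - al * \sum_j l 0 j * partial j (partial i g) x0.
  apply: cvgB; first exact: (cvg_coord (i := i) hl).
  apply: cvgM; first exact: cvg_cst.
  apply: (@cvg_sumr R nat U FU _ (index_enum 'I_m)
    (fun j n => v n 0 j * partial j (partial i g) (xi (n, i) j))) => j.
  apply: cvgM; first exact: (cvg_coord (i := j) hl).
  have cp : continuous (partial j (partial i g)) := CD_continuous (CD_partial j (CD_partial i g2)).
  have hx : xi (n, i) j @[n --> U] --> x0.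
    by apply: cvg_sandwich_inv => // n; have [_] := hxi (n, i); apply.
  exact: (cvg_comp _ _ hx (cp x0)).
exact: (cvg_unique (@Rhausdorff R) w1 w0).
Qed.

(** Each covering cube of radius [r] that meets the image of [E] pulls back into a cube of radius
    [L * 2 * r] centred at a point of [E]; cubes missing the image get an arbitrary centre. *)
Lemma expanding_preimage_null (T : 'rV[R]_m -> 'rV[R]_m) (E N : set 'rV[R]_m) (L : R) :
  0 < L -> (forall x y, E x -> E y -> `|x - y| <= L * `|T x - T y|) ->
  cube_null N -> cube_null [set x | E x /\ N (T x)].
Proof.
move=> L0 ex nN e e0.
have [|c [r [r0 cov vol]]] := nN (e / (L * 2) ^+ m).
  by rewrite divr_gt0 // exprn_gt0 // mulr_gt0.
have /choice[c' hc'] : forall t, exists c', (exists2 x, E x & `|T x - c t| <= r t) ->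
    E c' /\ `|T c' - c t| <= r t.
  move=> t; case: (pselect (exists2 x, E x & `|T x - c t| <= r t)) => [[x Ex h]|n].
    by exists x.
  by exists 0.
exists c', (fun t => L * 2 * r t); split=> [t|x [Ex Nx]|s us].
- by rewrite !mulr_ge0 // ltW.
- have [t ht] := cov _ Nx; exists t.
  have [|Ec h] := hc' t; first by exists x.
  apply: le_trans (ex _ _ Ex Ec) _; rewrite -mulrA; apply: ler_wpM2l; first exact: ltW.
  have -> : T x - T (c' t) = (T x - c t) - (T (c' t) - c t).
    by rewrite opprB addrA subrK.
  apply: le_trans (ler_normB _ _) _; rewrite mulr_natl mulr2n; exact: lerD.
under eq_bigr do rewrite exprMn.
by rewrite -mulr_sumr mulrC -ler_pdivlMr ?exprn_gt0 ?mulr_gt0 //; exact: vol.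
Qed.

Lemma rational_approx x (e : R) : 0 < e ->
  exists q : 'rV[rat]_m, `|x - map_mx ratr q| <= e.
Proof.
move=> e0; have /choice[q hq] : forall i, exists q : rat, `|x 0 i - ratr q| <= e.
  move=> i; have [|q] := @rat_in_itvoo R (x 0 i - e) (x 0 i + e); first by lra.
  rewrite in_itv /= => /andP[h1 h2]; exists q; move: h1 h2.
  by move: (x 0 i) (ratr q : R) => u w *; rewrite ler_norml; lra.
exists (\row_i q i); apply/rV_norm_leP; first exact: ltW.
by move=> i; rewrite !mxE.
Qed.

Lemma grad_step_preimage_null g al (N : set 'rV[R]_m) : CD 2 g ->
  cube_null (singular g al) -> cube_null N -> cube_null [set x | N (grad_step g al x)].
Proof.
move=> g2 ns nN.
(* Rational centres make the family countable; half the radius of [grad_step_expands] keeps the ball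
   of [E] inside the ball around any of its points. *)
pose E (qn : 'rV[rat]_m * nat) : set 'rV[R]_m := [set x | `|x - map_mx ratr qn.1| <= (2 * qn.2.+1%:R)^-1].
pose F (qn : 'rV[rat]_m * nat) : set 'rV[R]_m := [set x | [/\ E qn x, N (grad_step g al x) &
  forall x y, E qn x -> E qn y -> `|x - y| <= qn.2.+1%:R * `|grad_step g al x - grad_step g al y|]].
apply: (@cube_null_sub _ _ _ (singular g al `|` [set x | exists qn, F qn x])) => [x Nx|].
  case: (pselect (singular g al x)) => [|sx]; [by left|right].
  have [n hn] := grad_step_expands g2 sx.
  have n0 : (0 : R) < n.+1%:R by [].
  have [|q hq] := @rational_approx x (2 * n.+1%:R)^-1; first by rewrite invr_gt0 mulr_gt0.
  exists (q, n); split=> //= u v hu hv.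
  have tri w : `|w - map_mx ratr q| <= (2 * n.+1%:R)^-1 -> `|w - x| <= n.+1%:R^-1.
    move=> hw; have -> : w - x = (w - map_mx ratr q) - (x - map_mx ratr q).
      by rewrite opprB addrA subrK.
    apply: le_trans (ler_normB _ _) _; apply: le_trans (lerD hw hq) _.
    by rewrite invfM; move: (n.+1%:R^-1) => z; lra.
  by apply: hn; apply: tri.
apply: cube_nullU => //; apply: cube_null_bigcup => qn.
case: (pselect (forall x y, E qn x -> E qn y ->
    `|x - y| <= qn.2.+1%:R * `|grad_step g al x - grad_step g al y|)) => h; last first.
  by apply: (@cube_null_sub _ _ _ N) => // x [].
apply: (@cube_null_sub _ _ _ [set x | E qn x /\ N (grad_step g al x)]); first by move=> x [].
exact: expanding_preimage_null h nN.
Qed.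

End StepMap.

Lemma finite_set_size_bound (T : choiceType) (A : set T) (K : nat) :
  (forall s : seq T, uniq s -> (forall t, t \in s -> A t) -> (size s <= K)%N) -> finite_set A.
Proof.
move=> hK.
pose P k := `[< exists s : seq T, [/\ uniq s, forall t, t \in s -> A t & size s = k] >].
have exP : exists k, P k by exists 0%N; apply/asboolP; exists [::].
have ubP k : P k -> (k <= K)%N by move=> /asboolP[s [us sA <-]]; exact: hK.
case: (ex_maxnP exP ubP) => k /asboolP[s [us sA <-]] smax.
apply: (@sub_finite_set _ _ [set` s]); last exact: finite_seq.
move=> t At /=; apply: contrapT => /negP ts.
have := smax (size s).+1; rewrite ltnn => h; suff : false by [].
apply: h; apply/asboolP; exists (t :: s); split=> //=.
  by rewrite ts.
by move=> u; rewrite in_cons => /orP[/eqP->|/sA].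
Qed.

Section SingularSteps.
Context {R : realType} {m' : nat}.
Local Notation m := m'.+1.
Variable g : 'rV[R]_m -> R.
Implicit Types (x y : 'rV[R]_m).
Local Notation partial i g := ('D_(delta_mx 0 i) g).
Local Notation CD := continuously_differentiable.
Hypothesis g2 : CD 2 g.

Lemma singular_closed (U : set_system nat) (UU : UltraFilter U) (y : nat -> 'rV[R]_m) x al :
  y k @[k --> U] --> x -> (\forall k \near U, singular g al (y k)) -> singular g al x.
Proof.
move=> yx hs.
have PU : ProperFilter U by exact: ultra_proper.
have FU : Filter U by exact: filter_filter.
have /choice[v hv] : forall k, exists v : 'rV[R]_m, `|v| <= 1 /\ (singular g al (y k) -> `|v| = 1 /\
    forall i, v 0 i = al * \sum_j v 0 j * partial j (partial i g) (y k)).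
  move=> k; case: (pselect (singular g al (y k))) => [[v v1 h]|n].
    by exists v; rewrite v1.
  by exists 0; rewrite normr0.
have [l hl] := @ultra_cvg_rV R m U UU v 1 (fun k => (hv k).1).
exists l.
  have h1 : `|v n| @[n --> U] --> `|l| by exact: cvg_norm.
  have h2 : `|v n| @[n --> U] --> (1 : R).
    by apply: cvg_near_cst; apply: filterS hs => n /(hv n).2[].
  exact: (cvg_unique (@Rhausdorff R) h1 h2).
move=> i; have h1 : v n 0 i @[n --> U] --> l 0 i by exact: (cvg_coord (i := i) hl).
have h2 : al * \sum_j v n 0 j * partial j (partial i g) (y n) @[n --> U] -->
    al * \sum_j l 0 j * partial j (partial i g) x.
  apply: cvgM; first exact: cvg_cst.
  apply: (@cvg_sumr R nat U FU _ (index_enum 'I_m)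
    (fun j n => v n 0 j * partial j (partial i g) (y n))) => j.
  apply: cvgM; first exact: (cvg_coord (i := j) hl).
  have cp : continuous (partial j (partial i g)) := CD_continuous (CD_partial j (CD_partial i g2)).
  exact: (cvg_comp _ _ yx (cp x)).
have h3 : al * \sum_j v n 0 j * partial j (partial i g) (y n) @[n --> U] --> l 0 i.
  apply: cvg_trans h1; apply: near_eq_cvg; apply: filterS hs => n /(hv n).2[_]; exact.
exact: (cvg_unique (@Rhausdorff R) h3 h2).
Qed.

(** The inverses of these step sizes are distinct roots of a characteristic polynomial of degree
    [m]. *)
Lemma singular_card x (s : seq R) : uniq s ->
  (forall al, al \in s -> 0 < al /\ singular g al x) -> (size s <= m)%N.
Proof.
move=> us hs; pose H : 'M[R]_m := \matrix_(j, i) partial j (partial i g) x.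
have nz : char_poly H != 0 by apply: monic_neq0; exact: char_poly_monic.
have := @max_poly_roots _ (char_poly H) (map (fun al => al^-1) s) nz.
rewrite size_map size_char_poly ltnS; apply; last first.
  by rewrite map_inj_uniq //; exact: invr_inj.
apply/allP => _ /mapP[al /hs[al0 [v v1 hv]] ->].
rewrite -eigenvalue_root_char; apply/eigenvalueP; exists v; last first.
  by apply/eqP => v0; move: v1; rewrite v0 normr0 => /esym/eqP; rewrite oner_eq0.
apply/rowP => i; rewrite mxE [RHS]mxE (hv i) mulrA mulVf ?gt_eqF // mul1r.
by apply: eq_bigr => j _; rewrite mxE.
Qed.

Section Grid.
Variables (B : nat) (L : nat).
Local Notation b := (B.+1%:R : R).
Local Notation l := (L.+1%:R : R).

(** [L.+1] cells of half side [b / l] fill a side of the cube; the additional index receives its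
    right end. *)
Definition grid_center (z : {ffun 'I_m -> 'I_L.+2}) : 'rV[R]_m :=
  \row_i (- b + (2 * (z i)%:R + 1) * (b / l)).

Lemma grid_cover x : `|x| <= b -> exists z, `|x - grid_center z| <= b / l.
Proof.
move=> xb; have bl0 : 0 < b / l by rewrite divr_gt0.
pose k i := Num.truncn ((x 0 i + b) / (2 * (b / l))).
have xi i : - b <= x 0 i <= b by rewrite -ler_norml (le_trans (ler_coord_norm _ i)).
have q0 i : 0 <= (x 0 i + b) / (2 * (b / l)).
  by rewrite divr_ge0 ?mulr_ge0 ?(ltW bl0) //; have /andP[] := xi i; lra.
have kL i : (k i < L.+2)%N.
  rewrite /k truncn_lt_nat // ltr_pdivrMr ?mulr_gt0 //.
  have -> : L.+2%:R * (2 * (b / l)) = 2 * b + 2 * (b / l) :> R.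
    have l0 : l != 0 by rewrite pnatr_eq0.
    by rewrite -[L.+2%:R]natr1; move: l0; move: (l) (b) => p q p0; field.
  by have /andP[_] := xi i; move: bl0; move: (b / l) (x 0 i) => *; lra.
exists [ffun i => Ordinal (kL i)]; apply/rV_norm_leP; first exact: ltW.
move=> i; rewrite !mxE ffunE /=; have /andP[] := truncn_itv (q0 i); rewrite -/(k i).
rewrite ler_pdivlMr ?mulr_gt0 // ltr_pdivrMr ?mulr_gt0 // -[(k i).+1%:R]natr1.
by rewrite ler_norml; move: ((k i)%:R) (x 0 i) (b / l) => u v w h1 h2; nra.
Qed.

Definition grid_meets al z :=
  `[< exists x, [/\ `|x| <= b, `|x - grid_center z| <= b / l & singular g al x] >].

Lemma grid_count al e :
  ~ small_cover ([set x | `|x| <= b] `&` singular g al) e ->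
  e <= #|[pred z | grid_meets al z]|%:R * (b / l) ^+ m.
Proof.
move=> H; rewrite leNgt; apply/negP => lt; apply: H.
have bl0 : 0 <= b / l by rewrite divr_ge0.
apply: (@small_cover_countable _ _ _ _ _ grid_center
  (fun z => if grid_meets al z then b / l else 0)).
- by move=> z; case: ifP.
- move=> x [xb sx]; have [z hz] := grid_cover xb; exists z.
  by rewrite (_ : grid_meets al z) //; apply/asboolP; exists x.
move=> s us; apply: le_trans (ltW lt).
apply: (@le_trans _ _ (\sum_(z : {ffun 'I_m -> 'I_L.+2}) (if grid_meets al z then b / l else 0) ^+ m)).
  rewrite [leRHS](bigID (mem s)) /= -[leLHS]addr0; apply: lerD; last first.
    by apply: sumr_ge0 => z _; case: ifP => _; rewrite exprn_ge0.
  rewrite -[leRHS]big_filter le_eqVlt; apply/orP; left; apply/eqP.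
  apply: perm_big; apply: uniq_perm => //; first by rewrite filter_uniq // index_enum_uniq.
  by move=> z; rewrite mem_filter mem_index_enum andbT.
rewrite [leRHS]mulr_natl -[leRHS]sumr_const [leRHS]big_mkcond /=; apply: ler_sum => z _.
by rewrite unfold_in /=; case: ifP => // _; rewrite expr0n.
Qed.

End Grid.

(** Otherwise every mesh has a cell met by the singular sets of more than [m] values of [s]. These
    cells shrink to a point, along an ultrafilter, and singular sets are closed, so that point would
    carry too many eigenvalues. *)
Lemma grid_multiplicity (B : nat) (s : seq R) : uniq s -> (forall al, al \in s -> 0 < al) ->
  exists L, forall z, (count (fun al => @grid_meets B L al z) s <= m)%N.
Proof.
move=> us s0; apply: contrapT => H.
have hex L : exists z, (m < count (fun al => @grid_meets B L al z) s)%N.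
  apply: contrapT => H1; apply: H; exists L => z; rewrite leqNgt.
  by apply/negP => h; apply: H1; exists z.
pose z L := projT1 (cid (hex L)); have hz L := projT2 (cid (hex L)).
have [U [UU oU]] := ultra_nat.
have PU : ProperFilter U by exact: ultra_proper.
have FU : Filter U by exact: filter_filter.
have /choice[y0 hy0] : forall L, exists y, `|y| <= B.+1%:R /\
    `|y - grid_center B (z L)| <= B.+1%:R / L.+1%:R.
  move=> L; have : has (fun al => grid_meets B al (z L)) s by rewrite has_count (leq_ltn_trans _ (hz L)).
  by move=> /hasP[al _ /asboolP[y [h1 h2 _]]]; exists y.
have [x hx] := @ultra_cvg_rV R m U UU y0 B.+1%:R (fun L => (hy0 L).1).
have key al : U [set L | grid_meets B al (z L) -> singular g al x].
  case: (pselect (singular g al x)) => sx; first by apply: filterE => L /= _.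
  have [h|h] := in_ultra_setVsetC [set L | is_true (grid_meets B al (z L))] UU; last first.
    by apply: filterS h => L /= h1 h2.
  exfalso; apply: sx.
  have /choice[y hy] : forall L, exists y, `|y - y0 L| <= 2 * B.+1%:R / L.+1%:R /\
      (grid_meets B al (z L) -> singular g al y).
    move=> L; case: (boolP (grid_meets B al (z L))) => [/asboolP[y [h1 h2 h3]]|n].
      exists y; split=> //; have [_ h4] := hy0 L.
      have -> : y - y0 L = (y - grid_center B (z L)) - (y0 L - grid_center B (z L)).
        by rewrite opprB addrA subrK.
      apply: le_trans (ler_normB _ _) _; rewrite -mulrA mulr_natl mulr2n; exact: lerD.
    by exists (y0 L); split=> //; rewrite subrr normr0 divr_ge0 // mulr_ge0.
  have yd : y L - y0 L @[L --> U] --> (0 : 'rV[R]_m).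
    apply/cvgr0Pnorm_lt => e e0; apply: oU.
    have e1 : 0 < e / (2 * B.+1%:R) by rewrite divr_gt0 // mulr_gt0.
    have [N _ hN] : \forall n \near \oo, (n.+1%:R^-1 : R) < e / (2 * B.+1%:R).
      by near=> n; near: n; exact: near_infty_natSinv_lt (PosNum e1).
    exists N => // L /= /hN; rewrite ltr_pdivlMr ?mulr_gt0 // => h1.
    by apply: le_lt_trans h1; rewrite mulrC; case: (hy L).
  have yx : y L @[L --> U] --> x.
    have h1 : y L - y0 L + y0 L @[L --> U] --> 0 + x by exact: cvgD.
    rewrite add0r in h1; have E : y = (fun L => y L - y0 L + y0 L).
      by apply/funext => n; rewrite subrK.
    by rewrite E.
  apply: (singular_closed UU yx); apply: filterS h => L /=; exact: (hy L).2.
have : U (fun L => forall t : 'I_(size s), [set L | grid_meets B s`_t (z L) -> singular g s`_t x] L).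
  by apply: filter_forall => t; exact: key.
move=> /filter_ex[L hL].
have := hz L; rewrite ltnNge => /negP; apply.
apply: (@leq_trans (count (fun al => `[< singular g al x >]) s)).
  rewrite -!sum1_count big_seq_cond [leqRHS]big_seq_cond.
  rewrite !(big_mkcond (fun i => (i \in s) && _)) /=; apply: leq_sum => al _.
  case: (boolP (al \in s)) => //= als; case: ifP => // hm.
  have := als; rewrite -index_mem => lt; have := hL (Ordinal lt); rewrite /= nth_index //.
  by move=> /(_ hm) h; case: asboolP.
rewrite -size_filter; apply: (@singular_card x); first exact: filter_uniq.
by move=> al; rewrite mem_filter => /andP[/asboolP h /s0].
Unshelve. all: by end_near. Qed.

(** Double counting on a grid stands in for integrating the number of eigenvalues: each [al] in
    [Bad (B, N)] occupies cells of total volume at least [N.+1%:R^-1], and each cell is counted at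
    most [m] times. So every [Bad] set is finite. *)
Lemma countable_singular : countable [set al | 0 < al /\ ~ cube_null (singular g al)].
Proof.
pose Bad (p : nat * nat) : set R := [set al | 0 < al /\
  ~ small_cover ([set x | `|x| <= p.1.+1%:R] `&` singular g al) p.2.+1%:R^-1].
apply: (@sub_countable _ _ _ (\bigcup_(p in setT) Bad p)).
  apply: subset_card_le => al [al0 H]; apply: contrapT => H1; apply: H.
  apply: (@cube_null_sub _ _ _ [set x | exists B : nat, ([set x | `|x| <= B.+1%:R] `&` singular g al) x]).
    move=> x sx; exists (Num.truncn `|x|); split=> //=.
    by apply: ltW; exact: truncnS_gt.
  apply: cube_null_bigcup => B e e0.
  have [N hN] : exists N : nat, (N.+1%:R^-1 : R) < e.
    have [N _ hN] : \forall n \near \oo, (n.+1%:R^-1 : R) < e.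
      by near=> n; near: n; exact: near_infty_natSinv_lt (PosNum e0).
    by exists N; apply: hN => /=.
  apply: (small_cover_le (ltW hN)); apply: contrapT => H2; apply: H1.
  by exists (B, N).
apply: bigcup_countable => // -[B N] _.
apply: finite_set_countable.
(* [(b * 2) ^+ m] bounds the total volume of the grid uniformly in [L], since [L.+2] is at most
   twice [L.+1]. *)
pose b : R := B.+1%:R; pose K := m%:R * (b * 2) ^+ m * N.+1%:R.
apply: (@finite_set_size_bound _ _ (Num.truncn K)) => s us sA.
have s0 al : al \in s -> 0 < al by move=> /sA[].
have [L hL] := grid_multiplicity B us s0.
have cnt al : al \in s -> N.+1%:R^-1 <= #|[pred z | @grid_meets B L al z]|%:R * (b / L.+1%:R) ^+ m.
  by move=> /sA[_ h]; exact: grid_count.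
have K0 : 0 <= K by rewrite !mulr_ge0 // exprn_ge0 // mulr_ge0.
rewrite truncn_ge_nat // /K -ler_pdivrMr //.
apply: (@le_trans _ _ (\sum_(al <- s) #|[pred z | @grid_meets B L al z]|%:R * (b / L.+1%:R) ^+ m)).
  rewrite -sum1_size natr_sum mulr_suml big_seq [leRHS]big_seq; apply: ler_sum => al als.
  by rewrite mul1r; exact: cnt.
rewrite -mulr_suml -natr_sum.
apply: (@le_trans _ _ ((m * L.+2 ^ m)%:R * (b / L.+1%:R) ^+ m)).
  apply: ler_wpM2r; first by rewrite exprn_ge0 // divr_ge0.
  rewrite ler_nat; under eq_bigr do rewrite -sum1_card big_mkcond.
  rewrite exchange_big /= -[(L.+2 ^ m)%N]/(L.+2 ^ m)%N.
  have -> : (m * L.+2 ^ m = \sum_(z : {ffun 'I_m -> 'I_L.+2}) m)%N.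
    by rewrite sum_nat_const card_ffun !card_ord mulnC.
  apply: leq_sum => z _; rewrite -big_mkcond sum1_count; exact: hL.
rewrite natrM -mulrA; apply: ler_wpM2l => //.
rewrite natrX -exprMn; apply: lerXn2r; rewrite ?nnegrE ?mulr_ge0 ?divr_ge0 //.
rewrite mulrCA; apply: ler_wpM2l => //; rewrite ler_pdivrMr // -natrM ler_nat.
by rewrite mulnC muln2 -addnn !addSn addnS !ltnS leq_addr.
Unshelve. all: by end_near. Qed.

End SingularSteps.

(** * Almost sure control of the noise *)

(** From [expR y <= (1 - y)^-1], itself the inequality [1 - y <= expR (- y)]. *)
Lemma expR_quadratic_bound {R : realType} (y : R) : `|y| <= 2^-1 -> expR y <= 1 + y + 2 * y ^+ 2.
Proof.
move=> y2; have /andP[h1 h2] : - 2^-1 <= y <= 2^-1 by rewrite -ler_norml.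
have y1 : 0 < 1 - y by move: h2; lra.
have e1 : 1 - y <= (expR y)^-1 by rewrite -expRN; exact: (expR_ge1Dx (- y)).
have : expR y <= (1 - y)^-1 by rewrite -[expR y]invrK lef_pV2 // posrE invr_gt0 expR_gt0.
move=> h; apply: le_trans h _; rewrite -[leLHS]mul1r ler_pdivrMr //.
have -> : (1 + y + 2 * y ^+ 2) * (1 - y) = 1 + y ^+ 2 * (1 - 2 * y) by ring.
by rewrite lerDl mulr_ge0 ?sqr_ge0 //; move: h2; lra.
Qed.

Section Words.
Context {R : realType} {n : nat}.
Variable i0 : 'I_n.
Implicit Types (u : seq 'I_n) (c : 'I_n).

(** Letters are added at the end, so that [sum_words] sums over the latest index for a fixed
    history: this is conditioning. *)
Fixpoint words (l : nat) : seq (seq 'I_n) :=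
  if l is l'.+1 then [seq rcons u c | u <- words l', c <- enum 'I_n] else [:: [::]].

Lemma sum_words (l : nat) (F : seq 'I_n -> R) :
  \sum_(u <- words l.+1) F u = \sum_(u <- words l) \sum_c F (rcons u c).
Proof.
rewrite /= big_allpairs_dep; apply: eq_bigr => u _.
by rewrite big_enum.
Qed.

Lemma size_words l u : u \in words l -> size u = l.
Proof.
elim: l u => [|l IH] u /=; first by rewrite inE => /eqP ->.
by move=> /allpairsP[[v c] /= [/IH vl _ ->]]; rewrite size_rcons vl.
Qed.

Lemma mem_words (h : nat -> 'I_n) l : mkseq h l \in words l.
Proof.
elim: l => [//|l IH]; rewrite mkseqS; apply/allpairsP.
by exists (mkseq h l, h l); rewrite mem_enum.
Qed.

(* [xi u c] is the increment at time [size u] after the history [u]; adaptedness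
   is thus built into the type. *)
Variables (xi : seq 'I_n -> 'I_n -> R) (b : nat -> R).
Hypothesis xi0 : forall u, \sum_c xi u c = 0.
Hypothesis xib : forall u c, `|xi u c| <= b (size u).

Definition window_sum k u : R := \sum_(k <= i < size u) xi (take i u) (nth i0 u i).

Lemma window_sum_rcons k u c : window_sum k (rcons u c) =
  window_sum k u + (if (k <= size u)%N then xi u c else 0).
Proof.
rewrite /window_sum size_rcons; case: leqP => ku.
  rewrite big_nat_recr //= nth_rcons ltnn eqxx.
  rewrite -cats1 take_size_cat //; congr (_ + _).
  rewrite big_nat_cond [RHS]big_nat_cond; apply: eq_bigr => i /andP[/andP[_ iu] _].
  by rewrite cats1 nth_rcons iu -cats1 takel_cat // ltnW.
by rewrite !big_geq ?addr0 // ltnW.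
Qed.

(** Sums over words are expectations multiplied by [n ^+ l]. For a fixed history the linear term of
    the exponential averages to 0, which leaves a factor [1 + 2 * th ^+ 2 * b l ^+ 2]. *)
Lemma window_moment k l (th : R) : (k <= l)%N ->
  (forall i, (k <= i < l)%N -> `|th| * b i <= 2^-1) ->
  \sum_(u <- words l) expR (th * window_sum k u) <=
  n%:R ^+ l * expR (2 * th ^+ 2 * \sum_(k <= i < l) b i ^+ 2).
Proof.
move=> kl; have : (k <= l)%N := kl; elim: l kl => [|l IH] kl kl1 hb.
  rewrite /= big_seq1 expr0 mul1r big_geq // /window_sum big_geq // !mulr0.
  exact: lexx.
rewrite sum_words.
move: kl1; rewrite leq_eqVlt => /orP[/eqP kE|].
  rewrite [X in expR (_ * X)]big_geq ?kE // mulr0 expR0 mulr1.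
  rewrite big_seq (eq_bigr (fun=> \sum_(c : 'I_n) 1)); last first.
    move=> u /size_words ul; apply: eq_bigr => c _.
    by rewrite window_sum_rcons ul ltnn addr0 /window_sum big_geq ?mulr0 ?expR0 // ul.
  rewrite -big_seq sumr_const card_ord.
  have -> : \sum_(u <- words l) n%:R = n%:R ^+ l.+1 :> R.
    elim: (l) => [|q IHq]; first by rewrite big_seq1.
    rewrite sum_words (eq_bigr (fun=> n%:R * n%:R)) => [|u _]; last first.
      by rewrite sumr_const card_ord mulr_natl.
    by rewrite -mulr_sumr IHq -exprS.
  exact: lexx.
rewrite ltnS => {}kl.
have hb' i : (k <= i < l)%N -> `|th| * b i <= 2^-1.
  by move=> /andP[h1 h2]; apply: hb; rewrite h1 ltnW.
have bl : `|th| * b l <= 2^-1 by apply: hb; rewrite kl ltnSn.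
have key u : u \in words l -> \sum_c expR (th * window_sum k (rcons u c)) <=
    expR (th * window_sum k u) * (n%:R * expR (2 * th ^+ 2 * b l ^+ 2)).
  move=> /size_words ul.
  under eq_bigr do rewrite window_sum_rcons ul kl mulrDr expRD.
  rewrite -mulr_sumr; apply: ler_wpM2l; first exact: expR_ge0.
  have bnd c : `|th * xi u c| <= `|th| * b l.
    by rewrite normrM -ul; apply: ler_wpM2l.
  apply: (@le_trans _ _ (\sum_c (1 + th * xi u c + 2 * (th ^+ 2 * b l ^+ 2)))).
    apply: ler_sum => c _; apply: le_trans (expR_quadratic_bound (le_trans (bnd c) bl)) _.
    rewrite lerD2l ler_pM2l // -exprMn -real_normK ?num_real // -[leRHS]real_normK ?num_real //.
    rewrite ler_sqr ?nnegrE // [leRHS]normrM; apply: le_trans (bnd c) _.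
    by apply: ler_wpM2l => //; exact: ler_norm.
  rewrite big_split big_split /= sumr_const -mulr_sumr xi0 mulr0 addr0 sumr_const card_ord.
  rewrite -mulrnDl -[leLHS]mulr_natl.
  by apply: ler_wpM2l => //; rewrite mulrA; exact: expR_ge1Dx.
rewrite big_seq; apply: le_trans (ler_sum _ key) _.
rewrite -big_seq -mulr_suml.
apply: le_trans (ler_wpM2r _ (IH kl kl hb')) _; first by rewrite mulr_ge0 // expR_ge0.
by rewrite big_nat_recr //= mulrDr expRD [n%:R ^+ l.+1]exprSr mulrACA; exact: lexx.
Qed.

End Words.

Section NoiseAlmostSurely.
Context {R : realType} {n : nat}.
Hypothesis n_gt0 : (0 < n)%N.
Variables (d0 : measure_display) (T0 : measurableType d0) (P0 : probability T0 R)
  (iota : T0 -> 'I_n).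
Hypothesis iota_measurable : forall l, measurable (iota @^-1` [set l]).
Hypothesis iota_uniform : forall l, P0 (iota @^-1` [set l]) = (n%:R^-1)%:E.
Variable P : probability (infinite_product T0) R.
Hypothesis P_product : is_product_measure P0 P.
Variable i0 : 'I_n.
Implicit Types (u : seq 'I_n) (c : 'I_n) (w : infinite_product T0).

Definition cylinder u : set (infinite_product T0) :=
  [set w | forall k, (k < size u)%N -> (iota @^-1` [set nth i0 u k]) (w k)].

Lemma measurable_cylinder u : measurable (cylinder u).
Proof.
have -> : cylinder u = \bigcap_(k in [set k | (k < size u)%N])
    [set w : infinite_product T0 | (iota @^-1` [set nth i0 u k]) (w k)].
  by apply/seteqP; split.
apply: bigcap_measurableType => k _; apply: sub_sigma_algebra; exists k => //.
by exists (iota @^-1` [set nth i0 u k]) => //; rewrite setTI.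
Qed.

Lemma measure_cylinder u : P (cylinder u) = (n%:R ^- size u)%:E.
Proof.
rewrite /cylinder (@P_product (size u) (fun k => iota @^-1` [set nth i0 u k])) //.
under eq_bigr do rewrite iota_uniform.
by rewrite prodEFin prodr_const card_ord exprVn.
Qed.

Lemma measure_cylinders (s : seq (seq 'I_n)) (Q : pred (seq 'I_n)) :
  (P (\big[setU/set0]_(u <- s | Q u) cylinder u) <= \sum_(u <- s | Q u) (n%:R ^- size u)%:E)%E.
Proof.
elim: s => [|u s IH]; first by rewrite !big_nil measure0.
rewrite !big_cons; case: ifP => // Qu; apply: (le_trans (measureU2 _ _ _)).
- exact: measurable_cylinder.
- by apply: bigsetU_measurable => v _; exact: measurable_cylinder.
by apply: leeD; [rewrite -measure_cylinder; exact: lexx|exact: IH].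
Qed.

Variables (a : nat -> R) (C T : R) (l : nat -> nat).
Hypothesis C0 : 0 < C.
Hypothesis T0' : 0 < T.
Hypothesis a0 : forall k, 0 < a k.
Hypothesis a_ln : forall e, 0 < e -> exists N, forall k, (N <= k)%N -> a k * ln k%:R <= e.
Hypothesis kl : forall k, (k <= l k)%N.
Hypothesis lT : forall k, \sum_(k <= i < l k) a i <= T.

Lemma exponent_bound (eta : R) : 0 < eta -> exists N, forall k, (N <= k)%N ->
  exists th : R, (forall i, (k <= i < l k)%N -> `|th| * (C * a i) <= 2^-1) /\
   [/\ 0 <= th, (0 < k)%N & - (th * eta) + 2 * th ^+ 2 * \sum_(k <= i < l k) (C * a i) ^+ 2 <= - 2 * ln k%:R].
Proof.
(* With [th] equal to [4 * L / eta], the first bound gives [th * (C * a i) <= 2^-1], and the second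
   keeps the variance term below [2 * L], half of the gain [4 * L]. *)
move=> eta0; pose de := Num.min (eta / (8 * C)) (eta ^+ 2 / (16 * C ^+ 2 * T)).
have de0 : 0 < de by rewrite lt_min !divr_gt0 // ?mulr_gt0 // exprn_gt0.
have [N hN] := a_ln de0; exists (maxn N 1) => k; rewrite geq_max => /andP[Nk k1].
have k0 : (0 : R) < k%:R by rewrite ltr0n.
have L0 : 0 <= ln (k%:R : R) by rewrite ln_ge0 // ler1n.
have aL i : (k <= i)%N -> a i * ln k%:R <= de.
  move=> ki; apply: le_trans (hN i (leq_trans Nk ki)); apply: ler_wpM2l; first exact: ltW.
  by rewrite ler_ln ?posrE // ?ler_nat // ltr0n (leq_trans k1 ki).
pose L : R := ln k%:R; exists (4 * L / eta).
have th0 : 0 <= 4 * L / eta by rewrite divr_ge0 ?mulr_ge0 // ltW.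
have de1 : de * (8 * C) <= eta.
  by rewrite -ler_pdivlMr ?mulr_gt0 // ge_min lexx.
have de2 : de * (16 * C ^+ 2 * T) <= eta ^+ 2.
  by rewrite -ler_pdivlMr ?mulr_gt0 ?exprn_gt0 // ge_min lexx orbT.
split=> [i /andP[ki _]|].
  rewrite ger0_norm // mulrAC ler_pdivrMr //.
  apply: (@le_trans _ _ (4 * C * de)); last by move: de1; lra.
  have -> : 4 * L * (C * a i) = 4 * C * (a i * L) by ring.
  by apply: ler_wpM2l; [rewrite mulr_ge0 // ltW|exact: aL].
split=> //; have -> : 4 * L / eta * eta = 4 * L by field; rewrite gt_eqF.
suff h : 2 * (4 * L / eta) ^+ 2 * (\sum_(k <= i < l k) (C * a i) ^+ 2) <= 2 * L.
  by move: h; rewrite -/L; lra.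
have S1 : L * \sum_(k <= i < l k) (C * a i) ^+ 2 <= C ^+ 2 * de * T.
  apply: (@le_trans _ _ (C ^+ 2 * de * \sum_(k <= i < l k) a i)); last first.
    by apply: ler_wpM2l (lT k); rewrite mulr_ge0 ?sqr_ge0 // ltW.
  rewrite !mulr_sumr big_nat_cond [leRHS]big_nat_cond; apply: ler_sum => i /andP[/andP[ki _] _].
  have -> : L * (C * a i) ^+ 2 = C ^+ 2 * (a i * L) * a i by ring.
  apply: ler_wpM2r; first exact: ltW.
  by apply: ler_wpM2l; [exact: sqr_ge0|exact: aL].
have -> : 2 * (4 * L / eta) ^+ 2 * (\sum_(k <= i < l k) (C * a i) ^+ 2) =
    32 * L / eta ^+ 2 * (L * \sum_(k <= i < l k) (C * a i) ^+ 2).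
  by field; rewrite gt_eqF.
apply: (le_trans (ler_wpM2l _ S1)); first by rewrite divr_ge0 ?mulr_ge0 // ltW.
rewrite mulrAC ler_pdivrMr ?exprn_gt0 //.
have -> : 32 * L * (C ^+ 2 * de * T) = 2 * L * (de * (16 * C ^+ 2 * T)) by ring.
by apply: ler_wpM2l de2; rewrite mulr_ge0.
Qed.

Section OneSided.
Variable xi : seq 'I_n -> 'I_n -> R.
Hypothesis xi0 : forall u, \sum_c xi u c = 0.
Hypothesis xib : forall u c, `|xi u c| <= C * a (size u).

(** The bad event depends on the first [l k] indices only, so [B k] is a finite union of cylinders,
    measurable and estimated by counting words. *)
Lemma window_tail (eta : R) : 0 < eta -> {ae P, forall w, \forall k \near \oo,
  window_sum i0 xi k (mkseq (fun i => iota (w i)) (l k)) < eta}.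
Proof.
move=> eta0; have [N hN] := exponent_bound eta0.
pose B k := \big[setU/set0]_(u <- words (l k) | eta <= window_sum i0 xi k u) cylinder u.
have mB k : measurable (B k) by apply: bigsetU_measurable => u _; exact: measurable_cylinder.
have nl0 q : (0 : R) < n%:R ^+ q by rewrite exprn_gt0 // ltr0n.
have PB k : (N <= k)%N -> (0 < k)%N /\ (P (B k) <= (k%:R ^- 2)%:E)%E.
  move=> /hN[th [hb [th0 k0 bound]]]; split=> //.
  apply: (le_trans (measure_cylinders _ _)); rewrite sumEFin lee_fin.
  have e1 : \sum_(u <- words (l k) | eta <= window_sum i0 xi k u) n%:R ^- size u <=
      n%:R ^- l k * expR (- (th * eta)) * \sum_(u <- words (l k)) expR (th * window_sum i0 xi k u).
    rewrite mulr_sumr [leLHS]big_mkcond big_seq [leRHS]big_seq; apply: ler_sum => u /size_words ->.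
    case: ifP => h; last by rewrite !mulr_ge0 ?expR_ge0 // invr_ge0 ltW.
    rewrite -mulrA -[leLHS]mulr1; apply: ler_wpM2l; first by rewrite invr_ge0 ltW.
    rewrite -expRD -[leLHS]expR0 ler_expR addrC subr_ge0; exact: ler_wpM2l.
  apply: (le_trans e1).
  have := @window_moment R n i0 xi (fun i => C * a i) xi0 xib k (l k) th (kl k) hb.
  move=> h; apply: (le_trans (ler_wpM2l _ h)).
    by rewrite mulr_ge0 ?expR_ge0 // invr_ge0 ltW.
  rewrite mulrACA mulVf ?gt_eqF // mul1r -expRD; apply: (@le_trans _ _ (expR (- 2 * ln k%:R))).
    by rewrite ler_expR.
  by rewrite mulNr expRN expRM_natl lnK ?posrE ?ltr0n //; exact: lexx.
have fin : (\sum_(0 <= k <oo) P (B k) < +oo)%E.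
  apply: (@le_lt_trans _ _ ((N.+1%:R + 2) : R)%:E); last exact: ltry.
  apply: lime_le; first by apply: is_cvg_nneseries => k _ _; exact: measure_ge0.
  apply: filterE => K.
  (* The first [N.+1] terms are at most 1 each; the others telescope, as [k ^- 2] is at most
     [(k - 1)^-1 - k^-1]. *)
  have h K' : (\sum_(0 <= k < K') P (B k) <=
      ((minn K' N.+1)%:R + (if (K' <= N.+1)%N then 0 else 2 - (K'.-1)%:R^-1))%:E)%E.
    elim: K' => [|K' IH]; first by rewrite big_geq //= min0n addr0.
    rewrite big_nat_recr //=; apply: (le_trans (leeD2r _ IH)).
    have [KN|NK] := ltnP K' N.+1.
      rewrite ltnW // !(minn_idPl _) // ?ltnW // !addr0 -natr1 EFinD leeD2l //.
      exact: probability_le1.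
    have [k0 h] := PB K' (ltnW NK); apply: (le_trans (leeD2l _ h)).
    rewrite -EFinD lee_fin (minn_idPr _) // ?(leq_trans NK) // -addrA lerD2l.
    move: NK; rewrite leq_eqVlt => /orP[/eqP <-|NK].
      rewrite leqnn add0r; have : (N.+1%:R ^- 2 : R) <= 1 by rewrite invf_le1 ?exprn_gt0 // exprn_ege1 // ler1n.
      have : (N.+1%:R^-1 : R) <= 1 by rewrite invf_le1 // ler1n.
      by move: (N.+1%:R^-1) (N.+1%:R ^- 2) => *; lra.
    rewrite leqNgt NK /=; have K1 : (0 < K'.-1)%N by rewrite -ltnS prednK // (leq_ltn_trans _ NK).
    have E : (K'%:R : R) = K'.-1%:R + 1 by rewrite natr1 prednK.
    have p0 : (0 : R) < K'.-1%:R by rewrite ltr0n.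
    rewrite E; move: (K'.-1%:R : R) p0 => p p0.
    rewrite -subr_ge0; have -> : 2 - (p + 1)^-1 - (2 - p^-1 + (p + 1) ^- 2) = (p * (p + 1) ^+ 2)^-1.
      by field; rewrite !gt_eqF // ltr_wpDl // ltW.
    by rewrite invr_ge0 mulr_ge0 ?sqr_ge0 // ltW.
  apply: (le_trans (h K)); rewrite lee_fin; apply: lerD; first by rewrite ler_nat geq_minr.
  by case: ifP => // _; rewrite gerBl invr_ge0.
have nul := lim_sup_set_cvg0 mB fin.
exists (lim_sup_set B); split=> //.
  by apply: bigcapT_measurable => k; apply: bigcup_measurable => i _; exact: mB.
move=> w /= nw k0 _; apply: contrapT => nB; apply: nw.
exists k0 => // k /= k0k; rewrite ltNge; apply/negP => h; apply: nB.
exists k => //; rewrite /B -bigcup_seq_cond; exists (mkseq (fun i => iota (w i)) (l k)).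
  by rewrite /= mem_words h.
by move=> i; rewrite size_mkseq => il; rewrite nth_mkseq.
Qed.
End OneSided.

Variable xi : seq 'I_n -> 'I_n -> R.
Hypothesis xi0 : forall u, \sum_c xi u c = 0.
Hypothesis xib : forall u c, `|xi u c| <= C * a (size u).

Lemma window_sum_cvg0 : {ae P, forall w,
  \sum_(k <= i < l k) xi (mkseq (fun i => iota (w i)) i) (iota (w i)) @[k --> \oo] --> (0 : R)}.
Proof.
have wE (z : seq 'I_n -> 'I_n -> R) k w : window_sum i0 z k (mkseq (fun i => iota (w i)) (l k)) =
    \sum_(k <= i < l k) z (mkseq (fun i => iota (w i)) i) (iota (w i)).
  rewrite /window_sum size_mkseq big_nat_cond [RHS]big_nat_cond.
  apply: eq_bigr => i /andP[/andP[_ il] _]; rewrite nth_mkseq //; congr (z _ _).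
  apply: (@eq_from_nth _ i0) => [|j]; rewrite size_take size_mkseq il ?size_mkseq // => ji.
  by rewrite nth_take // !nth_mkseq // (ltn_trans ji).
pose xi' u c := - xi u c.
have xi'0 u : \sum_c xi' u c = 0 by rewrite sumrN xi0 oppr0.
have xi'b u c : `|xi' u c| <= C * a (size u) by rewrite normrN.
have h1 : {ae P, forall w, forall j : nat, \forall k \near \oo,
    window_sum i0 xi k (mkseq (fun i => iota (w i)) (l k)) < j.+1%:R^-1}.
  by apply: ae_foralln => j; apply: window_tail => //; rewrite invr_gt0.
have h2 : {ae P, forall w, forall j : nat, \forall k \near \oo,
    window_sum i0 xi' k (mkseq (fun i => iota (w i)) (l k)) < j.+1%:R^-1}.
  by apply: ae_foralln => j; apply: window_tail => //; rewrite invr_gt0.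
apply: filterS2 h1 h2 => w h1 h2; apply/cvgr0Pnorm_lt => e e0.
have [N _ hN] : \forall j \near \oo, (j.+1%:R^-1 : R) < e.
  by near=> j; near: j; exact: near_infty_natSinv_lt (PosNum e0).
have {}hN := hN N (leqnn N).
near=> k; apply: lt_trans hN; rewrite ltr_norml; apply/andP; split; last first.
  by rewrite -wE; near: k; exact: h1.
rewrite ltrNl -sumrN -(wE xi'); near: k; exact: h2.
Unshelve. all: by end_near. Qed.

End NoiseAlmostSurely.

Section DenseTimes.
Context {R : realType} {m : nat}.
Variables (a : nat -> R) (nu : nat -> 'rV[R]_m) (K : R).
Hypothesis a0 : forall k, 0 < a k.
Hypothesis acvg : a k @[k --> \oo] --> 0.
Hypothesis adiv : forall k t, exists l, t <= \sum_(k <= i < l) a i.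
Hypothesis nuK : forall k, `|nu k| <= K * a k.
Local Notation stop := (stop a0 adiv).

(** Almost sure statements combine over countably many windows only. Extending a window from [t] to
    a rational time below [t + d] changes the sum by less than about [K * d], which gives all
    times. *)
Lemma window_cvg0_dense :
  (forall q : rat, \sum_(k <= i < stop k (ratr q)) nu i @[k --> \oo] --> (0 : 'rV[R]_m)) ->
  forall t, \sum_(k <= i < stop k t) nu i @[k --> \oo] --> (0 : 'rV[R]_m).
Proof.
move=> hq t; apply/cvgr0Pnorm_lt => e e0.
have K0 : 0 <= K by have := le_trans (normr_ge0 _) (nuK 0); rewrite pmulr_lge0.
pose d := e / (3 * (K + 1)).
have d0 : 0 < d by rewrite divr_gt0 // mulr_gt0 // ltr_wpDl.
have [|q] := @rat_in_itvoo R t (t + d); first by rewrite ltrDl.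
rewrite in_itv /= => /andP[tq qd]; pose s : R := ratr q.
have cs := @clock_stop_cvg R a a0 adiv acvg s.
have ct := @clock_stop_cvg R a a0 adiv acvg t.
have cd : clock a k (stop k s) - clock a k (stop k t) @[k --> \oo] --> Num.max s 0 - Num.max t 0.
  exact: cvgB.
have lt1 : Num.max s 0 - Num.max t 0 < d.
  move: tq qd; rewrite -/s => tq qd; rewrite !maxEle.
  by case: (leP t 0) => t0; case: (leP s 0) => s0; move: tq qd t0 s0 d0; lra.
have e3 : 0 < e / 3 by rewrite divr_gt0.
have Kd : K * d <= e / 3.
  have -> : d = e / 3 / (K + 1) by rewrite /d invfM mulrA.
  by rewrite mulrA ler_pdivrMr ?ltr_wpDl // mulrDr mulr1 mulrC lerDl ltW.
have h1 : \forall k \near \oo, clock a k (stop k s) - clock a k (stop k t) < d.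
  exact: (cvgr_lt _ cd).
have h2 : \forall k \near \oo, `|\sum_(k <= i < stop k s) nu i| < e / 3.
  by have := hq q => /cvgr0Pnorm_lt /(_ _ e3).
apply: filterS2 h1 h2 => k h1 h2.
have kt := stop_ge a0 adiv k t; have ts := stop_mono a0 adiv k (ltW tq).
have E : \sum_(k <= i < stop k t) nu i =
    \sum_(k <= i < stop k s) nu i - \sum_(stop k t <= i < stop k s) nu i.
  by rewrite (big_cat_nat kt ts) /= addrK.
have h3 : `|\sum_(stop k t <= i < stop k s) nu i| <= e / 3.
  apply: le_trans (ler_norm_sum _ _ _) _.
  apply: (@le_trans _ _ (K * (clock a k (stop k s) - clock a k (stop k t)))).
    rewrite (clockD a kt ts) addrC addKr /clock mulr_sumr; exact: ler_sum.
  by apply: le_trans Kd; apply: ler_wpM2l => //; exact: ltW.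
rewrite E; apply: le_lt_trans (ler_normB _ _) _.
by move: h2 h3 e0; move: `|_| `|_| => *; lra.
Qed.

End DenseTimes.

(** * Critical points of piecewise smooth functions *)

Section Differentiability.
Context {R : realType} {m : nat}.
Implicit Types (x y : 'rV[R]_m) (g : 'rV[R]_m -> R).
Local Notation partial i g := ('D_(delta_mx 0 i) g).
Local Notation CD := continuously_differentiable.

Definition dot (c h : 'rV[R]_m) : R := \sum_i c 0 i * h 0 i.

Lemma dot_linear c : linear (dot c).
Proof.
move=> t u v; rewrite /dot scaler_sumr -big_split /=; apply: eq_bigr => i _.
by rewrite !mxE mulrDr mulrCA.
Qed.

HB.instance Definition _ c :=
  GRing.isLinear.Build R 'rV[R]_m R _ (dot c) (dot_linear c).

Lemma dot_continuous c : continuous (dot c).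
Proof.
move=> x; apply: (@cvg_sumr R _ (nbhs x) _ _ (index_enum 'I_m) (fun i h => c 0 i * h 0 i)) => i.
by apply: cvgM; [exact: cvg_cst|exact: (@cvg_coord R m _ (nbhs x) _ id x i)].
Qed.

(** The subdifferential asks for total differentiability, while [CD] speaks of partial derivatives;
    the second order bound of [CD2_taylor] links them. *)
Lemma near_CD_differentiable f g x : CD 2 g -> (\forall y \near x, f y = g y) ->
  differentiable f x.
Proof.
move=> g2 fg; have [L L0 hL] := CD2_taylor (`|x| + 1) g2.
have fx : f x = g x by exact: (nbhs_singleton fg).
have E : f \o shift x = cst (f x) + dot (gradient g x) +o_ (0 : 'rV[R]_m) id.
  apply/eqaddoP => e e0.
  have h1 : \forall h \near (0 : 'rV[R]_m), f (h + x) = g (h + x).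
    have /nbhs_ballP[r r0 hr] := fg; apply/nbhs_ballP; exists r => // h.
    by rewrite -ball_normE /= sub0r normrN => hh; apply: hr; rewrite -ball_normE /= opprD addrCA subrr addr0 normrN.
  have d0 : 0 < Num.min 1 (e / (L + 1)) by rewrite lt_min ltr01 divr_gt0 // ltr_wpDl.
  have h2 : \forall h \near (0 : 'rV[R]_m), `|h| < Num.min 1 (e / (L + 1)).
    by apply/nbhs_ballP; exists (Num.min 1 (e / (L + 1))) => // h; rewrite -ball_normE /= sub0r normrN.
  apply: filterS2 h1 h2 => h h1; rewrite lt_min => /andP[hl1 hl2].
  have := hL x (h + x); rewrite addrK => /(_ _ _)/wrap[||H].
  - by rewrite lerDl.
  - by apply: le_trans (ler_normD _ _) _; rewrite addrC lerD2l ltW.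
  have -> : (f \o shift x - (cst (f x) + dot (gradient g x))) h =
      g (h + x) - g x - \sum_i partial i g x * ((h + x) 0 i - x 0 i).
    rewrite /= -[LHS]/(f (h + x) - (f x + dot (gradient g x) h)) h1 fx opprD addrA; congr (_ - _).
    by apply: eq_bigr => i _; rewrite !mxE addrK.
  apply: le_trans H _; rewrite expr2 mulrA; apply: ler_wpM2r => //.
  apply: (@le_trans _ _ (L * (e / (L + 1)))); first by apply: ler_wpM2l => //; exact: ltW.
  by rewrite mulrA ler_pdivrMr ?ltr_wpDl // mulrDr mulr1 mulrC lerDl ltW.
apply/diff_locallyP; rewrite (diff_unique (@dot_continuous (gradient g x)) E).
by split=> //; exact: dot_continuous.
Qed.

Lemma near_gradient f g x : (\forall y \near x, f y = g y) -> gradient f x = gradient g x.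
Proof. by move=> fg; apply/rowP => i; rewrite !mxE; exact: near_eq_derive. Qed.

Lemma gradient_continuous g : CD 1 g -> continuous (gradient g).
Proof.
move=> g1 x; apply: (@cvg_rV R m _ (nbhs x) (nbhs_filter x)) => i.
have -> : (fun y => gradient g y 0 i) = partial i g by apply/funext => y; rewrite mxE.
rewrite mxE; exact: (CD_continuous (CD_partial i g1)).
Qed.

(** Near [x], points of [Int j] have [gradient f] equal to [gradient (g j)], so by continuity the
    gradient of each active piece at [x] is a limiting gradient of [f]. *)
Lemma crit_point_clarke (J : finType) (Int : J -> set 'rV[R]_m) (g : J -> 'rV[R]_m -> R) f x :
  (forall j, CD 2 (g j)) -> (forall j y, Int j y -> \forall z \near y, f z = g j z) ->
  crit_point (fun j => closure (Int j)) g x -> clarke_subdifferential f x 0.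
Proof.
move=> g2 fg [l [l0 l1 lC lg]].
have [j0 hj0] : exists j, l j != 0.
  apply: contrapT => H; have : \sum_j l j = 0.
    by apply: big1 => j _; apply/eqP; apply: contrapT => h; apply: H; exists j; exact/negP.
  by rewrite l1 => /eqP; rewrite oner_eq0.
have grad j : closure (Int j) x -> exists xs : nat -> 'rV[R]_m,
    [/\ forall q, differentiable f (xs q), xs q @[q --> \oo] --> x
      & gradient f (xs q) @[q --> \oo] --> gradient (g j) x].
  move=> cl; have /choice[xs hxs] : forall q : nat, exists y, Int j y /\ `|x - y| < q.+1%:R^-1.
    move=> q; have /cl[y [Iy By]] : nbhs x (ball x (q.+1%:R^-1 : R)).
      by apply: nbhsx_ballx; rewrite invr_gt0.
    by exists y; move: By; rewrite -ball_normE.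
  have xsx : xs q @[q --> \oo] --> x.
    apply/cvgrPdist_lt => e e0; near=> q; apply: lt_trans (hxs q).2 _.
    by near: q; exact: near_infty_natSinv_lt (PosNum e0).
  exists xs; split=> // [q|].
    by apply: near_CD_differentiable (g2 j) (fg _ _ (hxs q).1).
  have -> : (fun q => gradient f (xs q)) = (fun q => gradient (g j) (xs q)).
    by apply/funext => q; apply: near_gradient; apply: fg; exact: (hxs q).1.
  have c : continuous (gradient (g j)) by apply: gradient_continuous; exact: CD_leq (g2 j).
  exact: (cvg_comp _ _ xsx (c x)).
(* [convex_hull] wants every vector in the set, those of weight 0 included; they borrow an active
   gradient. *)
pose v j := if l j != 0 then gradient (g j) x else gradient (g j0) x.
exists #|J|, (fun k => l (enum_val k)), (fun k => v (enum_val k)); split.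
- by move=> k.
- by rewrite -(big_enum_val (A := J) l).
- move=> k; rewrite /v; case: ifP => h; apply: grad; first exact: lC.
  exact: lC.
rewrite -(big_enum_val (A := J) (fun j => l j *: v j)); apply/rowP => i.
rewrite mxE summxE -[LHS](lg i); apply: eq_bigr => j _; rewrite mxE /v.
by case: ifPn => [_|]; rewrite ?mxE // negbK => /eqP ->; rewrite !mul0r.
Unshelve. all: by end_near. Qed.

End Differentiability.

Lemma sgd_eq (R : realType) (m n : nat) (grad : 'I_n -> 'rV[R]_m -> 'rV[R]_m) step idx idx' x k :
  (forall i, (i < k)%N -> idx i = idx' i) ->
  sgd grad step idx x k = sgd grad step idx' x k.
Proof.
elim: k => [//|k IH] h /=; rewrite IH => [|i ik]; last by apply: h; rewrite ltnW.
by rewrite h.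
Qed.

Section Pieces.
Context {R : realType} {m : nat}.
Variables (J : nat) (P : 'I_J -> set 'rV[R]_m) (gs : 'I_J -> 'rV[R]_m -> R).
Hypothesis trivP : trivIset setT P.

Lemma piecewise_gradientE j x : P j x -> piecewise_gradient P gs x = gradient (gs j) x.
Proof.
move=> Pj; rewrite /piecewise_gradient (big_pred1 j) // => i /=.
apply/idP/eqP => [|->]; last exact: mem_set.
by rewrite inE => Pi; apply: trivP => //; exists x.
Qed.

(** Off the interface [x] avoids the closures of the finitely many other pieces, so a neighbourhood
    misses them all. *)
Lemma piece_nbhs j x : \bigcup_j P j = setT -> P j x -> ~ interface P x -> nbhs x (P j).
Proof.
move=> cover Pj nI.
have h (i : 'I_J) : \forall y \near x, i != j -> ~ P i y.
  case: (eqVneq i j) => [->|ij]; first by apply: filterE.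
  have ncl : ~ closure (P i) x.
    by move=> cl; apply: nI; exists (i, j) => //; split=> //; exact: subset_closure.
  have : open (~` closure (P i)) by apply: closed_openC; exact: closed_closure.
  rewrite openE => /(_ x ncl); apply: filterS => y ny _ Py; apply: ny.
  exact: subset_closure.
have : \forall y \near x, forall i : 'I_J, i != j -> ~ P i y.
  exact: (@filter_forall _ _ _ _ (nbhs_filter x) h).
apply: filterS => y hy; have : (\bigcup_j P j) y by rewrite cover.
move=> [i _ Pi]; case: (eqVneq i j) => [<- //|ij]; by have := hy i ij.
Qed.

End Pieces.

Section NullStarts.
Context {R : realType} {m' : nat}.
Local Notation m := m'.+1.
Local Notation CD := continuously_differentiable.

Lemma piecewise_step_preimage_null (J : nat) (P : 'I_J -> set 'rV[R]_m)
  (gs : 'I_J -> 'rV[R]_m -> R) al (N : set 'rV[R]_m) :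
  trivIset setT P -> \bigcup_j P j = setT -> (forall j, CD 2 (gs j)) ->
  (forall j, cube_null (singular (gs j) al)) -> cube_null N ->
  cube_null [set x | N (x - al *: piecewise_gradient P gs x)].
Proof.
move=> triv cover g2 ns nN.
apply: (@cube_null_sub _ _ _ [set x | exists j, N (grad_step (gs j) al x)]); last first.
  by apply: (@cube_null_bigcup _ _ 'I_J (fun j => [set x | N (grad_step (gs j) al x)])) => j; exact: grad_step_preimage_null.
move=> x Nx; have : (\bigcup_j P j) x by rewrite cover.
by move=> [j _ Pj]; exists j; rewrite /grad_step -(piecewise_gradientE gs triv Pj).
Qed.

Variables (n : nat) (grad : 'I_n -> 'rV[R]_m -> 'rV[R]_m) (step : nat -> R).
Hypothesis step_null : forall k i (N : set 'rV[R]_m), cube_null N ->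
  cube_null [set x | N (x - step k *: grad i x)].

Lemma sgd_preimage_null idx k (N : set 'rV[R]_m) : cube_null N ->
  cube_null [set x | N (sgd grad step idx x k)].
Proof.
elim: k N => [|k IH] N nN //=.
exact: (IH [set x | N (x - step k *: grad (idx k) x)] (step_null k (idx k) nN)).
Qed.

(** An iterate depends on finitely many indices and there are countably many finite words, so one
    set [G] serves all index sequences; no probability enters. *)
Lemma good_starts (i0 : 'I_n) (Bad : 'I_n -> set 'rV[R]_m) : (forall i, lebesgue_null (Bad i)) ->
  exists G : set 'rV[R]_m, lebesgue_null (~` G) /\
    forall x, G x -> forall idx k i, ~ Bad i (sgd grad step idx x k).
Proof.
move=> nBad.
pose F (p : seq 'I_n * 'I_n) : set 'rV[R]_m :=
  [set x | Bad p.2 (sgd grad step (nth i0 p.1) x (size p.1))].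
exists (~` [set x | exists p, F p x]); split.
  rewrite setCK; apply: cube_lebesgue_null; apply: cube_null_bigcup => -[u i].
  by apply: sgd_preimage_null; exact: lebesgue_cube_null.
move=> x Gx idx k i bad; apply: Gx; exists (mkseq idx k, i); rewrite /F /= size_mkseq.
rewrite (_ : sgd grad step _ x k = sgd grad step idx x k) //.
by apply: sgd_eq => j jk; rewrite nth_mkseq.
Qed.

End NullStarts.

Section GoodSteps.
Context {R : realType} {m' : nat}.
Local Notation m := m'.+1.
Local Notation CD := continuously_differentiable.
Variables (I : countType) (g : I -> 'rV[R]_m -> R).
Hypothesis g2 : forall i, CD 2 (g i).

Definition good_steps : set R :=
  [set al | 0 < al /\ forall i, cube_null (singular (g i) al)].

Lemma countable_bad_steps : countable ([set al | 0 < al] `\` good_steps).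
Proof.
apply: (@sub_countable _ _ _ (\bigcup_(i in setT) [set al | 0 < al /\ ~ cube_null (singular (g i) al)])).
  apply: subset_card_le => al [/= al0 H]; apply: contrapT => H1; apply: H; split=> // i.
  by apply: contrapT => H2; apply: H1; exists i.
by apply: bigcup_countable => [|i _]; [exact: countableP|exact: countable_singular].
Qed.

Lemma countable_negligible (A : set R) : countable A -> lebesgue_measure.-negligible A.
Proof.
move=> cA; exists A; split=> //; last exact: countable_lebesgue_measure0.
by apply: countable_measurable => // t; exact: measurable_set1.
Qed.

Lemma ae_good_steps (alpha : nat -> R) : (forall k, 0 < alpha k) ->
  {ae lebesgue_measure, forall c : R, 0 < c -> forall k, good_steps (c * alpha k)}.
Proof.
move=> alpha0.
have : {ae lebesgue_measure, forall c : R, forall k, 0 < c -> good_steps (c * alpha k)}.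
  apply: ae_foralln => k; apply: countable_negligible.
  apply: (@sub_countable _ _ _ ((fun b => b / alpha k) @` ([set al | 0 < al] `\` good_steps))).
    apply: subset_card_le => c /= H; exists (c * alpha k); last by rewrite mulfK ?gt_eqF.
    have c0 : 0 < c by apply: contrapT => h; apply: H.
    split; first by rewrite /= mulr_gt0.
    by move=> h; apply: H.
  by apply: sub_countable (card_image_le _ _) _; exact: countable_bad_steps.
by apply: negligibleS => c /= H h; apply: H => c0 k; exact: h.
Qed.

End GoodSteps.

Lemma class_C_CD (R : realType) (m : nat) (p : option nat) (g : 'rV[R]_m -> R) k q :
  le_exponent q p -> (k <= q)%N -> class_C p g -> continuously_differentiable k g.
Proof.
case: p => [p|] /= qp kq; last exact.
by apply: CD_leq; exact: leq_trans qp.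
Qed.

Lemma ae_countable (d : measure_display) (T : measurableType d) (R : realType)
  (P : probability T R) (I : countType) (Q : I -> T -> Prop) :
  (forall i, {ae P, forall x, Q i x}) -> {ae P, forall x, forall i, Q i x}.
Proof.
move=> h.
have : {ae P, forall x, forall k, (fun k x => forall i : I, pickle i = k -> Q i x) k x}.
  apply: ae_foralln => k; case: (pselect (exists i : I, pickle i = k)) => [[i ik]|H].
    apply: filterS (h i) => x Qi i' i'k; have -> // : i' = i.
    by apply: (pcan_inj (@pickleK I)); rewrite i'k.
  by apply: filterE => x i ik; exfalso; apply: H; exists i.
by apply: filterS => x hx i; exact: hx.
Qed.

(** * Application to the averaged piecewise function *)

Section Assembly.
Context {R : realType} {m' n : nat}.
Local Notation m := m'.+1.
Local Notation CD := continuously_differentiable.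
Local Notation partial i g := ('D_(delta_mx 0 i) g).
Variable i0 : 'I_n.
Variables (J : 'I_n -> nat) (Pt : forall i : 'I_n, 'I_(J i) -> set 'rV[R]_m)
  (fs : forall i : 'I_n, 'I_(J i) -> 'rV[R]_m -> R).
Arguments Pt : clear implicits.
Arguments fs : clear implicits.
Hypothesis triv : forall i, trivIset setT (Pt i).
Hypothesis cover : forall i, \bigcup_j Pt i j = setT.
Hypothesis fs2 : forall i j, CD 2 (fs i j).
Hypothesis fsm : forall i j, CD m (fs i j).
Arguments fs2 : clear implicits.
Arguments fsm : clear implicits.
Variables (f_ : 'I_n -> 'rV[R]_m -> R) (f : 'rV[R]_m -> R).
Hypothesis cf_ : forall i, continuous (f_ i).
Hypothesis f_E : forall i j x, Pt i j x -> f_ i x = fs i j x.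
Hypothesis fE : forall x, f x = n%:R^-1 * \sum_(i < n) f_ i x.

Local Notation JJ := {dffun forall i : 'I_n, 'I_(J i)}.
Local Notation G i := (piecewise_gradient (Pt i) (fs i)).

Definition mean_piece (j : JJ) x := n%:R^-1 * \sum_(i < n) fs i (j i) x.
(** The interior of the common refinement; the closures of these sets play the role of the closed
    pieces [C] of limit curves. *)
Definition inner_piece (j : JJ) : set 'rV[R]_m := [set x | forall i, nbhs x (Pt i (j i))].

Lemma piece_exists x : exists j : JJ, forall i, Pt i (j i) x.
Proof.
have h i : exists j, Pt i j x.
  have : (\bigcup_j Pt i j) x by rewrite cover.
  by move=> [j _ Pj]; exists j.
exists [ffun i => projT1 (cid (h i))] => i; rewrite ffunE; exact: projT2 (cid (h i)).
Qed.

Lemma CD_mean_piece k j : (forall i j, CD k (fs i j)) -> CD k (mean_piece j).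
Proof.
by move=> h; apply: CDZ; apply: (@CD_sum _ _ k _ _ (fun i => fs i (j i))) => i; exact: h.
Qed.

Lemma gradient_mean_piece j x :
  gradient (mean_piece j) x = n%:R^-1 *: \sum_i gradient (fs i (j i)) x.
Proof.
apply/rowP => e; rewrite !mxE summxE.
have d i : derivable (fs i (j i)) x (delta_mx 0 e) by exact: (@CD_derivable _ _ 1 _ e x (fs2 i (j i))).
have -> : mean_piece j = n%:R^-1 *: \sum_(i < n) fs i (j i).
  by apply/funext => y; rewrite /mean_piece fct_sumE.
rewrite deriveZ; last by apply: derivable_sum.
rewrite derive_sum //; congr (_ * _); apply: eq_bigr => i _; by rewrite mxE.
Qed.

Lemma mean_piece_near j x : inner_piece j x -> \forall y \near x, f y = mean_piece j y.
Proof.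
move=> Ix; have : \forall y \near x, forall i, Pt i (j i) y.
  exact: (@filter_forall _ _ _ _ (nbhs_filter x) Ix).
apply: filterS => y Py; rewrite fE /mean_piece; congr (_ * _).
by apply: eq_bigr => i _; exact: f_E.
Qed.

Lemma continuous_mean : continuous f.
Proof.
have -> : f = (fun x => n%:R^-1 * \sum_(i < n) f_ i x) by apply/funext.
have c1 : continuous (fun x : 'rV[R]_m => \sum_(i < n) f_ i x) by exact: cont_sum.
have c2 : continuous (fun _ : 'rV[R]_m => n%:R^-1 : R) by move=> x; exact: cst_continuous.
exact: (contM c2 c1).
Qed.

Lemma mean_piece_closure j x : closure (inner_piece j) x -> f x = mean_piece j x.
Proof.
have cl : closed [set x | f x = mean_piece j x].
  have -> : [set x | f x = mean_piece j x] = [set x | f x - mean_piece j x = 0].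
    by apply/seteqP; split=> y /= => [->|/eqP]; rewrite ?subrr // subr_eq0 => /eqP.
  apply: closed_continuous_eq; apply: contB; first exact: continuous_mean.
  exact: CD_continuous (CD_mean_piece j fs2).
move=> h; apply: cl; move: x h; apply: closureS => x Ix /=.
exact: (nbhs_singleton (mean_piece_near Ix)).
Qed.

Lemma piecewise_gradient_bounded (M : R) :
  exists2 B, 0 <= B & forall i x, `|x| <= M -> `|G i x| <= B.
Proof.
pose K := ({i : 'I_n & 'I_(J i)} * 'I_m)%type.
have /choice[B hB] : forall k : K, exists B, 0 <= B /\ forall x, `|x| <= M ->
    `|partial k.2 (fs (tag k.1) (tagged k.1)) x| <= B.
  move=> [[i j] e] /=.
  have c : continuous (partial e (fs i j)) := CD_continuous (CD_partial e (fs2 i j)).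
  by have [B B0 h] := continuous_bounded M c; exists B.
exists (\sum_k B k); first by apply: sumr_ge0 => k _; case: (hB k).
move=> i x xM; have : (\bigcup_j Pt i j) x by rewrite cover.
move=> [j _ Pj]; rewrite (piecewise_gradientE (fs i) (@triv i) Pj).
apply/rV_norm_leP; first by apply: sumr_ge0 => k _; case: (hB k).
move=> e; rewrite mxE; pose k : K := (Tagged (fun i => 'I_(J i)) j, e).
have [_ h] := hB k; apply: le_trans (h x xM) _; rewrite (bigD1 k) //= lerDl.
by apply: sumr_ge0 => k' _; case: (hB k').
Qed.

Variables (a : nat -> R).
Hypothesis a0 : forall k, 0 < a k.
Hypothesis acvg : a k @[k --> \oo] --> 0.
Hypothesis adiv : forall k t, exists l, t <= \sum_(k <= i < l) a i.
Local Notation stop := (stop a0 adiv).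
Local Notation iter := (sgd (fun i => G i) a).

Definition mean_gap (c : 'I_n) x : 'rV[R]_m := n%:R^-1 *: (\sum_i G i x) - G c x.

Lemma sum_mean_gap x : \sum_c mean_gap c x = 0.
Proof.
have n0 : (n%:R : R) != 0 by rewrite pnatr_eq0 -lt0n; exact: leq_ltn_trans (ltn_ord i0).
by rewrite /mean_gap sumrB sumr_const card_ord -scaler_nat scalerA divff // scale1r subrr.
Qed.

Lemma mean_gap_bounded (M : R) :
  exists2 B, 0 < B & forall c x, `|x| <= M -> `|mean_gap c x| <= B.
Proof.
have n0 : (n%:R : R) != 0 by rewrite pnatr_eq0 -lt0n; exact: leq_ltn_trans (ltn_ord i0).
have [B B0 hB] := piecewise_gradient_bounded M.
exists (B + B + 1); first by rewrite ltr_wpDl // addr_ge0.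
move=> c x xM; apply: le_trans (ler_normB _ _) _.
have h1 : `|n%:R^-1 *: (\sum_i G i x)| <= B.
  rewrite normrZ ger0_norm ?invr_ge0 // mulrC ler_pdivrMr ?lt0r ?n0 ?ler0n //.
  apply: le_trans (ler_norm_sum _ _ _) _.
  apply: (@le_trans _ _ (\sum_(i < n) B)); first by apply: ler_sum => i _; exact: hB.
  by rewrite sumr_const card_ord mulr_natr.
have h2 := hB c x xM.
by apply: le_trans (lerD h1 h2) _; rewrite lerDl.
Qed.

Section Deterministic.
Variables (x0 : 'rV[R]_m) (idx : nat -> 'I_n) (M : R).
Local Notation x := (iter idx x0).
Hypothesis xM : forall k, `|x k| <= M.
Hypothesis x_avoid : forall k i, ~ interface (Pt i) (x k).
Hypothesis noise_rat : forall q : rat, forall e,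
  \sum_(k <= i < stop k (ratr q)) a i * mean_gap (idx i) (x i) 0 e @[k --> \oo] --> (0 : R).

Lemma iterates_converge :
  [/\ dist_to (x k) [set y | clarke_subdifferential f y 0] @[k --> \oo] --> 0%E,
      cvg (f (x k) @[k --> \oo]) & connected (limit_points x)].
Proof.
have /choice[jj hjj] : forall k, exists j : JJ, forall i, Pt i (j i) (x k).
  by move=> k; exact: piece_exists.
pose C j := closure (inner_piece j).
have xI k : inner_piece (jj k) (x k).
  by move=> i; apply: (piece_nbhs (cover i)) => //; exact: hjj.
have xC k : C (jj k) (x k) by apply: subset_closure.
have g2 j : CD 2 (mean_piece j) by exact: CD_mean_piece.
have gm j : CD m (mean_piece j) by exact: CD_mean_piece.
have clC j : closed (C j) by exact: closed_closure.
have noiseE k : noise mean_piece a x jj k = a k *: mean_gap (idx k) (x k).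
  rewrite /noise /= gradient_mean_piece /mean_gap scalerBr [X in X + _]addrAC subrr add0r addrC.
  congr (_ *: (_ *: _) - _); apply: eq_bigr => i _.
  by rewrite (piecewise_gradientE (fs i) (@triv i) (hjj k i)).
have [B B0 hB] := mean_gap_bounded M.
have [La La0 hLa] := piecewise_gradient_bounded M.
have step k : `|x k.+1 - x k| <= La * a k.
  rewrite /= addrAC subrr add0r normrN normrZ gtr0_norm // mulrC.
  by apply: ler_wpM2r; [exact: ltW|exact: hLa].
have noiseB k : `|noise mean_piece a x jj k| <= B * a k.
  rewrite noiseE normrZ gtr0_norm // mulrC; apply: ler_wpM2r; [exact: ltW|exact: hB].
have noise_cvg : forall t, \sum_(k <= i < stop k t) noise mean_piece a x jj i @[k --> \oo] --> (0 : 'rV[R]_m).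
  apply: (window_cvg0_dense acvg noiseB) => q; apply: cvg_rV => e.
  have := noise_rat q e; rewrite mxE.
  have -> // : (fun k => (\sum_(k <= i < stop k (ratr q)) noise mean_piece a x jj i) 0 e) =
    (fun k => \sum_(k <= i < stop k (ratr q)) a i * mean_gap (idx i) (x i) 0 e).
  by apply/funext => k; rewrite summxE; apply: eq_bigr => i _; rewrite noiseE mxE.
have xM1 k : `|x k| <= `|M| + 1 by apply: le_trans (xM k) _; rewrite ler_wpDr // ler_norm.
have M0 : 0 < `|M| + 1 by rewrite ltr_wpDl.
have fg j y : C j y -> f y = mean_piece j y by exact: mean_piece_closure.
split.
- apply: (dist_to_cvg0 xM) => U UU oU y xy /=.
  apply: (crit_point_clarke g2 mean_piece_near).
  exact: (limit_point_crit clC g2 gm continuous_mean fg M0 acvg xC xM1 step noise_cvg UU oU xy).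
- have [l hl] := f_iterates_cvg clC g2 gm continuous_mean fg M0 acvg xC xM1 step noise_cvg.
  by apply/cvg_ex; exists l.
apply: (connected_limit_points xM).
apply/cvgr0Pnorm_le => e e0.
have h : La * a k @[k --> \oo] --> La * 0 by apply: cvgM => //; exact: cvg_cst.
rewrite mulr0 in h; apply: filterS (cvgr_le _ h _ e0) => k; apply: le_trans.
exact: step.
Qed.

End Deterministic.

Variables (d0 : measure_display) (T0 : measurableType d0) (P0 : probability T0 R)
  (iota : T0 -> 'I_n).
Hypothesis iota_measurable : forall l, measurable (iota @^-1` [set l]).
Hypothesis iota_uniform : forall l, P0 (iota @^-1` [set l]) = (n%:R^-1)%:E.
Variable P : probability (infinite_product T0) R.
Hypothesis P_product : is_product_measure P0 P.
Hypothesis a_ln : forall e, 0 < e -> exists N, forall k, (N <= k)%N -> a k * ln k%:R <= e.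
Variable x0 : 'rV[R]_m.
Hypothesis avoid : forall idx k i, ~ interface (Pt i) (iter idx x0 k).

(** The bound on the iterates is random, so increments are cut off when the current iterate exceeds
    an integer. The cutoff looks at the history only and keeps them centred; for a bounded path some
    integer makes it inactive, and there are countably many of them. *)
Lemma noise_almost_surely : {ae P, forall w : infinite_product T0, forall p : 'I_m * nat * rat,
  \sum_(k <= i < stop k (ratr p.2))
    (if `|iter (fun l => iota (w l)) x0 i| <= p.1.2%:R
     then a i * mean_gap (iota (w i)) (iter (fun l => iota (w l)) x0 i) 0 p.1.1 else 0)
    @[k --> \oo] --> (0 : R)}.
Proof.
apply: ae_countable => -[[e M] q] /=.
pose X u := iter (nth i0 u) x0 (size u).
pose xi u c : R := if `|X u| <= M%:R then a (size u) * mean_gap c (X u) 0 e else 0.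
have [B B0 hB] := mean_gap_bounded M%:R.
have [A A0 hA] := steps_bounded a0 acvg.
have n_gt0 : (0 < n)%N by exact: leq_ltn_trans (ltn_ord i0).
have T0' : 0 < Num.max (ratr q : R) 0 + A + 1 by rewrite ltr_wpDl // addr_ge0 // le_max lexx orbT.
have lT k : \sum_(k <= i < stop k (ratr q)) a i <= Num.max (ratr q) 0 + A + 1.
  rewrite -[leLHS]/(clock a k (stop k (ratr q))).
  have h := @clock_stop R a a0 adiv k (ratr q) A (fun i _ => hA i).
  have := le_trans (ler_norm _) h; move: (clock _ _ _) (Num.max _ _) => u v; lra.
have xi0 u : \sum_c xi u c = 0.
  rewrite /xi; have [h|h] := boolP (`|X u| <= M%:R); last by rewrite big1.
  by rewrite -mulr_sumr -summxE sum_mean_gap mxE mulr0.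
have xib u c : `|xi u c| <= B * a (size u).
  rewrite /xi; case: ifP => h; last by rewrite normr0 mulr_ge0 ?ltW.
  rewrite normrM gtr0_norm // mulrC; apply: ler_wpM2r; first exact: ltW.
  exact: le_trans (ler_coord_norm _ _) (hB _ _ h).
have := window_sum_cvg0 n_gt0 iota_measurable iota_uniform P_product i0 B0 T0' a0 a_ln
  (fun k => stop_ge a0 adiv k (ratr q)) lT xi0 xib.
apply: filterS => w; have -> // : (fun k => \sum_(k <= i < stop k (ratr q))
    xi (mkseq (fun i => iota (w i)) i) (iota (w i))) =
  (fun k => \sum_(k <= i < stop k (ratr q))
    (if `|iter (fun l => iota (w l)) x0 i| <= M%:R
     then a i * mean_gap (iota (w i)) (iter (fun l => iota (w l)) x0 i) 0 e else 0)).
apply/funext => k; apply: eq_bigr => i _; rewrite /xi /X size_mkseq.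
rewrite (_ : iter (nth i0 _) x0 i = iter (fun l => iota (w l)) x0 i) //.
by apply: sgd_eq => l li; rewrite nth_mkseq.
Qed.

Lemma iterates_converge_almost_surely :
  {ae P, forall w, exists M : R, forall k, enorm (iter (fun l => iota (w l)) x0 k) <= M} ->
  {ae P, forall w,
    [/\ dist_to (iter (fun l => iota (w l)) x0 k) [set y | clarke_subdifferential f y 0]
          @[k --> \oo] --> 0%E,
        cvg (f (iter (fun l => iota (w l)) x0 k) @[k --> \oo])
      & connected (limit_points (iter (fun l => iota (w l)) x0))]}.
Proof.
move=> bnd; have FP : Filter (nbhs (almost_everywhere P)) := ae_filter_ringOfSetsType P.
apply: filterS2 bnd noise_almost_surely => w [M hM] hnoise.
pose N := (Num.truncn M).+1.
have xN k : `|iter (fun l => iota (w l)) x0 k| <= N%:R.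
  apply: le_trans (norm_le_enorm _) _; apply: le_trans (hM k) _.
  by apply: ltW; exact: truncnS_gt.
apply: (iterates_converge xN) => [k i|q e]; first exact: avoid.
have := hnoise (e, N, q) => /=.
have -> // : (fun k => \sum_(k <= i < stop k (ratr q))
    (if `|iter (fun l => iota (w l)) x0 i| <= N%:R
     then a i * mean_gap (iota (w i)) (iter (fun l => iota (w l)) x0 i) 0 e else 0)) =
  (fun k => \sum_(k <= i < stop k (ratr q))
    a i * mean_gap (iota (w i)) (iter (fun l => iota (w l)) x0 i) 0 e).
by apply/funext => k; apply: eq_bigr => i _; rewrite xN.
Qed.

End Assembly.

Section StepSizes.
Context {R : realType}.
Variables (alpha : nat -> R) (c : R).
Hypothesis c0 : 0 < c.
Hypothesis alpha_gt0 : forall k, 0 < alpha k.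

Lemma steps_diverge : (\sum_(0 <= k < N) alpha k) @[N --> \oo] --> +oo ->
  forall k t, exists l, t <= \sum_(k <= i < l) c * alpha i.
Proof.
move=> /cvgryPge div k t.
have [N _ hN] := div (t / c + \sum_(0 <= i < k) alpha i).
have := hN (maxn k N) (leq_maxr k N); rewrite /= => h; exists (maxn k N).
rewrite -mulr_sumr -ler_pdivrMl // mulrC -(lerD2r (\sum_(0 <= i < k) alpha i)).
by apply: le_trans h _; rewrite [leLHS](big_cat_nat (leq0n k) (leq_maxl k N)) /= addrC.
Qed.

Hypothesis alpha_o : alpha =o_\oo (fun k => (ln (k%:R : R))^-1).

Lemma steps_log (e : R) : 0 < e -> exists N, forall k, (N <= k)%N -> c * alpha k * ln k%:R <= e.
Proof.
move=> e0; have ec : 0 < e / c by rewrite divr_gt0.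
have /eqoP/(_ _ ec)[N _ hN] := alpha_o; exists N => k /hN /=.
have [L0|L0] := leP (ln (k%:R : R)) 0.
  move=> _; apply: le_trans (ltW e0); rewrite pmulr_rle0 // mulr_gt0 //.
rewrite !gtr0_norm ?invr_gt0 // ler_pdivlMr // ler_pdivlMr // => h.
by rewrite -mulrA mulrC.
Qed.

Lemma steps_cvg0 : c * alpha k @[k --> \oo] --> 0.
Proof.
apply/cvgr0Pnorm_le => e e0.
have L2 : 0 < ln (2 : R) by rewrite ln_gt0 // ltr1n.
(* From [k >= 2] on, the logarithm is at least [ln 2], by which one may divide. *)
have [N hN] := steps_log (mulr_gt0 e0 L2); exists (maxn N 2) => // k /=.
rewrite geq_max => /andP[Nk k2]; rewrite gtr0_norm ?mulr_gt0 //.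
rewrite -(ler_pM2r L2); apply: le_trans (hN k Nk); apply: ler_wpM2l.
  by rewrite mulr_ge0 // ltW.
by rewrite ler_ln ?posrE // ?ler_nat // ltr0n (leq_trans _ k2).
Qed.

End StepSizes.

Theorem theorem4p3 (R : realType) (m n : nat) (p : option nat)
  (m_gt0 : (0 < m)%N) (n_gt0 : (0 < n)%N) (p_ge : le_exponent (maxn m 2) p)
  (f_ : 'I_n -> 'rV[R]_m -> R) (J : 'I_n -> nat)
  (Pt : forall i : 'I_n, 'I_(J i) -> set 'rV[R]_m)
  (fs : forall i : 'I_n, 'I_(J i) -> 'rV[R]_m -> R)
  (f_repr : forall i, piecewise_representation p (f_ i) (Pt i) (fs i))
  (f : 'rV[R]_m -> R)
  (fE : forall x, f x = n%:R^-1 * \sum_(i < n) f_ i x)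
  (f_bounded_below : exists b : R, forall x, b <= f x)
  (d0 : measure_display) (T0 : measurableType d0) (P0 : probability T0 R)
  (iota : T0 -> 'I_n)
  (iota_measurable : forall l, measurable (iota @^-1` [set l]))
  (iota_uniform : forall l, P0 (iota @^-1` [set l]) = (n%:R^-1)%:E)
  (P : probability (infinite_product T0) R)
  (P_product : is_product_measure P0 P)
  (alpha : nat -> R)
  (alpha_gt0 : forall k, 0 < alpha k)
  (alpha_sum : (\sum_(0 <= k < N) alpha k) @[N --> \oo] --> +oo)
  (alpha_o : alpha =o_\oo (fun k => (ln (k%:R : R))^-1))
  (interface_null : forall i, lebesgue_null (interface (Pt i))) :
  let iter (c : R) (x0 : 'rV[R]_m) (w : infinite_product T0) : nat -> 'rV[R]_m :=
    sgd (fun i => piecewise_gradient (Pt i) (fs i))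
        (fun k => c * alpha k) (fun k => iota (w k)) x0 in
  exists Gamma : set R,
    [/\ Gamma `<=` [set c | 0 < c],
        lebesgue_measure.-negligible ([set c | 0 < c] `\` Gamma),
        {ae lebesgue_measure, forall c : R,
          0 < c -> forall k, Gamma (c * alpha k)}
      & forall c : R, 0 < c -> (forall k, Gamma (c * alpha k)) ->
        exists G : set 'rV[R]_m,
          lebesgue_null (~` G) /\
          forall x0, G x0 ->
            {ae P, forall w, exists M : R,
              forall k, enorm (iter c x0 w k) <= M} ->
            {ae P, forall w,
              [/\ dist_to (iter c x0 w k)
                    [set x | clarke_subdifferential f x 0]
                    @[k --> \oo] --> 0%E,
                  cvg (f (iter c x0 w k) @[k --> \oo])
                & connected (limit_points (iter c x0 w))]}].
Proof.
case: m m_gt0 p_ge f_ Pt fs f_repr f fE f_bounded_below interface_null => [//|m'].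
move=> m_gt0 p_ge f_ Pt fs f_repr f fE f_bounded_below interface_null iter.
pose i0 := Ordinal n_gt0.
have triv i : trivIset setT (Pt i) by have [_ [_ _ ]] := f_repr i.
have cover i : \bigcup_j Pt i j = setT by have [_ [_ _ ]] := f_repr i.
have fs2 i j : continuously_differentiable 2 (fs i j).
  by have [_ _ h _] := f_repr i; apply: class_C_CD p_ge (leq_maxr _ _) (h j).
have fsm i j : continuously_differentiable m'.+1 (fs i j).
  by have [_ _ h _] := f_repr i; apply: class_C_CD p_ge (leq_maxl _ _) (h j).
have cf_ i : continuous (f_ i) by have [] := f_repr i.
have f_E i j x : Pt i j x -> f_ i x = fs i j x by have [_ _ _] := f_repr i; exact.
(* All pieces of all summands in one countable family, so that one set of step sizes suits every
   possible step. *)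
pose g (k : {i : 'I_n & 'I_(J i)}) := fs (tag k) (tagged k).
have g2 k : continuously_differentiable 2 (g k) by exact: fs2.
exists (good_steps g); split.
- by move=> c [].
- by apply: countable_negligible; exact: countable_bad_steps.
- exact: ae_good_steps.
move=> c c0 good.
have [|G [nG hG]] := @good_starts R m' n (fun i => piecewise_gradient (Pt i) (fs i))
    (fun k => c * alpha k) _ i0 (fun i => interface (Pt i)) interface_null.
  move=> k i N nN; apply: piecewise_step_preimage_null => // j.
  by have [_ h] := good k; exact: (h (Tagged (fun i => 'I_(J i)) j)).
exists G; split=> // x0 Gx0.
have a0 k : 0 < c * alpha k by rewrite mulr_gt0.
apply: (iterates_converge_almost_surely i0 triv cover fs2 fsm cf_ f_E fE a0) => //.
- exact: steps_cvg0.
- exact: steps_diverge.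
- by move=> e e0; exact: steps_log.
- exact: hG.
Qed.
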